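(* Let $n\ge 1$ and let $f_i(z)=q_i(z)+Q_i(z)$, $i=1,\dots,n$, be polynomials in $z=(z_1,\dots,z_n)\in\mathbb C^n$, where $$q_i(z)=\prod_{j=1}^n(1-a_{ij}z_j)^{m_{ij}},$$ the $m_{ij}$ are positive integers, the $a_{ij}$ are complex numbers with $a_{ij}\ne a_{kj}$ whenever $i\neq k$ (for every $j$), and $$Q_i(z)=z_1\cdots z_n\sum_{\alpha}C^i_\alpha z^\alpha$$ (a finite sum over multi-indices $\alpha\in\mathbb Z_{\ge0}^n$, $C^i_\alpha\in\mathbb C$) satisfies $\deg_{z_j}Q_i\le m_{ij}$ for all $i,j$ with $a_{ij}\neq 0$ (no restriction on $\deg_{z_j}Q_i$ if $a_{ij}=0$). Let $z^{(j)}=(z_{j1},\dots,z_{jn})$, $j=1,\dots,p$, be all the zeros, counted with multiplicities, of the system $f_1(z)=\dots=f_n(z)=0$ in $\mathbb C^n$ that do not lie in the coordinate hyperplanes $\{z_k=0\}$ (there are finitely many). Let $\gamma=(\gamma_1,\dots,\gamma_n)\in\mathbb Z_{\ge 0}^n$. Then, with the notation $\widetilde q_i,\widetilde Q_i,\widetilde\Delta,a_J,\beta(K,J),\widetilde q^{K+I}(J),\mathfrak R,T_J$ of the context, the power sum $\sigma_{\gamma+I}=\sum_{j=1}^p z_{j1}^{-\gamma_1-1}\cdots z_{jn}^{-\gamma_n-1}$ satisfies $$\sigma_{\gamma+I}=\sum_{j=1}^p\frac1{z_{j1}^{\gamma_1+1}\cdots z_{jn}^{\gamma_n+1}} =\frac1{(2\pi\sqrt{-1})^n}\sum_{\|K\|\ge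 0}(-1)^{\|K\|+n}\sum_J(-1)^{s(J)}\int_{T_J}\widetilde\Delta\cdot w_1^{\gamma_1+1}\cdots w_n^{\gamma_n+1}\cdot\frac{\widetilde Q_1^{k_1}\cdots\widetilde Q_n^{k_n}}{\widetilde q_1^{\,k_1+1}\cdots\widetilde q_n^{\,k_n+1}}\,dw$$ $$=\sum_{K\in\mathfrak R}(-1)^{\|K\|+n}\sum_J\frac{(-1)^{s(J)}}{\beta(K,J)!}\cdot\frac{\partial^{\|\beta(K,J)\|}}{\partial w^{\beta(K,J)}}\left[\widetilde\Delta\cdot w_1^{\gamma_1+1}\cdots w_n^{\gamma_n+1}\cdot\frac{\widetilde Q^K}{\widetilde q^{K+I}(J)}\right]_{w=a_J}.$$ Here the sums over $J$ run over all $n!$ permutations $J$ of $(1,\dots,n)$, and the sum over $\|K\|\ge0$ runs over all $K=(k_1,\dots,k_n)\in\mathbb Z_{\ge0}^n$.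
   Context: Convention: if $a_{ij}=0$, the exponent $m_{ij}$ does not affect $q_i$; in that case (and $Q_i\not\equiv0$) one takes $m_{ij}:=\deg_{z_j}Q_i$ in all the formulas below. Notation. For a multi-index $\alpha$, $\|\alpha\|=\alpha_1+\dots+\alpha_n$ and $z^\alpha=z_1^{\alpha_1}\cdots z_n^{\alpha_n}$; $I=(1,\dots,1)$. For $w=(w_1,\dots,w_n)$ set $$\widetilde q_i(w)=\prod_{j=1}^n(w_j-a_{ij})^{m_{ij}},\qquad \widetilde Q_i(w)=w_1^{m_{i1}}\cdots w_n^{m_{in}}\,Q_i(1/w_1,\dots,1/w_n),$$ so that $\widetilde Q_i$ is a polynomial with $\deg_{w_j}\widetilde Q_i<m_{ij}$. $\widetilde\Delta=\widetilde\Delta(w)$ is the Jacobian determinant $\det\big(\partial(\widetilde q_i+\widetilde Q_i)/\partial w_j\big)_{i,j=1}^n$. For $K=(k_1,\dots,k_n)\in\mathbb Z_{\ge0}^n$, $\widetilde Q^K=\widetilde Q_1^{k_1}\cdots\widetilde Q_n^{k_n}$. For a permutation $J=(j_1,\dots,j_n)$ of $(1,\dots,n)$: $(-1)^{s(J)}$ is its sign; $a_J=(a_{j_11},a_{j_22},\dots,a_{j_nn})\in\mathbb C^n$ (the $k$-th coordinate $w_k$ equals $a_{j_kk}$); $$\beta(K,J)=\big(m_{j_11}(k_{j_1}+1)-1,\dots,m_{j_nn}(k_{j_n}+1)-1\big),\qquad \beta(K,J)!=\prod_{l=1}^n\big(m_{j_ll}(k_{j_l}+1)-1\big)!;$$ $$\widetilde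 q^{K+I}(J)=\prod_{l=1}^n\left(\frac{\widetilde q_{j_l}(w)}{(w_l-a_{j_ll})^{m_{j_ll}}}\right)^{k_{j_l}+1},$$ which is nonzero at $w=a_J$. $\partial^{\|\beta\|}/\partial w^{\beta}$ denotes $\partial^{\beta_1+\dots+\beta_n}/\partial w_1^{\beta_1}\cdots\partial w_n^{\beta_n}$. $T_J=\{w:\ |w_k-a_{j_kk}|=\varepsilon_k,\ k=1,\dots,n\}$, with sufficiently small $\varepsilon_k>0$, each circle being oriented counterclockwise and $T_J$ carrying the product orientation; $dw=dw_1\wedge\dots\wedge dw_n$. $\mathfrak R=\{K\in\mathbb Z_{\ge0}^n:\ \text{there exists } i\in\{1,\dots,n\}\text{ with }\|K\|<\gamma_i+2\}$, a finite set.
   Formalization: The printed sign is wrong for odd n (n=1, f=1-z, γ=0: σ=1 but the right-hand sides equal -1); what is proved has (-1)^n σ_{γ+I} in place of σ_{γ+I} on the left, i.e. the sign (-1)^{||K||} instead of (-1)^{||K||+n}; for even n it is the printed formula. *)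

(* Defs.v *)
(* MathComp-Analysis, over an arbitrary [R : realType]: the complex numbers are
   [R[i]], a point of C^n is a row vector, a multi-index is a [multinom n].
   The notations of mpoly.v clash with those of MathComp-Analysis and are
   therefore not imported. *)
From HB Require Import structures.
From mathcomp Require Export all_boot all_order all_algebra all_fingroup finmap.
From mathcomp Require Export complex.
From mathcomp Require Export all_classical all_reals all_analysis.
From mathcomp Require Export -(notations) mpoly.
Export numFieldNormedType.Exports.

Set Implicit Arguments.
Unset Strict Implicit.
Unset Printing Implicit Defensive.
Export Order.TTheory GRing.Theory Num.Theory.
#[export] Set Warnings "-notation-incompatible-prefix,-notation-overridden".

Local Open Scope classical_set_scope.
Local Open Scope ring_scope.
Local Open Scope complex_scope.

Notation "{ 'mpoly' R [ n ] }" := (mpoly n R)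
  (at level 0, R, n at level 2, format "{ 'mpoly'  R [ n ] }") : type_scope.
Notation "p .@[ x ]" := (meval (fun j => fun_of_matrix x ord0 j) p)
  (at level 1, format "p .@[ x ]") : ring_scope.

Section Multiplicity.
Variables (R : realType) (n : nat).
Local Notation C := R[i].
Local Notation P := {mpoly C[n]}.

(* [deg_{z_j} p]; it is 0 for p = 0. *)
Definition degz (j : 'I_n) (p : P) : nat := (\max_(al <- msupp p) al j)%N.

(* The local ring O_x of C^n at x, inside the field C(z_1, ..., z_n). *)
Definition local_ring (x : 'rV[C]_n) : set {fraction P} :=
  [set y | exists g s : P, s.@[x] != 0 /\ y = tofrac g / tofrac s].

Definition local_ideal (f : 'I_n -> P) (x : 'rV[C]_n) : set {fraction P} :=
  [set y | exists2 h : 'I_n -> {fraction P},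
     (forall i, local_ring x (h i)) & y = \sum_i h i * tofrac (f i)].

(* dim_C O_x / (f_1, ..., f_n) O_x = d: there are d elements of O_x whose
   classes form a basis of the quotient. *)
Definition has_multiplicity (f : 'I_n -> P) (x : 'rV[C]_n) (d : nat) : Prop :=
  exists2 b : 'I_d -> {fraction P}, (forall i, local_ring x (b i)) &
    forall y, local_ring x y ->
      exists! c : 'rV[C]_d,
        local_ideal f x (y - \sum_i tofrac (mpolyC n (c ord0 i)) * b i).

Definition is_zero (f : 'I_n -> P) (x : 'rV[C]_n) : Prop :=
  forall i, (f i).@[x] = 0.

Definition off_hyperplanes (x : 'rV[C]_n) : Prop := forall k, x ord0 k != 0.

Definition zeros_with_multiplicity (f : 'I_n -> P) (zs : seq 'rV[C]_n) : Prop :=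
  (forall x, x \in zs -> is_zero f x /\ off_hyperplanes x) /\
  (forall x, is_zero f x -> off_hyperplanes x ->
     x \in zs /\ has_multiplicity f x (count_mem x zs)).

End Multiplicity.

Section System.
Variables (R : realType) (n : nat).
Local Notation C := R[i].
Local Notation P := {mpoly C[n]}.
Local Notation "''X_' i" := (mpolyX C (mnm1 i)).
Variables (a : 'I_n -> 'I_n -> C) (m : 'I_n -> 'I_n -> nat) (c : 'I_n -> P).

(* [c i] is the polynomial sum_al C^i_al z^al. *)
Definition Q (i : 'I_n) : P := (\prod_j 'X_j) * c i.

Definition q (i : 'I_n) : P := \prod_j (1 - a i j *: 'X_j) ^+ m i j.

Definition sys (i : 'I_n) : P := q i + Q i.

(* The exponents used everywhere below: when a_ij = 0, the exponent m_ij does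
   not affect q_i, and it is replaced by deg_{z_j} Q_i if Q_i is not 0. *)
Definition mexp (i j : 'I_n) : nat :=
  if (a i j == 0) && (Q i != 0) then degz j (Q i) else m i j.

Definition qt (i : 'I_n) : P :=
  \prod_j ('X_j - mpolyC n (a i j)) ^+ mexp i j.

(* The polynomial w^{m_i} Q_i(1/w), see [meval_Qt]; the truncated subtraction
   is exact because deg_{z_j} Q_i <= mexp i j. *)
Definition Qt (i : 'I_n) : P :=
  \sum_(al <- msupp (Q i))
    mcoeff al (Q i) *: mpolyX C (Multinom [tuple (mexp i j - al j)%N | j < n]).

Lemma meval_Qt (i : 'I_n) (w : 'rV[C]_n) :
    (forall j, degz j (Q i) <= mexp i j)%N -> off_hyperplanes w ->
  (Qt i).@[w] =
  (\prod_j w ord0 j ^+ mexp i j) * (Q i).@[\row_j (w ord0 j)^-1].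
Proof.
move=> degQ w_neq0; rewrite /Qt raddf_sum /= mevalE big_distrr /=.
apply: eq_big_seq => al al_Q; rewrite mevalZ mevalX mulrCA; congr (_ * _).
rewrite -big_split /=; apply: eq_bigr => j _; rewrite mxE multinomE tnth_mktuple.
have le_al : (al j <= mexp i j)%N.
  apply: leq_trans (degQ j).
  exact: (@leq_bigmax_seq _ _ xpredT (fun k : multinom n => k j) _ al_Q isT).
by rewrite exprVn expfB_cond ?(negbTE (w_neq0 j)).
Qed.

Definition Delta : P := \det (\matrix_(i, j) mderiv j (qt i + Qt i)).

Definition aJ (J : 'S_n) : 'rV[C]_n := \row_k a (J k) k.

Definition beta (K : multinom n) (J : 'S_n) (l : 'I_n) : nat :=
  (mexp (J l) l * (K (J l)).+1 - 1)%N.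

(* The factor (w_l - a_{j_l l})^{m_{j_l l}} of qt (J l) is cancelled as
   polynomials, since the value at [aJ J] is needed, see [qt_split]. *)
Definition qKIJ (K : multinom n) (J : 'S_n) : P :=
  \prod_l (\prod_(t | t != l)
    ('X_t - mpolyC n (a (J l) t)) ^+ mexp (J l) t) ^+ (K (J l)).+1.

Lemma qt_split (J : 'S_n) (l : 'I_n) :
  qt (J l) = ('X_l - mpolyC n (a (J l) l)) ^+ mexp (J l) l *
    \prod_(t | t != l) ('X_t - mpolyC n (a (J l) t)) ^+ mexp (J l) t.
Proof. by rewrite /qt (bigD1 l). Qed.

(* Delta * w^{gam + I} * Qt^K / qt^{K + I} *)
Definition integrand (gam K : multinom n) (w : 'rV[C]_n) : C :=
  Delta.@[w] * (\prod_k w ord0 k ^+ (gam k).+1) *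
  ((\prod_i (Qt i).@[w] ^+ K i) / (\prod_i (qt i).@[w] ^+ (K i).+1)).

(* Delta * w^{gam + I} * Qt^K / qt^{K + I}(J) *)
Definition reduced_integrand (gam K : multinom n) (J : 'S_n) (w : 'rV[C]_n) : C :=
  Delta.@[w] * (\prod_k w ord0 k ^+ (gam k).+1) *
  ((\prod_i (Qt i).@[w] ^+ K i) / (qKIJ K J).@[w]).

End System.

Section Analysis.
Variables (R : realType).
Local Notation C := R[i].

Definition cintegral (lo hi : R) (g : R -> C) : C :=
  Rintegral lebesgue_measure `[lo, hi] (fun t => complex.Re (g t)) +i*
  Rintegral lebesgue_measure `[lo, hi] (fun t => complex.Im (g t)).

(* The integral of g over the counterclockwise circle |z - z0| = r, with
   z = z0 + r e^{it} and dz = i r e^{it} dt. *)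
Definition circle_integral (z0 : C) (r : R) (g : C -> C) : C :=
  cintegral 0 (2 * pi) (fun t =>
    let e := r%:C * (cos t +i* sin t) in g (z0 + e) * ((0 +i* 1) * e)).

Variable n : nat.

Definition upd (w : 'rV[C]_n) (k : 'I_n) (z : C) : 'rV[C]_n :=
  \row_j (if j == k then z else w ord0 j).

(* The integral of F dw_1 /\ ... /\ dw_n over the torus |w_k - z0_k| = eps_k
   with the product orientation, as an iterated integral; every coordinate of
   the starting point [z0] is overwritten. *)
Definition torus_integral (z0 : 'rV[C]_n) (eps : 'I_n -> R)
    (F : 'rV[C]_n -> C) : C :=
  foldr (fun k G w => circle_integral (z0 ord0 k) (eps k) (fun z => G (upd w k z)))
    F (enum 'I_n) z0.

(* The complex partial derivative in the l-th variable ([C^o] carries the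
   topology of C). *)
Definition pderiv (l : 'I_n) (F : 'rV[C]_n -> C) : 'rV[C]_n -> C :=
  fun w => 'D_(delta_mx ord0 l) (F : 'rV[C]_n -> C^o) w.

Definition mixed_pderiv (b : 'I_n -> nat) (F : 'rV[C]_n -> C) : 'rV[C]_n -> C :=
  foldr (fun l G => iter (b l) (pderiv l) G) F (enum 'I_n).

(* Unordered summation over all multi-indices. *)
Definition has_msum (u : multinom n -> C) (s : C) : Prop :=
  forall e : R, 0 < e -> exists A : {fset (multinom n)}, forall B : {fset (multinom n)},
    (A `<=` B)%fset -> `|\sum_(K <- B) u K - s| < e%:C.

(* mdeg K is ||K||. *)
Definition frakR (gam : multinom n) : set (multinom n) :=
  [set K | exists i, (mdeg K < gam i + 2)%N].

Lemma finite_frakR (gam : multinom n) : finite_set (frakR gam).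
Proof.
pose d := ((\max_i gam i) + 2)%N.
apply: (@sub_finite_set _ _ (range (@bmnm n d))); last exact/finite_image/finite_finset.
move=> K [i ltKi]; have ltKd : (mdeg K < d)%N.
  by apply: leq_trans ltKi _; rewrite leq_add2r; apply: leq_bigmax.
by exists (BMultinom ltKd).
Qed.

End Analysis.

(* Main.v *)
(* In the coordinates w = 1/z the system is F = 0 with F_i = qt_i + Qt_i, and Qt_i
   has degree less than mexp i j in each w_j. As qt_i is a product of powers of the
   w_j - a_ij, the residues of p dw / qt^{K + I} are products of one-variable
   residues, which are defined algebraically. The finite sum
     rho p = \sum_K (-1)^{||K||} Res (p Qt^K / qt^{K + I})
   telescopes to 0 on the ideal (F). The Bezoutian B(w, v) is the determinant of the
   difference quotients of F between two points. By Cramer's rule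
   h(v) B(w, v) = h(w) B(w, v) modulo F(w) and F(v), and rho applied in v to B
   gives 1: by a degree count only the Bezoutian of the qt_i matters, and its residues
   at the a_J add up to 1 like the probabilities of a sampling without replacement. Hence B
   provides dual families of C[w] / (F) for the pairing rho (g h); as B is the
   Jacobian determinant on the diagonal, rho (h Delta) is the trace of the
   multiplication by h. Trigonalizing the multiplications by the w_j simultaneously,
   this trace is the sum of the values of h at the zeros of F, with the dimensions
   of the local components as multiplicities. For h = w^{gamma + I} the values at
   zeros in the coordinate hyperplanes are 0, and a degree count shows that only
   the K in frakR contribute to rho. *)

From HB Require Import structures.
Require Import Defs.
From mathcomp Require Import ring zify.
Set Implicit Arguments.
Unset Strict Implicit.
Unset Printing Implicit Defensive.
Local Open Scope ring_scope.

(** * Algebraic residues *)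

(** Algebraic residues make multiple zeros harmless: no perturbation of the system and no Stokes'
    theorem is called upon, and integrals and derivatives enter only at the end, where for each
    monomial of the numerator they split into one-variable ones. The engine is the strict bound
    deg_{w_j} Qt_i < mexp i j, which stems from the factor z_1 ... z_n of Q_i: each further factor
    Qt_i / qt_i gains one order of decay in every variable, so that only finitely many K matter for
    a given numerator. Geometrically, F has no zeros at infinity in the product of n projective
    lines. Nothing is assumed about the finiteness of C[w] / (F) or of the set of zeros: both follow
    from the Bezoutian, whose finitely many monomials yield a spanning family of the quotient. The
    multiplicities of the statement are dimensions over the local rings of f at z, whereas the trace
    lives in C[w] / (F). The two are compared on the component cut out by an idempotent, along w =
    1/z. *)

Section OneVariable.
Variables (C : numFieldType) (I : finType) (a : I -> C).
Hypothesis a_inj : injective a.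
Implicit Types (p r s : {poly C}) (e : I -> nat) (i j k : I).

(* The numerator of the [k]-th derivative of [p / r] over [r ^+ k.+1]. *)
Fixpoint dnum r p n : {poly C} :=
  if n is n'.+1 then (dnum r p n')^`() * r - (dnum r p n' * r^`()) *+ n else p.

Lemma dnum_linear r n : linear (dnum r ^~ n).
Proof.
elim: n => [//|n IHn] c p q /=; rewrite IHn derivD derivZ mulrDl -scalerAl.
by rewrite mulrDl -scalerAl mulrnDl scalerBr -scalerMnr opprD addrACA.
Qed.

(** Leibniz's rule for the product of ['X - x%:P] and [p / r], the first factor having no second
    derivative; the factor [r] brings the [n]-th derivative to the denominator [r ^+ n.+2]. *)
Lemma dnum_mulXsub r p x n :
  dnum r (('X - x%:P) * p) n.+1 =
  ('X - x%:P) * dnum r p n.+1 + (dnum r p n * r) *+ n.+1.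
Proof.
elim: n => [|n IHn].
  by rewrite /= derivM derivXsubC mul1r !mulr1n; ring.
have E : dnum r p n.+1 = (dnum r p n)^`() * r - (dnum r p n * r^`()) *+ n.+1 by [].
rewrite [LHS]/= -/(dnum r _ n.+1) IHn [dnum r p n.+2]/= -/(dnum r p n.+1).
rewrite derivD derivM derivXsubC mul1r derivMn derivM.
move: (dnum r p n.+1) E => u ->; move: ((_ - _)^`()) => u'.
ring.
Qed.

Lemma dnumM r p s n : dnum (r * s) (p * s) n = dnum r p n * s ^+ n.+1.
Proof.
elim: n => [//|n IHn]; rewrite [LHS]/= IHn [dnum r p n.+1]/=.
rewrite !derivM deriv_exp /= [s ^+ n.+2]exprS [s ^+ n.+1]exprS; ring.
Qed.

Definition cofactor_poly i e : {poly C} := \prod_(k | k != i) ('X - (a k)%:P) ^+ e k.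

(* The residue at [a i] of [p / \prod_k ('X - a k) ^+ e k]. *)
Definition residue i e p : C :=
  if e i is b.+1 then
    (dnum (cofactor_poly i e) p b).[a i] / (cofactor_poly i e).[a i] ^+ b.+1 / b`!%:R
  else 0.

Lemma cofactor_poly_neq0 i e : (cofactor_poly i e).[a i] != 0.
Proof.
rewrite horner_prod; apply/prodf_neq0 => k ki.
by rewrite horner_exp expf_neq0// hornerXsubC subr_eq0 (inj_eq a_inj) eq_sym.
Qed.

Lemma residue_linear i e : linear_for *%R (residue i e).
Proof.
move=> c p q; rewrite /residue; case: (e i) => [|b]; first by rewrite mulr0 addr0.
by rewrite dnum_linear hornerD hornerZ !mulrDl !mulrA.
Qed.

HB.instance Definition _ i e :=
  GRing.isLinear.Build C {poly C} C _ (residue i e) (residue_linear i e).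

Lemma eq_residue i e e' p : e =1 e' -> residue i e p = residue i e' p.
Proof.
move=> ee'; rewrite /residue; have -> : cofactor_poly i e = cofactor_poly i e'.
  by apply: eq_bigr => k _; rewrite ee'.
by rewrite ee'.
Qed.

Lemma residue0 i e p : e i = 0%N -> residue i e p = 0.
Proof. by rewrite /residue => ->. Qed.

Definition incr e k : I -> nat := fun j => (e j + (j == k))%N.

(** Cancelling a common factor does not change the fraction. For [i = k] the differentiation has one
    order more, and Leibniz's rule supplies the factor that the factorial gains; otherwise the
    factor is absorbed by the cofactor. *)
Lemma residue_incr i k e p :
  residue i (incr e k) (p * ('X - (a k)%:P)) = residue i e p.
Proof.
have [->{i}|ki] := eqVneq i k.
  have -> : residue k (incr e k) = fun p =>
    (dnum (cofactor_poly k e) p (e k)).[a k] / (cofactor_poly k e).[a k] ^+ (e k).+1 / (e k)`!%:R.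
    rewrite /residue /incr eqxx addn1.
    rewrite (_ : cofactor_poly _ _ = cofactor_poly k e)//.
    by apply: eq_bigr => j /negbTE jk; rewrite jk addn0.
  rewrite /residue; case: (e k) => [|b].
    by rewrite /= hornerM hornerXsubC subrr mulr0 !mul0r.
  rewrite [p * _]mulrC dnum_mulXsub hornerD hornerM hornerXsubC subrr mul0r add0r.
  rewrite hornerMn hornerM.
  have := cofactor_poly_neq0 k e.
  set x := (dnum _ _ _).[_]; set y := (cofactor_poly k e).[a k] => y0.
  have bb : b`!%:R != 0 :> C by rewrite pnatr_eq0 -lt0n fact_gt0.
  have b1 : b.+1%:R != 0 :> C by rewrite pnatr_eq0.
  rewrite factS natrM -mulr_natr [y ^+ b.+2]exprS; move: b.+1%:R b1 => c c0.
  have : y ^+ b.+1 != 0 by rewrite expf_neq0.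
  by move: (y ^+ _) => z z0; field; rewrite c0 bb z0 y0.
rewrite /residue /incr (negbTE ki) addn0.
case E : (e i) => [//|b].
have -> : cofactor_poly i (incr e k) = cofactor_poly i e * ('X - (a k)%:P).
  rewrite /cofactor_poly (bigD1 k) 1?eq_sym//= [in RHS](bigD1 k) 1?eq_sym//= /incr eqxx addn1 exprSr.
  rewrite -!mulrA [('X - _) * _]mulrC; congr (_ * (_ * _)).
  by apply: eq_bigr => j /andP[_ /negbTE ->]; rewrite addn0.
rewrite dnumM hornerM horner_exp hornerM exprMn invfM mulrACA.
by rewrite divff ?mulr1// expf_neq0// hornerXsubC subr_eq0 (inj_eq a_inj).
Qed.

(* Partial fractions: [p / \prod_k ('X - a k) ^+ e k] is a combination of a
   polynomial and of powers of the [1 / ('X - a k)]. *)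
Lemma fraction_ind (T U : (I -> nat) -> {poly C} -> C) :
  (forall e c p q, T e (c *: p + q) = c * T e p + T e q) ->
  (forall e c p q, U e (c *: p + q) = c * U e p + U e q) ->
  (forall e k p, T (incr e k) (p * ('X - (a k)%:P)) = T e p) ->
  (forall e k p, U (incr e k) (p * ('X - (a k)%:P)) = U e p) ->
  (forall e p, (forall k, e k = 0%N) -> T e p = U e p) ->
  (forall e k n, (forall j, e j = (j == k) * n.+1)%N -> T e 1 = U e 1) ->
  (forall e e', e =1 e' -> T e =1 T e') -> (forall e e', e =1 e' -> U e =1 U e') ->
  forall e p, T e p = U e p.
Proof.
move=> Tl Ul Ti Ui TU0 TUn Tx Ux e p.
have [n] := ubnP (\sum_k e k)%N; elim: n e p => // n IHn e p le_en.
have [e0|] := boolP [forall k, e k == 0%N].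
  by apply: TU0 => k; apply/eqP/(forallP e0).
rewrite negb_forall => /existsP[k ek].
pose decr e k := fun j => (e j - (j == k))%N.
have eK f j : f j != 0%N -> f =1 incr (decr f j) j.
  move=> fj l; rewrite /incr /decr; case: eqVneq => [->|]; last by rewrite subn0 addn0.
  by rewrite subnK// lt0n.
have lt_decr f j : f j != 0%N -> (\sum_k f k < n.+1)%N -> (\sum_k decr f j k < n)%N.
  move=> fj lt_fn; rewrite -ltnS (leq_trans _ lt_fn)// ltnS (bigD1 j)// [in leqRHS](bigD1 j)//=.
  rewrite /decr eqxx -addSn leq_add//; first by rewrite subn1 prednK// lt0n.
  by apply: leq_sum => l _; apply: leq_subr.
have one : T e 1 = U e 1.
  have [e0|] := boolP [forall j, (j != k) ==> (e j == 0%N)].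
    apply: (TUn e k (e k).-1) => j; rewrite prednK ?lt0n//.
    case: eqVneq => [->|jk]; first by rewrite mul1n.
    by move/forallP/(_ j): e0; rewrite jk => /eqP.
  rewrite negb_forall => /existsP[j]; rewrite negb_imply => /andP[jk ej].
  have ajk : a j - a k != 0 by rewrite subr_eq0 (inj_eq a_inj).
  (* With two distinct poles, 1 is a combination of ['X - a k] and ['X - a j], each of which lowers
     the total order. The summand 0 only provides the shape required by linearity. *)
  have -> : 1 = (a j - a k)^-1 *: (1 * ('X - (a k)%:P)) +
     ((- (a j - a k)^-1) *: (1 * ('X - (a j)%:P)) + 0) :> {poly C}.
    rewrite !mul1r addr0 scaleNr -scalerBr.
    rewrite [X in _ *: X](_ : _ = (a j - a k)%:P); last by rewrite rmorphB/=; ring.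
    by rewrite -mul_polyC -rmorphM/= mulVf.
  rewrite !Tl !Ul; congr (_ * _ + (_ * _ + _)).
  - by rewrite (Tx _ _ (eK _ _ ek)) (Ux _ _ (eK _ _ ek)) Ti Ui IHn// lt_decr.
  - by rewrite (Tx _ _ (eK _ _ ej)) (Ux _ _ (eK _ _ ej)) Ti Ui IHn// lt_decr.
  - rewrite -[X in T e X](mul0r ('X - (a j)%:P)) -[X in U e X](mul0r ('X - (a j)%:P)).
    by rewrite (Tx _ _ (eK _ _ ej)) (Ux _ _ (eK _ _ ej)) Ti Ui IHn// lt_decr.
have : root (p - p.[a k]%:P) (a k) by rewrite rootE !hornerE subrr.
rewrite -dvdp_XsubCl => /dvdpP[q def_p].
have -> : p = p.[a k] *: 1 + q * ('X - (a k)%:P).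
  by rewrite -def_p -mul_polyC mulr1 addrC subrK.
rewrite Tl Ul one; congr (_ + _).
by rewrite (Tx _ _ (eK _ _ ek)) (Ux _ _ (eK _ _ ek)) Ti Ui IHn// lt_decr.
Qed.

Lemma dnum1 p n : dnum 1 p n = p^`(n).
Proof.
by elim: n => //= n ->; rewrite mulr1 poly.derivE mulr0 mul0rn subr0.
Qed.

Lemma residue_pole i j e n : (forall k, e k = (k == i) * n.+1)%N ->
  residue j e 1 = (j == i)%:R * (n == 0%N)%:R.
Proof.
move=> def_e; rewrite /residue def_e.
case: eqVneq => [->|]; last by rewrite mul0r.
have -> : cofactor_poly i e = 1.
  by rewrite /cofactor_poly big1// => k /negbTE ki; rewrite def_e ki expr0.
rewrite !mul1n dnum1 hornerC expr1n.
case: n {def_e} => [|n]; first by rewrite hornerC !divr1 mulr1.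
by rewrite derivSn derivC linear0 horner0 !mul0r mulr0.
Qed.

(* The sum of the residues is minus the residue at infinity. *)
Lemma sum_residue e p : (size p <= \sum_k e k)%N ->
  \sum_i residue i e p = p`_(\sum_k e k).-1.
Proof.
move=> le_pe.
pose M e := \prod_k ('X - (a k)%:P) ^+ e k.
have M_monic e' : M e' \is monic.
  by apply: monic_prod => k _; rewrite monic_exp ?monicXsubC.
have szM e' : size (M e') = (\sum_k e' k).+1.
  rewrite size_prod => [|k _]; last by rewrite expf_neq0// polyXsubC_eq0.
  rewrite (eq_bigr (fun k => e' k + 1)%N) => [|k _]; last by rewrite size_exp_XsubC addn1.
  by rewrite big_split/= sum1_card -addSn addnK.
have Mincr e' k : M (incr e' k) = M e' * ('X - (a k)%:P).
  rewrite /M (bigD1 k)//= [in RHS](bigD1 k)//= /incr eqxx addn1 exprSr.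
  rewrite -!mulrA [('X - _) * _]mulrC; congr (_ * (_ * _)).
  by apply: eq_bigr => j /negbTE ->; rewrite addn0.
(* Division by [M e] splits off the polynomial part, which has no residues. With the remainder the
   identity holds for every [p], as the induction on fractions needs. *)
transitivity ((p %% M e)`_(\sum_k e k).-1); last by rewrite modp_small// szM ltnS.
have sz_mod e' q : (size (q %% M e')%R <= \sum_k e' k)%N.
  by rewrite -ltnS -szM ltn_modp monic_neq0.
pose T e p := \sum_i residue i e p.
pose U e p := (p %% M e)`_(\sum_k e k).-1.
rewrite -/(T e p) -/(U e p).
apply: fraction_ind => {e p le_pe}.
- move=> e c p q; rewrite mulr_sumr -big_split; apply: eq_bigr => i _.
  by rewrite residue_linear.
- by move=> e c p q; rewrite /U modpD modpZl coefD coefZ.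
- by move=> e k p; apply: eq_bigr => i _; rewrite residue_incr.
- move=> e k p; have sum_incr : (\sum_j incr e k j = (\sum_j e j).+1)%N.
    rewrite /incr big_split/= [X in (_ + X)%N](bigD1 k)//= eqxx.
    by rewrite [X in (_ + (_ + X))%N]big1 => [|j /negbTE ->//]; rewrite addn0 addn1.
  have mod_incr : (p %% M e) * ('X - (a k)%:P) = (p * ('X - (a k)%:P)) %% M (incr e k).
    apply: (@modpP _ _ (p %/ M e)); first by rewrite Mincr {1}(divp_eq p (M e)) mulrDl mulrA.
    rewrite szM sum_incr; have [->|q0] := eqVneq (p %% M e) 0; first by rewrite mul0r size_poly0.
    by rewrite size_Mmonic ?monicXsubC// size_XsubC addn2 !ltnS.
  rewrite /U -mod_incr sum_incr /=.
  rewrite mulrBr coefB coefMX mulrC mul_polyC coefZ.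
  have -> : (p %% M e)`_(\sum_k e k) = 0 by rewrite nth_default.
  (* If the orders sum to 0, the predecessor in the index is truncated; the remainder is then 0. *)
  rewrite mulr0 subr0; case: eqP => // E0.
  have := sz_mod e p; rewrite E0 leqn0 size_poly_eq0 => /eqP ->.
  by rewrite coef0.
- move=> e p e0; rewrite /T /U big1 => [|i _]; last by rewrite residue0.
  have := sz_mod e p; rewrite big1//.
  by rewrite leqn0 size_poly_eq0 => /eqP ->; rewrite coef0.
- move=> e k n ek; rewrite /T /U.
  rewrite (eq_bigr _ (fun i _ => residue_pole i ek)).
  have sum_e : (\sum_k e k)%N = n.+1.
    rewrite (bigD1 k)//= big1 ?ek ?eqxx ?mul1n ?addn0// => j /negbTE jk.
    by rewrite ek jk.
  rewrite (bigD1 k)//= eqxx big1 ?addr0 ?mul1r; last first.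
    by move=> j /negbTE ->; rewrite mul0r.
  by rewrite modp_small ?szM sum_e ?size_poly1//= coef1.
- by move=> e e' ee' p; apply: eq_bigr => i _; apply: eq_residue.
- move=> e e' ee' p; rewrite /U; have -> : M e = M e'.
    by apply: eq_bigr => k _; rewrite ee'.
  by rewrite (eq_bigr e').
Qed.

End OneVariable.

(** * Linear functionals and degrees in several variables *)

Section LinearExtension.
Variables (C : comRingType) (n : nat).
Local Notation P := {mpoly C[n]}.
Local Notation "''X_' i" := (mpolyX C (mnm1 i)).
Implicit Types (f : multinom n -> C) (p q : P).

Definition mlinear f p : C := \sum_(al <- msupp p) mcoeff al p * f al.

Lemma mlinear_wider f p (s : seq (multinom n)) : uniq s -> {subset msupp p <= s} ->
  mlinear f p = \sum_(al <- s) mcoeff al p * f al.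
Proof.
move=> s_uniq sub; rewrite (bigID (mem (msupp p)))/= addrC big1 ?add0r => [|al].
  have eq_s : perm_eq (msupp p) [seq al <- s | al \in msupp p].
    apply: uniq_perm; [exact: msupp_uniq | by rewrite filter_uniq|].
    by move=> al; rewrite mem_filter; case: (boolP (al \in _)) => //= /sub ->.
  by rewrite {1}/mlinear (perm_big _ eq_s) big_filter.
by move/memN_msupp_eq0 ->; rewrite mul0r.
Qed.

Lemma mlinear_linear f : linear_for *%R (mlinear f).
Proof.
move=> c p q; pose s := undup (msupp p ++ msupp q ++ msupp (c *: p + q)).
have s_uniq : uniq s by rewrite undup_uniq.
rewrite !(@mlinear_wider f _ s)//; first last.
- by move=> al al_p; rewrite mem_undup !mem_cat al_p !orbT.
- by move=> al al_p; rewrite mem_undup !mem_cat al_p.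
- by move=> al al_p; rewrite mem_undup !mem_cat al_p orbT.
rewrite mulr_sumr -big_split; apply: eq_bigr => al _ /=.
by rewrite mcoeffD mcoeffZ mulrDl mulrA.
Qed.

HB.instance Definition _ f :=
  GRing.isLinear.Build C P C _ (mlinear f) (mlinear_linear f).

Lemma mlinearX f al : mlinear f (mpolyX C al) = f al.
Proof. by rewrite /mlinear msuppX big_seq1 mcoeffX eqxx mul1r. Qed.

Lemma eq_mlinear f g : f =1 g -> mlinear f =1 mlinear g.
Proof. by move=> fg p; apply: eq_bigr => al _; rewrite fg. Qed.

Definition pvar (l : 'I_n) (u : {poly C}) : P := (map_poly (@mpolyC n C) u).['X_l].

Lemma pvar_is_zmod_morphism l : zmod_morphism (pvar l).
Proof. by move=> u v; rewrite /pvar rmorphB hornerD hornerN. Qed.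
Lemma pvar_is_monoid_morphism l : monoid_morphism (pvar l).
Proof. by split=> [|u v]; rewrite /pvar ?rmorph1 ?hornerC// rmorphM hornerM. Qed.
HB.instance Definition _ l :=
  GRing.isZmodMorphism.Build {poly C} P (pvar l) (pvar_is_zmod_morphism l).
HB.instance Definition _ l :=
  GRing.isMonoidMorphism.Build {poly C} P (pvar l) (pvar_is_monoid_morphism l).

Lemma pvarX l : pvar l 'X = 'X_l.
Proof. by rewrite /pvar map_polyX hornerX. Qed.

Lemma pvarC l c : pvar l c%:P = mpolyC n c.
Proof. by rewrite /pvar map_polyC hornerC. Qed.

Lemma pvarE l (u : {poly C}) N : (size u <= N)%N -> pvar l u = \sum_(k < N) u`_k *: 'X_l ^+ k.
Proof.
move=> le_uN; rewrite /pvar (@horner_coef_wide _ N); last first.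
  by apply: leq_trans le_uN; apply: size_poly.
by apply: eq_bigr => k _; rewrite coef_map mul_mpolyC.
Qed.

Lemma mpolyX_pvar al : mpolyX C al = \prod_l pvar l 'X^(al l).
Proof. by rewrite mpolyXE_id; apply: eq_bigr => l _; rewrite rmorphXn/= pvarX. Qed.

(** The functional is the tensor product of the [phi l]: after expansion of every [u l] in powers it
    is evaluated on monomials, where it is a product by definition. *)
Lemma mlinear_prod (phi : 'I_n -> {poly C} -> C) (u : 'I_n -> {poly C}) :
  (forall l, linear_for *%R (phi l)) ->
  mlinear (fun al => \prod_l phi l 'X^(al l)) (\prod_l pvar l (u l)) =
  \prod_l phi l (u l).
Proof.
move=> lin_phi; pose N := (\max_l size (u l))%N.
have le_N l : (size (u l) <= N)%N by apply: leq_bigmax.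
pose phiL l : {linear {poly C} -> C | *%R} := HB.pack (phi l)
  (GRing.isLinear.Build C {poly C} C *%R (phi l) (lin_phi l)).
transitivity (\prod_l \sum_(k < N) (u l)`_k * phi l 'X^k); last first.
  apply: eq_bigr => l _; rewrite -[phi l]/(phiL l : _ -> _).
  have {2}-> : u l = \sum_(k < N) (u l)`_k *: 'X^k.
    rewrite -poly_def; apply/polyP => k; rewrite coef_poly; case: ltnP => //.
    by move=> /(leq_trans (le_N l)) /leq_sizeP ->.
  by rewrite linear_sum; apply: eq_bigr => k _; rewrite linearZ.
under eq_bigr do rewrite (pvarE _ (le_N _)).
rewrite !bigA_distr_bigA linear_sum; apply: eq_bigr => /= f _.
rewrite scaler_prod linearZ/= big_split/=; congr (_ * _).
have -> : \prod_i 'X_i ^+ f i = mpolyX C (Multinom [tuple (f i : nat) | i < n]).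
  by rewrite mpolyXE_id; apply: eq_bigr => i _; rewrite multinomE tnth_mktuple.
rewrite mlinearX; apply: eq_bigr => i _.
by rewrite multinomE tnth_mktuple.
Qed.

End LinearExtension.

Section DegreeBounds.
Variables (C : comRingType) (n : nat).
Local Notation P := {mpoly C[n]}.
Implicit Types (l : 'I_n) (p q : P).

(* [deg_l p + k <= d], where the zero polynomial has degree [- oo]. *)
Definition degle l k d p := forall al : multinom n, al \in msupp p -> (al l + k <= d)%N.

Lemma degleW l k d k' d' p : (d + k' <= d' + k)%N -> degle l k d p -> degle l k' d' p.
Proof.
move=> le_dk deg_p al al_p; rewrite -(leq_add2r k) addnAC; apply: leq_trans le_dk.
by rewrite leq_add2r deg_p.
Qed.

Lemma degleP l k d p :
  degle l k d p <-> forall al : multinom n, (d < al l + k)%N -> mcoeff al p = 0.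
Proof.
split=> [deg_p al|coef0 al]; first by rewrite ltnNge => lt_d; apply/memN_msupp_eq0/(contra (@deg_p al)).
by rewrite mcoeff_msupp; apply: contraR; rewrite -ltnNge => /coef0 ->.
Qed.

Lemma degle0 l k d : degle l k d 0.
Proof. by move=> al; rewrite msupp0. Qed.

Lemma degleD l k d p q : degle l k d p -> degle l k d q -> degle l k d (p + q).
Proof.
by move=> deg_p deg_q al /msuppD_le; rewrite mem_cat => /orP[/deg_p|/deg_q].
Qed.

Lemma degleZ l k d c p : degle l k d p -> degle l k d (c *: p).
Proof. by move=> deg_p al /msuppZ_le/deg_p. Qed.

Lemma degleN l k d p : degle l k d p -> degle l k d (- p).
Proof. by rewrite -scaleN1r; apply: degleZ. Qed.

Lemma degleB l k d p q : degle l k d p -> degle l k d q -> degle l k d (p - q).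
Proof. by move=> deg_p deg_q; apply/degleD/degleN. Qed.

Lemma degle_sum (I : Type) (r : seq I) (A : pred I) (F : I -> P) l k d :
  (forall i, A i -> degle l k d (F i)) -> degle l k d (\sum_(i <- r | A i) F i).
Proof. by move=> ?; apply: big_ind => //; [apply: degle0 | apply: degleD]. Qed.

Lemma degleM l k d k' d' p q : degle l k d p -> degle l k' d' q ->
  degle l (k + k') (d + d') (p * q).
Proof.
move=> deg_p deg_q al /msuppM_le /allpairsP[[b c]] [/deg_p b_p /deg_q c_q ->].
by rewrite mnmDE addnACA leq_add.
Qed.

Lemma degleC l c : degle l 0 0 (mpolyC n c).
Proof. by move=> al; rewrite msuppC; case: ifP => //_; rewrite inE => /eqP ->; rewrite mnm0E. Qed.

Lemma degleX l (be : multinom n) : degle l 0 (be l) (mpolyX C be).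
Proof. by move=> al; rewrite msuppX inE => /eqP ->; rewrite addn0. Qed.

Lemma degle_prod (I : Type) (r : seq I) (A : pred I) (F : I -> P) l (k d : I -> nat) :
  (forall i, A i -> degle l (k i) (d i) (F i)) ->
  degle l (\sum_(i <- r | A i) k i) (\sum_(i <- r | A i) d i) (\prod_(i <- r | A i) F i).
Proof.
move=> deg_F; elim: r => [|i r IHr]; first by rewrite !big_nil -mpolyC1; apply: degleC.
by rewrite !big_cons; case: ifP => // Ai; apply: degleM => //; apply: deg_F.
Qed.

Lemma degle_exp l k d p m : degle l k d p -> degle l (m * k) (m * d) (p ^+ m).
Proof.
move=> deg_p; elim: m => [|m IHm]; first by rewrite expr0 -mpolyC1; apply: degleC.
by rewrite exprS !mulSn; apply: degleM.
Qed.

End DegreeBounds.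

Section SeveralVariables.
Variables (C : numFieldType) (n : nat) (a : 'I_n -> 'I_n -> C).
Hypothesis a_inj : forall j, injective (a ^~ j).
Local Notation P := {mpoly C[n]}.
Implicit Types (E : 'I_n -> 'I_n -> nat) (p : P).

(* The residue of [p / \prod_(i, l) ('X_l - a i l) ^+ E i l] at [aJ a J]. *)
Definition mresidue_at E (J : 'S_n) : P -> C :=
  mlinear (fun al => \prod_l residue (a ^~ l) (J l) (E ^~ l) 'X^(al l)).

HB.instance Definition _ E J :=
  GRing.isLinear.Build C P C _ (mresidue_at E J) (mlinear_linear _).

(* The sum of the local residues of [p dw / \prod_i \prod_l ('X_l - a i l) ^+ E i l]
   with respect to the ordered divisors [\prod_l ('X_l - a i l)]. *)
Definition mresidue E p : C := \sum_(J : 'S_n) (-1) ^+ J * mresidue_at E J p.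

Lemma mresidue_linear E : linear_for *%R (mresidue E).
Proof.
move=> c p q; rewrite /mresidue mulr_sumr -big_split; apply: eq_bigr => J _ /=.
by rewrite /mresidue_at linearP mulrDr mulrCA.
Qed.

HB.instance Definition _ E :=
  GRing.isLinear.Build C P C _ (mresidue E) (mresidue_linear E).

Lemma mresidue_at_prod E J (u : 'I_n -> {poly C}) :
  mresidue_at E J (\prod_l pvar l (u l)) =
  \prod_l residue (a ^~ l) (J l) (E ^~ l) (u l).
Proof.
exact: (@mlinear_prod _ _ (fun l => residue (a ^~ l) (J l) (E ^~ l)))
  (fun l => residue_linear _ _ _).
Qed.

Definition linprod i (m : 'I_n -> nat) : P :=
  \prod_l (mpolyX C (mnm1 l) - mpolyC n (a i l)) ^+ m l.

Lemma residue_incrn (I : finType) (b : I -> C) (b_inj : injective b) i k e m (p : {poly C}) :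
  residue b i (fun j => e j + (j == k) * m)%N (p * ('X - (b k)%:P) ^+ m) =
  residue b i e p.
Proof.
elim: m p => [|m IHm] p.
  by rewrite mulr1; apply: eq_residue => j; rewrite muln0 addn0.
rewrite exprSr mulrA -[RHS]IHm -[RHS](residue_incr b_inj i k); apply: eq_residue => j.
by rewrite /incr mulnS addnCA addnC.
Qed.

Lemma linprod_pvar i m : linprod i m = \prod_l pvar l (('X - (a i l)%:P) ^+ m l).
Proof.
by apply: eq_bigr => l _; rewrite rmorphXn/= rmorphB/= pvarX pvarC.
Qed.

(** The factor of the numerator cancels against row [k] of the exponents. By linearity [p] may be
    taken to be a monomial, and everything splits into one-variable residues. *)
Lemma mresidue_linprod E k m p :
  mresidue (fun i j => E i j + (i == k) * m j)%N (p * linprod k m) = mresidue E p.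
Proof.
apply: eq_bigr => J _; congr (_ * _); rewrite (mpolyE p) mulr_suml !linear_sum.
apply: eq_bigr => al _; rewrite -scalerAl !linearZ /=; congr (_ * _).
rewrite linprod_pvar mpolyX_pvar -big_split/=.
rewrite (eq_bigr (fun l => pvar l ('X^(al l) * ('X - (a k l)%:P) ^+ m l))); last first.
  by move=> l _; rewrite rmorphM.
by rewrite !mresidue_at_prod; apply: eq_bigr => l _; rewrite residue_incrn.
Qed.

Lemma eq_mresidue E E' p : (forall i j, E i j = E' i j) -> mresidue E p = mresidue E' p.
Proof.
move=> EE'; apply: eq_bigr => J _; congr (_ * _); apply: eq_mlinear => al.
by apply: eq_bigr => l _; apply: eq_residue.
Qed.

(** Every permutation uses row [i] in exactly one column, where the point [a i l] is not a pole. *)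
Lemma mresidue_row0 E i p : (forall l, E i l = 0%N) -> mresidue E p = 0.
Proof.
move=> Ei; apply: big1 => J _; rewrite [mresidue_at _ _ _]big1 ?mulr0// => al _.
by rewrite (bigD1 (J^-1%g i))//= residue0 ?mul0r ?mulr0// permKV.
Qed.

Lemma mresidueX E al : mresidue E (mpolyX C al) =
  \det (\matrix_(l, i) residue (a ^~ l) i (E ^~ l) 'X^(al l)).
Proof.
apply: eq_bigr => J _; congr (_ * _); rewrite /mresidue_at mlinearX.
by apply: eq_bigr => l _; rewrite mxE.
Qed.

(** On a monomial the residue is the determinant of [mresidueX], with one row per variable. Each row
    sums to 0, since it lists all residues of a fraction that has none at infinity; so the vector of
    ones, nonzero as [0 < n], lies in the kernel. *)
Lemma mresidue_small E p : (0 < n)%N ->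
  (forall l, degle l 2 (\sum_i E i l) p) -> mresidue E p = 0.
Proof.
move=> n_gt0 small_p; rewrite (mpolyE p) linear_sum big_seq big1// => al al_p.
rewrite linearZ/= mresidueX -det_tr; apply/eqP; rewrite mulf_eq0; apply/orP; right.
apply/det0P; exists (const_mx 1).
  apply/eqP => /rowP/(_ (Ordinal n_gt0))/eqP; rewrite !mxE oner_eq0//.
apply/rowP => l; rewrite !mxE; under eq_bigr do rewrite !mxE mul1r.
have le_al := small_p l _ al_p.
rewrite sum_residue//; last by rewrite size_polyXn (leq_trans _ le_al)// addn2.
rewrite coefXn (_ : (_ == _) = false)//; apply/negP => /eqP E'.
by move: le_al; rewrite -E' addn2; case: (\sum_i _)%N => [|k] //=; rewrite ltnn.
Qed.

End SeveralVariables.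

(** * The global residue *)

Lemma sum_uniq_sub (T : eqType) (V : nmodType) (f : T -> V) (s s' : seq T) :
  uniq s -> uniq s' -> {subset s <= s'} -> {in s', forall x, x \notin s -> f x = 0} ->
  \sum_(x <- s') f x = \sum_(x <- s) f x.
Proof.
move=> s_uniq s'_uniq sub f0; rewrite (bigID (mem s))/= addrC big_seq_cond.
rewrite big1 ?add0r => [|x /andP[/f0]//].
rewrite -big_filter; apply/esym/perm_big/uniq_perm; rewrite ?filter_uniq//.
by move=> x; rewrite mem_filter; case: (boolP (x \in s)) => //= /sub ->.
Qed.

Section MultinomsBelow.
Variable n : nat.

Definition multinoms_below N : seq (multinom n) := map (@bmnm n N) (enum {: bmultinom n N}).

Lemma mem_multinoms_below N K : (K \in multinoms_below N) = (mdeg K < N)%N.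
Proof.
apply/mapP/idP => [[L _ ->]|lt_KN]; first exact: bmdeg.
by exists (BMultinom lt_KN); rewrite ?mem_enum.
Qed.

Lemma multinoms_below_uniq N : uniq (multinoms_below N).
Proof. by rewrite map_inj_uniq ?enum_uniq//; apply: val_inj. Qed.

End MultinomsBelow.

Section GlobalResidue.
Variables (C : numFieldType) (n : nat) (a : 'I_n -> 'I_n -> C) (mm : 'I_n -> 'I_n -> nat).
Local Notation P := {mpoly C[n]}.
Variable G : 'I_n -> P.
Hypotheses (n_gt0 : (0 < n)%N) (a_inj : forall j, injective (a ^~ j)).
Hypothesis degG : forall i l, degle l 1 (mm i l) (G i).
Implicit Types (K : multinom n) (g h : P).

Local Notation qq i := (linprod a i (mm i)).

Definition res_term K g : C :=
  mresidue a (fun i l => (K i).+1 * mm i l)%N (g * \prod_i G i ^+ K i).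

Lemma res_term_linear K : linear_for *%R (res_term K).
Proof. by move=> c g h; rewrite /res_term mulrDl -scalerAl linearP. Qed.

HB.instance Definition _ K :=
  GRing.isLinear.Build C P C _ (res_term K) (res_term_linear K).

(** Each of the [mdeg K] factors [G i] has degree at least one below the corresponding [qq i] in
    every variable, which relaxes the bound on [g] by [mdeg K]. *)
Lemma res_term_small K g :
  (forall l, degle l 2 (mdeg K + \sum_i mm i l) g) -> res_term K g = 0.
Proof.
move=> deg_g; apply: mresidue_small => // l.
have degGK : degle l (mdeg K) (\sum_i K i * mm i l) (\prod_i G i ^+ K i).
  rewrite mdegE (eq_bigr (fun i => K i * 1)%N) => [|i _]; last by rewrite muln1.
  by apply: degle_prod => i _; apply/degle_exp/degG.
apply: degleW (degleM (deg_g l) degGK).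
have -> : (\sum_i (K i).+1 * mm i l = \sum_i mm i l + \sum_i K i * mm i l)%N.
  by rewrite -big_split; apply: eq_bigr => i _; rewrite mulSn.
lia.
Qed.

Lemma res_term_qq0 K i h : K i = 0%N -> res_term K (qq i * h) = 0.
Proof.
move=> Ki; rewrite /res_term -mulrA mulrC.
pose E j l := (if j == i then 0 else (K j).+1 * mm j l)%N.
rewrite -[RHS](@mresidue_row0 _ _ a E i (h * \prod_i G i ^+ K i)); last first.
  by move=> l; rewrite /E eqxx.
rewrite -(mresidue_linprod a_inj E i (mm i)); apply: eq_mresidue => j l.
by rewrite /E; case: eqVneq => [->|_]; rewrite ?Ki ?mul1n// addn0.
Qed.

Lemma res_term_qqS K i h :
  res_term (mnm_add K (mnm1 i)) (qq i * h) = res_term K (G i * h).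
Proof.
rewrite /res_term -mulrA mulrC.
rewrite -[RHS](mresidue_linprod a_inj _ i (mm i)).
have -> : \prod_j G j ^+ (mnm_add K (mnm1 i)) j = G i * \prod_j G j ^+ K j.
  rewrite (bigD1 i)//= [in RHS](bigD1 i)//= mnmDE mnm1E eqxx addn1 exprS -mulrA.
  congr (_ * (_ * _)); apply: eq_bigr => j /negbTE ji.
  by rewrite mnmDE mnm1E eq_sym ji addn0.
rewrite mulrA [h * G i]mulrC; apply: eq_mresidue => j l.
by rewrite mnmDE mnm1E [i == j]eq_sym; case: eqVneq => [->|]; rewrite ?addn0// addn1 mulSn addnC mul1n.
Qed.

Definition res_below N g : C :=
  \sum_(K <- multinoms_below n N) (-1) ^+ mdeg K * res_term K g.

Lemma res_below_linear N : linear_for *%R (res_below N).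
Proof.
move=> c g h; rewrite /res_below mulr_sumr -big_split; apply: eq_bigr => K _ /=.
by rewrite linearP mulrDr mulrCA.
Qed.

Lemma res_below_wider N N' g : (N <= N')%N ->
  (forall l, degle l 2 (N + \sum_i mm i l) g) -> res_below N' g = res_below N g.
Proof.
move=> le_NN' deg_g; apply: sum_uniq_sub; rewrite ?multinoms_below_uniq//.
  by move=> K; rewrite !mem_multinoms_below => /leq_trans; apply.
move=> K _; rewrite mem_multinoms_below -leqNgt => le_NK; rewrite res_term_small ?mulr0//.
by move=> l; apply: degleW (deg_g l); lia.
Qed.

(** Telescoping: the [G i] part of the term at [K] is, up to sign, the [qq i] part of the term at
    [K + e_i]. There remain the [qq i] parts with [K i = 0], where [qq i] removes all poles of row
    [i], and those of degree [N], which vanish by the degree bound. *)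
Lemma res_below_ideal N i h :
  (forall l, degle l 2 (N + \sum_i mm i l) (qq i * h)) ->
  res_below N ((qq i + G i) * h) = 0.
Proof.
move=> deg_qh; pose X K := (-1) ^+ mdeg K * res_term K (qq i * h).
have X_eq0 K : (N <= mdeg K)%N -> X K = 0.
  move=> le_NK; rewrite /X res_term_small ?mulr0// => l.
  by apply: degleW (deg_qh l); lia.
transitivity (\sum_(K <- multinoms_below n N) X K -
              \sum_(K <- map (fun K => mnm_add K (mnm1 i)) (multinoms_below n N)) X K).
  rewrite -sumrN [X in _ = _ + X]big_map.
  rewrite -big_split; apply: eq_bigr => K _ /=.
  by rewrite mulrDl raddfD/= mulrDr /X res_term_qqS mdegD mdeg1 addn1 exprS mulN1r mulNr opprK.
apply/eqP; rewrite subr_eq0; apply/eqP.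
(* Both sums are compared with the one over [mdeg K <= N]: the first lacks the terms of degree [N],
   the second those with [K i = 0]. *)
transitivity (\sum_(K <- multinoms_below n N.+1) X K).
  apply/esym/sum_uniq_sub; rewrite ?multinoms_below_uniq//.
    by move=> K; rewrite !mem_multinoms_below => /ltnW.
  by move=> K _; rewrite mem_multinoms_below -leqNgt => /X_eq0.
have add_inj : injective (fun K => mnm_add K (mnm1 i)) by apply: addIm.
apply: sum_uniq_sub; rewrite ?(map_inj_uniq add_inj) ?multinoms_below_uniq//.
  by move=> _ /mapP[K + ->]; rewrite !mem_multinoms_below mdegD mdeg1 addn1.
move=> K; rewrite mem_multinoms_below ltnS => le_KN K_notin.
rewrite /X res_term_qq0 ?mulr0//; apply/eqP; apply: contraNT K_notin => Ki.
have le1K : (lem (mnm1 i) K) by rewrite lep1mP.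
apply/mapP; exists (mnm_sub K (mnm1 i)); last by rewrite submK.
rewrite mem_multinoms_below; move: le_KN; rewrite -{1}(submK le1K) mdegD mdeg1; lia.
Qed.

(* The alternating sum of the [res_term K g] over all [K]: the terms with
   [msize g < mdeg K] vanish. *)
Definition global_res g : C := res_below (msize g).+1 g.

Lemma degle_msize g l : degle l 1 (msize g) g.
Proof.
move=> al /msize_mdeg_lt; apply: leq_trans; rewrite addn1 ltnS mdegE (bigD1 l)//=.
exact: leq_addr.
Qed.

(** The truncation in [global_res] depends on [g]. Linearity and vanishing on the ideal involve
    several polynomials at once and need a common truncation. *)
Lemma global_resE N g :
  (forall l, degle l 2 (N + \sum_i mm i l) g) -> global_res g = res_below N g.
Proof.
move=> deg_g; rewrite -(res_below_wider (leq_maxl N (msize g).+1) deg_g).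
apply/esym/res_below_wider; first exact: leq_maxr.
move=> l; apply: degleW (@degle_msize g l); lia.
Qed.

Lemma global_res_linear : linear_for *%R global_res.
Proof.
move=> c g h; pose N := (msize g + msize h + msize (c *: g + h)).+1.
rewrite !(@global_resE N) ?res_below_linear// => l.
all: by apply: degleW (@degle_msize _ l); rewrite /N; lia.
Qed.

Lemma global_res_ideal i h : global_res ((qq i + G i) * h) = 0.
Proof.
pose N := (msize (qq i * h) + msize ((qq i + G i) * h)).+1.
rewrite (@global_resE N) ?res_below_ideal// => l; apply: degleW (@degle_msize _ l);
  rewrite /N; lia.
Qed.

End GlobalResidue.

(** * The Bezoutian *)

Section SequentialSampling.
Variable R : comRingType.

Lemma sum_perm_lift n (f : 'S_n.+1 -> R) :
  \sum_t f t = \sum_i \sum_(t : 'S_n) f (lift_perm ord0 i t).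
Proof.
pose h (p : 'I_n.+1 * 'S_n) := lift_perm ord0 p.1 p.2.
rewrite pair_big (reindex h)//=; apply/onW_bij/inj_card_bij => [[i s] [j t]|].
  rewrite /h /= => /permP eq_st; have := eq_st ord0; rewrite !lift_perm_id => ij.
  subst j; congr (_, _); apply/permP => k; apply: (@lift_inj _ i).
  by rewrite -!(lift_perm_lift ord0) eq_st.
by rewrite card_prod card_ord !card_Sn factS.
Qed.

(* Choose [t 0], [t 1], ... one after the other, [t l] among the remaining
   elements with weights [c l (remaining elements)] of total 1. *)
Lemma sum_perm_sampling n (c : 'I_n -> {set 'I_n} -> 'I_n -> R) :
  (forall l (S : {set 'I_n}), S != finset.set0 -> \sum_(i in S) c l S i = 1) ->
  \sum_(t : 'S_n) \prod_l c l (t @: [set k : 'I_n | l <= k]%N) (t l) = 1.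
Proof.
elim: n c => [|n IHn] c c1.
  rewrite (eq_bigr (fun=> 1)) => [|t _]; last by rewrite big_ord0.
  by rewrite sumr_const card_Sn.
have Im0 (t : 'S_n.+1) : t @: [set k : 'I_n.+1 | ord0 <= k]%N = [set: 'I_n.+1].
  apply/setP => i; rewrite inE; apply/imsetP; exists (t^-1%g i); rewrite ?inE//.
  by rewrite permKV.
rewrite sum_perm_lift.
transitivity (\sum_i c ord0 [set: 'I_n.+1] i); last first.
  rewrite -(c1 ord0 [set: 'I_n.+1]); first by apply: eq_bigl => i; rewrite inE.
  by apply/finset.set0Pn; exists ord0; rewrite inE.
apply: eq_bigr => i _.
(* Once [i] is drawn, the rest is a sampling among the other elements, renumbered by [lift i]. *)
pose c' (l : 'I_n) (S : {set 'I_n}) k := c (lift ord0 l) (lift i @: S) (lift i k).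
transitivity (c ord0 [set: 'I_n.+1] i *
  \sum_(t : 'S_n) \prod_l c' l (t @: [set k : 'I_n | l <= k]%N) (t l)); last first.
  rewrite IHn ?mulr1// => l S S0.
  rewrite -(c1 (lift ord0 l) (lift i @: S)) ?imset_eq0//.
  by rewrite big_imset// => ? ? _ _; apply: lift_inj.
rewrite mulr_sumr; apply: eq_bigr => t _.
rewrite big_ord_recl Im0 lift_perm_id; congr (_ * _); apply: eq_bigr => l _.
rewrite lift_perm_lift /c'; congr (c _ _ _).
rewrite -imset_comp; apply/setP => j; apply/imsetP/imsetP => -[k].
  rewrite inE; case: (unliftP ord0 k) => [k' ->|-> //].
  rewrite lift_perm_lift => le_lk ->; exists k' => //.
  by rewrite inE.
rewrite inE => le_lk ->; exists (lift ord0 k); rewrite ?inE//.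
by rewrite lift_perm_lift.
Qed.

End SequentialSampling.

Section DifferenceQuotient.
Variable C : fieldType.
Implicit Types (u v : {poly C}) (w : C).

Definition diffq u w : {poly C} := (u - u.[w]%:P) %/ ('X - w%:P).

Lemma diffqE u w : diffq u w * ('X - w%:P) = u - u.[w]%:P.
Proof.
by rewrite divpK// dvdp_XsubCl rootE !hornerE subrr.
Qed.

Lemma size_diffq u w : size (diffq u w) = (size u).-1.
Proof.
have [->|u0] := eqVneq u 0.
  by rewrite /diffq horner0 subr0 div0p size_poly0.
rewrite size_divp ?polyXsubC_eq0// size_XsubC subn1 /=.
have [u1|u1] := leqP (size u) 1.
  by rewrite (size1_polyC u1) hornerC subrr size_poly0 size_polyC; case: eqP.
rewrite size_polyDl// size_polyN size_polyC; apply: leq_ltn_trans u1; exact: leq_b1.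
Qed.

Lemma diffq_monic u w : u \is monic -> (1 < size u)%N -> diffq u w \is monic.
Proof.
move=> u_monic u1; rewrite -(monicMr _ (monicXsubC w)) diffqE.
by rewrite monicE lead_coefDl ?(monicP u_monic)// size_polyN size_polyC; apply: leq_ltn_trans u1; exact: leq_b1.
Qed.

End DifferenceQuotient.

Section PureProducts.
Variables (C : numFieldType) (n : nat) (a : 'I_n -> 'I_n -> C) (mm : 'I_n -> 'I_n -> nat).
Hypotheses (a_inj : forall j, injective (a ^~ j)) (mm_gt0 : forall i j, (0 < mm i j)%N).
Variable w : 'I_n -> C.

Let p i l : {poly C} := ('X - (a i l)%:P) ^+ mm i l.

(* Up to the factor [\prod_l pvar l], the product over [i] of the difference
   quotients of the [\prod_l pvar l (p i l)] in the variable [s i], where the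
   variables before [s i] are already replaced by the [w l]. *)
Definition mixed_factor (s : 'S_n) (l : 'I_n) : {poly C} :=
  \prod_i (if (l < s i)%N then ((p i l).[w l])%:P
           else if l == s i then diffq (p i l) (w l) else p i l).

Let Phi l (S : {set 'I_n}) := \prod_(i in S) p i l.

(** The residue at [a i l] of the difference quotient of [Phi l S] over [Phi l S] itself; the
    factors outside [S] only fill up the common denominator. *)
Let cS l (S : {set 'I_n}) i : C :=
  residue (a ^~ l) i (mm ^~ l) (diffq (Phi l S) (w l) * Phi l (~: S)).

Lemma p_monic i l : p i l \is monic.
Proof. by rewrite monic_exp ?monicXsubC. Qed.

Lemma Phi_monic l S : Phi l S \is monic.
Proof. by apply: monic_prod => i _; apply: p_monic. Qed.

Lemma size_Phi l (S : {set 'I_n}) : size (Phi l S) = (\sum_(i in S) mm i l).+1.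
Proof.
rewrite size_prod => [|k _]; last by rewrite expf_neq0// polyXsubC_eq0.
rewrite (eq_bigr (fun k => mm k l + 1)%N) => [|k _]; last by rewrite size_exp_XsubC addn1.
by rewrite big_split/= sum1_card -addSn addnK.
Qed.

Lemma cS_notin l (S : {set 'I_n}) i : i \notin S -> cS l S i = 0.
Proof.
move=> iS; rewrite /cS /Phi (bigD1 i (P := mem (~: S))) ?inE//= mulrCA mulrC.
pose e j := (if j == i then 0 else mm j l)%N.
rewrite -[RHS](@residue0 _ _ (a ^~ l) i e (diffq (Phi l S) (w l) *
  \prod_(j | (j \in ~: S) && (j != i)) p j l)) ?/e ?eqxx//.
rewrite -[RHS](residue_incrn (@a_inj l) i i _ (mm i l)); apply: eq_residue => j.
by case: eqVneq => [->|_]; rewrite ?mul1n ?mul0n ?addn0.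
Qed.

(** The numerator is monic of degree one below the denominator, so its top coefficient 1 is the sum
    of the residues. For empty [S] the difference quotient would be 0. *)
Lemma sum_cS l (S : {set 'I_n}) : S != finset.set0 -> \sum_(i in S) cS l S i = 1.
Proof.
move=> /finset.set0Pn[i0 i0S].
transitivity (\sum_i cS l S i).
  by rewrite [RHS](bigID (mem S))/= [X in _ = _ + X]big1 ?addr0// => i; apply: cS_notin.
have Phi1 : (1 < size (Phi l S))%N.
  by rewrite size_Phi ltnS (bigD1 i0)//= ltn_addr.
have num_monic : diffq (Phi l S) (w l) * Phi l (~: S) \is monic.
  by rewrite monicMl ?Phi_monic// diffq_monic// Phi_monic.
have sz : size (diffq (Phi l S) (w l) * Phi l (~: S)) = (\sum_i mm i l)%N.
  rewrite size_Mmonic ?Phi_monic ?monic_neq0 ?diffq_monic ?Phi_monic//.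
  rewrite size_diffq !size_Phi addnS /= [RHS](bigID (mem S))/=; congr (_ + _)%N.
  by apply: eq_bigl => i; rewrite inE.
rewrite /cS sum_residue//; last by rewrite sz.
by rewrite -[in X in _`_X]sz -/(lead_coef _) (monicP num_monic).
Qed.

(** The product rule for difference quotients: with [i0] such that [s i0 = l], [Phi l S] is [p i0 l]
    times [Phi l S'], and the value of [Phi l S'] at [w l] times the quotient of [p i0 l] is the
    quotient of [Phi l S] minus [p i0 l] times that of [Phi l S']. *)
Lemma mixed_factorE (s : 'S_n) (l : 'I_n) (S := [set i | l <= s i]%N) (S' := [set i | l < s i]%N) :
  mixed_factor s l =
  diffq (Phi l S) (w l) * Phi l (~: S) - diffq (Phi l S') (w l) * Phi l (~: S').
Proof.
pose i0 := s^-1%g l; have si0 : s i0 = l by rewrite permKV.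
have S_i0 i : (l <= s i)%N = (i == i0) || (l < s i)%N.
  by rewrite leq_eqVlt -si0; congr (_ || _); rewrite (inj_eq val_inj) (inj_eq perm_inj) eq_sym.
have i0S' : i0 \notin S' by rewrite inE si0 ltnn.
have PhiS : Phi l S = p i0 l * Phi l S'.
  rewrite /Phi (bigD1 i0)/=; last by rewrite inE si0.
  congr (_ * _); apply: eq_bigl => i; rewrite !inE S_i0.
  by case: eqVneq => [->|]; rewrite ?andbT ?andbF ?si0 ?ltnn.
have PhiS'C : Phi l (~: S') = p i0 l * Phi l (~: S).
  rewrite /Phi (bigD1 i0)/=; last by rewrite inE.
  congr (_ * _); apply: eq_bigl => i; rewrite !inE S_i0.
  by case: eqVneq => [->|]; rewrite ?andbT ?andbF.
have -> : mixed_factor s l = (Phi l S').[w l]%:P * diffq (p i0 l) (w l) * Phi l (~: S).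
  rewrite /mixed_factor (bigID (mem S'))/= -mulrA; congr (_ * _).
    rewrite /Phi horner_prod rmorph_prod; apply: eq_bigr => i; rewrite inE => -> //.
  rewrite (bigD1 i0)//= si0 ltnn eqxx; congr (_ * _).
  apply: eq_big => [i|i]; first by rewrite !inE S_i0 negb_or andbC.
  rewrite inE => /andP[/negbTE -> /negbTE ii0].
  by rewrite -si0 (inj_eq perm_inj) eq_sym ii0.
have X0 : 'X - (w l)%:P != 0 by rewrite polyXsubC_eq0.
apply: (mulIf X0); have E u := diffqE u (w l).
move: (E (p i0 l)) (E (Phi l S)) (E (Phi l S')); rewrite PhiS'C PhiS hornerM polyCM.
move: (diffq (p i0 l) _) => d0; move: (diffq (p i0 l * _) _) => dS.
move: (diffq (Phi l S') _) ('X - _) => dS' x E0 ES ES'.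
transitivity ((Phi l S').[w l]%:P * (d0 * x) * Phi l (~: S)); first by ring.
transitivity (dS * x * Phi l (~: S) - dS' * x * (p i0 l * Phi l (~: S))); last by ring.
by rewrite E0 ES ES'; ring.
Qed.

(** For [s = t^-1] the residue is a determinant whose entry in row [l] and column [t k] is a
    difference of two weights [cS]. Both vanish for [k < l], hence the matrix is triangular after
    the columns are permuted by [t], and the permutation sign cancels the given one. On the diagonal
    the second weight vanishes; the first is the probability of drawing [t l] among [t l], ..., the
    last element. *)
Lemma mresidue_mixed :
  \sum_(s : 'S_n) (-1) ^+ s * mresidue a mm (\prod_l pvar l (mixed_factor s l)) = 1.
Proof.
rewrite -[RHS](@sum_perm_sampling _ _ cS sum_cS) (reindex_inj invg_inj)/=.
apply: eq_bigr => t _.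
have -> : mresidue a mm (\prod_l pvar l (mixed_factor t^-1%g l)) =
    \det (\matrix_(l, i) residue (a ^~ l) i (mm ^~ l) (mixed_factor t^-1%g l)).
  apply: eq_bigr => J _; congr (_ * _); rewrite mresidue_at_prod.
  by apply: eq_bigr => l _; rewrite mxE.
set A := \matrix_(l, i) _.
have AE l i : A l i = cS l (t @: [set k : 'I_n | l <= k]%N) i -
                      cS l (t @: [set k : 'I_n | l < k]%N) i.
  rewrite mxE mixed_factorE raddfB /=.
  have imE (P : pred 'I_n) : [set i | P (t^-1%g i)] = t @: [set k | P k].
    apply/setP => k; rewrite inE; apply/idP/imsetP => [Pk|[k' + ->]].
      by exists (t^-1%g k); rewrite ?inE// permKV.
    by rewrite inE permK.
  by rewrite (imE (fun k : 'I_n => l <= k)%N) (imE (fun k : 'I_n => l < k)%N).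
have mem_im l (P : pred 'I_n) : (t l \in t @: [set k | P k]) = P l.
  by rewrite mem_imset ?inE//; apply: perm_inj.
have -> : \det A = (-1) ^+ t * \det (col_perm t A).
  rewrite col_permE det_mulmx det_perm odd_permV mulrCA -expr2 sqrr_sign mulr1 //.
rewrite odd_permV mulrA -expr2 sqrr_sign mul1r -det_tr det_trig; last first.
  apply/is_trig_mxP => k l lt_kl; rewrite 2!mxE AE.
  by rewrite !cS_notin ?subrr// mem_im -?leqNgt -?ltnNge// ltnW.
apply: eq_bigr => l _; rewrite 2!mxE AE.
by rewrite [X in _ - X]cS_notin ?subr0// mem_im ltnn.
Qed.

End PureProducts.

(** * Difference quotients in several variables *)

Section PartialDifferenceQuotient.
Variables (C : comRingType) (n : nat) (S : comRingType) (f : {rmorphism C -> S}).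
Variables (x y : 'I_n -> S).
Local Notation P := {mpoly C[n]}.
Implicit Types (p : P) (j : 'I_n).

Definition hybrid (j : nat) (l : 'I_n) : S := if (l < j)%N then x l else y l.

(** The quotient by [x j - y j] of the increment of [p] between two consecutive hybrid points. It is
    written out on monomials, so that it exists over any commutative ring and commutes with ring
    morphisms. *)
Definition mdiffq j p : S :=
  \sum_(al <- msupp p) f (mcoeff al p) *
    \prod_(l < n) (if (l < j)%N then x l ^+ al l
               else if l == j then \sum_(s < al l) x l ^+ ((al l).-1 - s) * y l ^+ s
               else y l ^+ al l).

Lemma mdiffqE j p :
  (x j - y j) * mdiffq j p = mmap f (hybrid j.+1) p - mmap f (hybrid j) p.
Proof.
rewrite /mdiffq /mmap mulr_sumr -sumrB; apply: eq_bigr => al _.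
rewrite mulrCA -mulrBr /mmap1; congr (_ * _).
rewrite (bigD1 j)//= ltnn eqxx mulrA -subrXX.
rewrite [X in _ = X - _](bigD1 j)//= [X in _ = _ - X](bigD1 j)//=.
rewrite /hybrid ltnn ltnS leqnn mulrBl.
by congr (_ * _ - _ * _); apply: eq_bigr => l lj;
  rewrite ?ltnS ?[(l <= j)%N]leq_eqVlt ?(negbTE (lj : l != j :> nat)) (negbTE lj)/=; case: ifP.
Qed.

(** The hybrid points lead from [y] to [x] one coordinate at a time, and the increments
    telescope. *)
Lemma sum_mdiffq p : \sum_j (x j - y j) * mdiffq j p = mmap f x p - mmap f y p.
Proof.
rewrite (eq_bigr _ (fun j _ => mdiffqE j p)).
rewrite -(big_mkord xpredT
  (fun j : nat => mmap f (hybrid j.+1) p - mmap f (hybrid j) p)) telescope_sumr//.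
by congr (_ - _); apply: eq_bigr => al _; congr (_ * _); apply: eq_bigr => l _;
  rewrite /hybrid ?ltn_ord.
Qed.

Lemma mdiffqB j : {morph mdiffq j : p q / p - q}.
Proof.
move=> p q; pose s := undup (msupp p ++ msupp q ++ msupp (p - q)).
have s_uniq : uniq s by rewrite undup_uniq.
have widen r : {subset msupp r <= s} -> mdiffq j r = \sum_(al <- s) f (mcoeff al r) *
    \prod_(l < n) (if (l < j)%N then x l ^+ al l
               else if l == j then \sum_(s < al l) x l ^+ ((al l).-1 - s) * y l ^+ s
               else y l ^+ al l).
  move=> sub; apply/esym/sum_uniq_sub => //.
  by move=> al _ /memN_msupp_eq0 ->; rewrite rmorph0 mul0r.
rewrite !widen -?sumrB; first last.
- by move=> al al_p; rewrite mem_undup !mem_cat al_p ?orbT.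
- by move=> al al_p; rewrite mem_undup !mem_cat al_p ?orbT.
- by move=> al al_p; rewrite mem_undup !mem_cat al_p ?orbT.
by apply: eq_bigr => al _; rewrite mcoeffB rmorphB mulrBl.
Qed.

End PartialDifferenceQuotient.

Lemma mdiffq_morph (C : comRingType) n (S S' : comRingType) (f : {rmorphism C -> S})
    (f' : {rmorphism C -> S'}) (g : {rmorphism S -> S'}) x y x' y' (j : 'I_n) p :
  (forall c, g (f c) = f' c) -> (forall l, g (x l) = x' l) -> (forall l, g (y l) = y' l) ->
  g (mdiffq f x y j p) = mdiffq f' x' y' j p.
Proof.
move=> gf gx gy; rewrite /mdiffq rmorph_sum; apply: eq_bigr => al _.
rewrite rmorphM gf rmorph_prod; congr (_ * _); apply: eq_bigr => l _.
case: ifP => _; first by rewrite rmorphXn gx.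
case: ifP => _; last by rewrite rmorphXn gy.
by rewrite rmorph_sum; apply: eq_bigr => s _; rewrite rmorphM !rmorphXn gx gy.
Qed.

Lemma mdiffq_diag (C : comRingType) n (j : 'I_n) (p : {mpoly C[n]}) :
  mdiffq (@mpolyC n C) (fun l => mpolyX C (mnm1 l)) (fun l => mpolyX C (mnm1 l)) j p
  = mderiv j p.
Proof.
rewrite [in RHS](mpolyE p) raddf_sum; apply: eq_bigr => al _.
rewrite /= linearZ/= mderivX mul_mpolyC; congr (_ *: _).
rewrite mpolyXE_id (bigD1 j)//= [in RHS](bigD1 j)//= ltnn eqxx scalerAl; congr (_ * _).
  rewrite mnmBE mnm1E eqxx subn1.
  rewrite (eq_bigr (fun=> mpolyX C (mnm1 j) ^+ (al j).-1)) => [|s _].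
    by rewrite sumr_const card_ord scaler_nat.
  by rewrite -exprD subnK//; case: (al j) s => [[]//|k] s /=; rewrite -ltnS.
apply: eq_bigr => l lj; rewrite (negbTE lj) if_same mnmBE mnm1E eq_sym (negbTE lj) subn0 //.
Qed.

Section DegreeMdiffq.
Variables (C : comRingType) (n : nat) (w : 'I_n -> C).
Local Notation P := {mpoly C[n]}.
Local Notation D := (mdiffq (@mpolyC n C) (fun l => mpolyC n (w l)) (fun l => mpolyX C (mnm1 l))).

Lemma degle_mdiffq (l j : 'I_n) k d (p : P) : degle l k d p ->
  degle l (if (l < j)%N then 0 else if l == j then k.+1 else k)
    (if (l < j)%N then 0 else d) (D j p).
Proof.
move=> deg_p; rewrite /mdiffq big_seq; apply: degle_sum => al al_p.
have le_al := deg_p _ al_p.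
rewrite mul_mpolyC; apply: degleZ.
pose kk (i : 'I_n) := if i == l then (if (l < j)%N then 0 else if l == j then k.+1 else k)%N else 0%N.
pose dd (i : 'I_n) := if i == l then (if (l < j)%N then 0 else d)%N else 0%N.
have -> : (if (l < j)%N then 0 else if l == j then k.+1 else k)%N = (\sum_i kk i)%N.
  by rewrite (bigD1 l)//= /kk eqxx big1 ?addn0// => i /negbTE ->.
have -> : (if (l < j)%N then 0 else d)%N = (\sum_i dd i)%N.
  by rewrite (bigD1 l)//= /dd eqxx big1 ?addn0// => i /negbTE ->.
have degC i c m : degle i 0 0 (mpolyC n c ^+ m : P) by rewrite -rmorphXn; apply: degleC.
have degX i m : degle l 0 (if i == l then m else 0) (mpolyX C (mnm1 i) ^+ m).
  rewrite mpolyXn; move: (@degleX C n l (mnm_muln (mnm1 i) m)).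
  by rewrite mulmnE mnm1E; case: eqP; rewrite ?mul1n.
apply: degle_prod => i _; rewrite /kk /dd; case: eqVneq => [->{i}|il].
  case: ifP => // _; case: ifP => _.
    apply: degle_sum => s _; move: (ltn_ord s) => lt_s.
    apply: degleW (degleM (degC _ _ _) (degX l s)); rewrite eqxx; lia.
  by apply: degleW (degX l (al l)); rewrite eqxx; lia.
case: ifP => // _; case: ifP => _.
  apply: degle_sum => s _.
  by apply: degleW (degleM (degC _ _ _) (degX i s)); rewrite (negbTE il).
by apply: degleW (degX i (al i)); rewrite (negbTE il).
Qed.

End DegreeMdiffq.

Section Vanishing.
Variable C : numFieldType.

Lemma digits_inj n N (al be : 'I_n -> nat) :
  (forall l, al l < N)%N -> (forall l, be l < N)%N ->
  (\sum_l al l * N ^ l = \sum_l be l * N ^ l)%N -> al =1 be.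
Proof.
elim: n al be => [|n IHn] al be lt_al lt_be; first by move=> _ [].
rewrite !big_ord_recl /= !expn0 !muln1 => eq_sum.
have shift (ga : 'I_n.+1 -> nat) : (\sum_(i < n) ga (lift ord0 i) * N ^ bump 0 i =
    (\sum_(i < n) ga (lift ord0 i) * N ^ i) * N)%N.
  by rewrite big_distrl; apply: eq_bigr => i _; rewrite /= expnS mulnCA mulnC.
move: eq_sum; rewrite !shift => eq_sum.
have N_gt0 : (0 < N)%N by apply: leq_ltn_trans (lt_al ord0).
have al0 : al ord0 = be ord0.
  by have := congr1 (modn^~ N) eq_sum; rewrite /= ![(_ + _ * N)%N]addnC !modnMDl !modn_small.
move: eq_sum; rewrite al0 => /addnI/eqP; rewrite eqn_pmul2r// => /eqP/IHn eq_tl l.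
case: (unliftP ord0 l) => [l' ->|-> //].
exact: (eq_tl (fun i => lt_al _) (fun i => lt_be _)).
Qed.

(** Kronecker's substitution of the powers [N ^ l] of one variable: it separates the monomials,
    whose exponents are digits in base [N], and yields a one-variable polynomial that vanishes at
    all natural numbers. *)
Lemma mpoly_eval_eq0 n (p : {mpoly C[n]}) : (forall w, meval w p = 0) -> p = 0.
Proof.
move=> p0; apply/eqP/negPn/negP => /eqP pn0.
have [al al_p] : exists al, al \in msupp p.
  case E : (msupp p) => [|al s]; first by case: pn0; apply: msuppnil0.
  by exists al; rewrite inE eqxx.
pose N := msize p.
have lt_N be l : be \in msupp p -> (be l < N)%N.
  move=> /msize_mdeg_lt; apply: leq_ltn_trans.
  by rewrite mdegE (bigD1 l)//= leq_addr.
pose code (be : multinom n) := (\sum_l be l * N ^ l)%N.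
pose u : {poly C} := \sum_(be <- msupp p) mcoeff be p *: 'X^(code be).
have u0 : u = 0.
  apply/eqP/negPn/negP => un0.
  pose rs := [seq k%:R : C | k <- iota 0 (size u)].
  have : (size rs < size u)%N.
    apply: max_poly_roots => //; last first.
      by rewrite map_inj_uniq ?iota_uniq//; apply: mulrIn; rewrite oner_eq0.
    apply/allP => _ /mapP[k _ ->]; rewrite rootE horner_sum; apply/eqP.
    rewrite -[RHS](p0 (fun l => k%:R ^+ (N ^ l))) mevalE; apply: eq_bigr => be _.
    rewrite hornerZ hornerXn; congr (_ * _); rewrite /code expr_sum.
    by apply: eq_bigr => l _; rewrite mulnC exprM.
  by rewrite size_map size_iota ltnn.
have : u`_(code al) = mcoeff al p.
  rewrite coef_sum (bigD1_seq al)//= ?msupp_uniq// coefZ coefXn eqxx mulr1.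
  rewrite big_seq_cond big1 ?addr0// => be /andP[be_p be_al].
  rewrite coefZ coefXn; case: eqP => [/esym eq_code|]; last by rewrite mulr0.
  case/eqP: be_al; apply/mnmP => l; move: l.
  by apply: (@digits_inj n N) => // l; apply: lt_N.
by rewrite u0 coef0 => /esym/eqP; rewrite mcoeff_eq0 al_p.
Qed.

End Vanishing.

(** * The global residue of the Bezoutian *)

Section Bezoutian.
Variables (C : numFieldType) (n : nat) (a : 'I_n -> 'I_n -> C) (mm : 'I_n -> 'I_n -> nat).
Local Notation P := {mpoly C[n]}.
Variable G : 'I_n -> P.
Hypotheses (n_gt0 : (0 < n)%N) (a_inj : forall j, injective (a ^~ j)).
Hypothesis mm_gt0 : forall i j, (0 < mm i j)%N.
Hypothesis degG : forall i l, degle l 1 (mm i l) (G i).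

Local Notation qq i := (linprod a i (mm i)).
Local Notation F i := (qq i + G i).
Local Notation "''X_' i" := (mpolyX C (mnm1 i)).

Lemma degle_linprod i l : degle l 0 (mm i l) (qq i).
Proof.
pose d j := (if j == l then mm i j else 0)%N.
have -> : mm i l = (\sum_j d j)%N.
  by rewrite (bigD1 l)//= /d eqxx big1 ?addn0// => j /negbTE ->.
suff : degle l (\sum_(j < n) 0)%N (\sum_j d j)%N (qq i) by rewrite big1.
apply: degle_prod => j _.
have degX : degle l 0 (j == l) ('X_j - mpolyC n (a i j)).
  apply: degleB; first by move: (@degleX C n l (mnm1 j)); rewrite mnm1E.
  by apply: degleW (@degleC C n l _); rewrite addn0.
by apply: degleW (degle_exp (m := mm i j) degX); rewrite /d; case: eqP => _; lia.
Qed.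

Section AtPoint.
Variable w : 'I_n -> C.
Local Notation D := (mdiffq (@mpolyC n C) (fun l => mpolyC n (w l)) (fun l => 'X_l)).

(** The factors [A i] are replaced by [B i] one at a time; in each summand the replaced factor
    contributes the extra drop. *)
Lemma degle_prod_diff (I : Type) (r : seq I) (A B : I -> P) l (k d : I -> nat) :
  (forall i, degle l (k i) (d i) (A i)) -> (forall i, degle l (k i) (d i) (B i)) ->
  (forall i, degle l (k i).+1 (d i) (A i - B i)) ->
  degle l (\sum_(i <- r) k i).+1 (\sum_(i <- r) d i) (\prod_(i <- r) A i - \prod_(i <- r) B i).
Proof.
move=> degA degB degAB; elim: r => [|i r IHr]; first by rewrite !big_nil subrr; apply: degle0.
rewrite !big_cons.
have -> : A i * \prod_(j <- r) A j - B i * \prod_(j <- r) B j =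
  A i * (\prod_(j <- r) A j - \prod_(j <- r) B j) + (A i - B i) * \prod_(j <- r) B j.
  by ring.
apply: degleD; first by rewrite -addnS; apply: degleM.
by rewrite -addSn; apply: degleM => //; apply: degle_prod.
Qed.

(** The factor with [s i = l] loses one degree in variable [l]. In the factor with [s i = l.+1] this
    variable is already replaced by a constant, which costs [mm i l], at least 1; for the last
    variable there is no such factor. *)
Lemma det_bez_small (H : 'I_n -> P) (s : 'S_n) l :
  (forall i, degle l 0 (mm i l) (H i)) ->
  degle l (if l.+1 == n then 1 else 2) (\sum_i mm i l) (\prod_i D (s i) (H i)).
Proof.
move=> degH; pose k (i : 'I_n) := (if (l < s i)%N then mm i l else (l == s i))%N.
have degD i : degle l (k i) (mm i l) (D (s i) (H i)).
  by apply: degleW (@degle_mdiffq _ _ w l (s i) _ _ _ (degH i)); rewrite /k; do 2?case: ifP => //=; lia.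
apply: degleW (degle_prod (fun i0 _ => degD i0)); rewrite leq_add2l.
have k1 : k (s^-1%g l) = 1%N by rewrite /k permKV ltnn eqxx.
rewrite (bigD1 (s^-1%g l))//= k1; case: eqVneq => [_|ln]; first exact: leq_addr.
have lt_ln : (l.+1 < n)%N by rewrite ltn_neqAle ln ltn_ord.
pose l' := Ordinal lt_ln; rewrite (bigD1 (s^-1%g l'))//=.
  by rewrite {1}/k permKV /= ltnSn add1n ltnS (leq_trans (mm_gt0 (s^-1%g l') l)) ?leq_addr.
by rewrite (inj_eq perm_inj) -val_eqE /= eqn_leq ltnn.
Qed.

Lemma mdiffq_linprod i j :
  D j (qq i) = \prod_(l < n) (if (l < j)%N then mpolyC n (('X - (a i l)%:P) ^+ mm i l).[w l]
     else if l == j then pvar l (diffq (('X - (a i l)%:P) ^+ mm i l) (w l))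
     else pvar l (('X - (a i l)%:P) ^+ mm i l)).
Proof.
set u := fun l : 'I_n => ('X - (a i l)%:P) ^+ mm i l.
have mmap_pvar h l v : mmap (@mpolyC n C) h (pvar l v) = (map_poly (@mpolyC n C) v).[h l].
  rewrite (pvarE _ (leqnn _)) raddf_sum /= (@horner_coef_wide _ (size v)); last exact: size_poly.
  apply: eq_bigr => k _; rewrite mmapZ rmorphXn /= mmapX mmap1U coef_map//.
have x_neq0 : mpolyC n (w j) - 'X_j != 0.
  apply/eqP => /(congr1 (mcoeff (mnm1 j)))/eqP.
  by rewrite mcoeff0 mcoeffB mcoeffC mcoeffX eqxx mnm1_eq0 mulr0 sub0r oppr_eq0 oner_eq0.
apply: (mulfI x_neq0); rewrite mdiffqE linprod_pvar -/u !rmorph_prod /=.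
have pvar_diffq l : (mpolyC n (w l) - 'X_l) * pvar l (diffq (u l) (w l)) =
    mpolyC n (u l).[w l] - pvar l (u l).
  have := congr1 (pvar l) (diffqE (u l) (w l)).
  rewrite rmorphM !rmorphB /= pvarX !pvarC => E.
  by rewrite -opprB mulNr mulrC E opprB.
rewrite [X in _ = _ * X](bigD1 j)//= ltnn eqxx mulrA pvar_diffq.
have hyb k l : mmap (@mpolyC n C) (hybrid (fun l => mpolyC n (w l)) (fun l => 'X_l) k)
   (pvar l (u l)) = if (l < k)%N then mpolyC n (u l).[w l] else pvar l (u l).
  by rewrite mmap_pvar /hybrid; case: ifP => // _; rewrite horner_map.
rewrite [X in X - _](bigD1 j)//= [X in _ - X](bigD1 j)//= !hyb ltnn ltnS leqnn mulrBl.
by congr (_ * _ - _ * _); apply: eq_bigr => l lj; rewrite hyb ?ltnS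
  ?[(l <= j)%N]leq_eqVlt ?(negbTE (lj : l != j :> nat)) (negbTE lj).
Qed.

Lemma global_res_bez : global_res a mm G (\det (\matrix_(i, j) D j (F i))) = 1.
Proof.
have degF i l : degle l 0 (mm i l) (F i).
  apply: degleD; first exact: degle_linprod.
  by apply: degleW (@degG i l); rewrite addn0 leq_addr.
pose detH (H : 'I_n -> P) := \sum_(s : 'S_n) (-1) ^+ s * \prod_i D (s i) (H i).
have -> : \det (\matrix_(i, j) D j (F i)) = detH (fun i => F i).
  by apply: eq_bigr => s _; congr (_ * _); apply: eq_bigr => i _; rewrite mxE.
have degS l k d (s : 'S_n) (p : P) : degle l k d p -> degle l k d ((-1) ^+ s * p).
  by case: (odd_perm s); rewrite ?mul1r// expr1 mulN1r; apply: degleN.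
have degdet l : degle l 1 (\sum_i mm i l) (detH (fun i => F i)).
  apply: degle_sum => s _; apply/degS.
  by apply: degleW (@det_bez_small (fun i => F i) s l (degF ^~ l)); case: ifP; lia.
(* The determinant has degree one below the denominator in each variable, so the term at [K = 0] is
   the only one left. *)
rewrite (@global_resE _ _ a mm G n_gt0 a_inj degG 1%N); last by move=> l; apply: degleW (degdet l); lia.
rewrite /res_below.
have -> : multinoms_below n 1 = [:: @mnm0 n].
  apply/perm_small_eq => //; apply: uniq_perm; rewrite ?multinoms_below_uniq// => K.
  by rewrite mem_multinoms_below inE ltnS leqn0 mdeg_eq0.
rewrite big_seq1 mdeg0 mul1r /res_term big1 ?mulr1 => [|i _]; last by rewrite mnm0E.
rewrite (@eq_mresidue _ _ a _ mm) => [|i j]; last by rewrite mnm0E mul1n.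
have -> : mresidue a mm (detH (fun i => F i)) = mresidue a mm (detH (fun i => qq i)).
  apply/eqP; rewrite -subr_eq0 -raddfB; apply/eqP/mresidue_small => // l.
  rewrite /detH -sumrB; apply: degle_sum => s _; rewrite -mulrBr; apply: degS.
  (* In all variables but the last both products already drop by two. In the last one the difference
     quotient gives one and the passage from [F i] to [qq i], an error of lower degree, gives the
     other. *)
  have [ln|ln] := eqVneq l.+1 n; last first.
    by apply: degleB; rewrite -[2%N]/(if false then 1 else 2)%N -(negbTE ln);
      apply: det_bez_small => // i; apply: degle_linprod.
  pose k (i : 'I_n) := (l == s i : nat).
  have kE i H : degle l 0 (mm i l) H -> degle l (k i) (mm i l) (D (s i) H).
    move=> degH; apply: degleW (@degle_mdiffq _ _ w l (s i) _ _ _ degH).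
    by rewrite (_ : (l < s i)%N = false) /k; [case: eqP | apply/negbTE; rewrite -leqNgt -ltnS ln ltn_ord].
  have := @degle_prod_diff _ (index_enum 'I_n) (fun i => D (s i) (F i)) (fun i => D (s i) (qq i)) l k (mm ^~ l).
  have -> : (\sum_i k i)%N = 1%N.
    rewrite (bigD1 (s^-1%g l))//= /k permKV eqxx big1// => i; case: (l =P s i) => // ->.
    by rewrite permK eqxx.
  apply => i; [by apply: kE | by apply/kE/degle_linprod|].
  rewrite -mdiffqB [F i - _]addrC addKr.
  apply: degleW (@degle_mdiffq _ _ w l (s i) _ _ _ (@degG i l)).
  by rewrite (_ : (l < s i)%N = false) /k; [case: eqP | apply/negbTE; rewrite -leqNgt -ltnS ln].
rewrite -[RHS](mresidue_mixed a_inj mm_gt0 w) raddf_sum; apply: eq_bigr => s _ /=.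
have -> : \prod_i D (s i) (qq i) = \prod_l pvar l (mixed_factor a mm w s l).
  rewrite (eq_bigr _ (fun i _ => mdiffq_linprod i (s i))) exchange_big.
  apply: eq_bigr => l _; rewrite rmorph_prod; apply: eq_bigr => i _ /=.
  by case: ifP => _; [rewrite pvarC | case: ifP].
by case: (odd_perm s); rewrite ?mul1r// expr1 !mulN1r raddfN.
Qed.

End AtPoint.
End Bezoutian.

(** * Duality and traces *)

Section Ideal.
Variables (C : comRingType) (n : nat) (F : 'I_n -> {mpoly C[n]}).
Local Notation P := {mpoly C[n]}.
Implicit Types p q : P.

Definition in_ideal p := exists h : 'I_n -> P, p = \sum_i h i * F i.

Lemma in_ideal0 : in_ideal 0.
Proof. by exists (fun=> 0); rewrite big1// => i _; rewrite mul0r. Qed.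

Lemma in_idealD p q : in_ideal p -> in_ideal q -> in_ideal (p + q).
Proof.
move=> [g ->] [h ->]; exists (fun i => g i + h i).
by rewrite -big_split; apply: eq_bigr => i _; rewrite mulrDl.
Qed.

Lemma in_idealMl p q : in_ideal q -> in_ideal (p * q).
Proof.
move=> [h ->]; exists (fun i => p * h i).
by rewrite mulr_sumr; apply: eq_bigr => i _; rewrite mulrA.
Qed.

Lemma in_idealMr p q : in_ideal p -> in_ideal (p * q).
Proof. by rewrite mulrC; apply: in_idealMl. Qed.

Lemma in_idealN p : in_ideal p -> in_ideal (- p).
Proof. by rewrite -mulN1r; apply: in_idealMl. Qed.

Lemma in_idealB p q : in_ideal p -> in_ideal q -> in_ideal (p - q).
Proof. by move=> ? /in_idealN; apply: in_idealD. Qed.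

Lemma in_ideal_sum (I : Type) (r : seq I) (A : I -> P) :
  (forall i, in_ideal (A i)) -> in_ideal (\sum_(i <- r) A i).
Proof. by move=> IA; apply: big_ind => //; [apply: in_ideal0 | apply: in_idealD]. Qed.

Lemma in_ideal_gen i : in_ideal (F i).
Proof.
exists (fun j => (j == i)%:R); rewrite (bigD1 i)//= eqxx mul1r big1 ?addr0// => j /negbTE ->.
by rewrite mul0r.
Qed.

End Ideal.

(* The inner variables are the ones on which [rho] acts. *)
Definition map_coefs (C : comRingType) n (rho : {linear {mpoly C[n]} -> C | *%R})
  (B : {mpoly {mpoly C[n]}[n]}) : {mpoly C[n]} := map_mpoly rho B.

Section Duality.
Variables (C : numFieldType) (n : nat).
Local Notation P := {mpoly C[n]}.
Local Notation "''X_' i" := (mpolyX C (mnm1 i)).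
Local Notation BP := {mpoly P[n]}.
Variables (F : 'I_n -> P) (rho : {linear P -> C | *%R}).
Hypothesis rho_ideal : forall i h, rho (F i * h) = 0.
Hypothesis rho_bez : forall w : 'I_n -> C, rho (\det (\matrix_(i, j)
    mdiffq (@mpolyC n C) (fun l => mpolyC n (w l)) (fun l => 'X_l) j (F i))) = 1.

Let f2 : {rmorphism C -> BP} := (@mpolyC n P \o @mpolyC n C)%FUN.
Let xw (l : 'I_n) : BP := mpolyX P (mnm1 l).
Let yv (l : 'I_n) : BP := mpolyC n 'X_l.

Let Bez_mx : 'M[BP]_n := \matrix_(i, j) mdiffq f2 xw yv j (F i).
Let Bez : BP := \det Bez_mx.

Local Notation gL := (map_coefs rho).

Let gLD : {morph gL : A B / A + B}. Proof. by move=> A B; rewrite /map_coefs raddfD. Qed.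
Let gLB : {morph gL : A B / A - B}. Proof. by move=> A B; rewrite /map_coefs raddfB. Qed.
Let gL_sum (I : Type) (r : seq I) (A : I -> BP) :
  gL (\sum_(i <- r) A i) = \sum_(i <- r) gL (A i).
Proof. by rewrite /map_coefs raddf_sum. Qed.

Lemma gLE B : gL B = \sum_(be <- msupp B) rho (mcoeff be B) *: mpolyX C be.
Proof.
apply/mpolyP => al; rewrite /map_coefs mcoeff_map_mpoly raddf_sum /=.
under eq_bigr => be _ do rewrite mcoeffZ mcoeffX.
have [al_B|al_B] := boolP (al \in msupp B).
  rewrite (bigD1_seq al) ?msupp_uniq//= eqxx mulr1 big1 ?addr0// => be /negbTE ->.
  by rewrite mulr0.
rewrite (memN_msupp_eq0 al_B) raddf0 big_seq big1// => be be_B.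
by case: eqP => [be_al|]; rewrite ?mulr0//; rewrite -be_al be_B in al_B.
Qed.

Lemma gL_inw g B : gL (mmap f2 xw g * B) = g * gL B.
Proof.
have gLmon b be : gL (b *: mpolyX P be) = rho b *: mpolyX C be.
  apply/mpolyP => al; rewrite /map_coefs mcoeff_map_mpoly !mcoeffZ !mcoeffX.
  by case: eqP; rewrite ?mulr1// !mulr0; rewrite raddf0.
rewrite [in RHS](mpolyE B) [in LHS](mpolyE B) !gL_sum mulr_sumr gL_sum mulr_sumr.
apply: eq_bigr => be _; rewrite [in RHS](mpolyE g) mulr_suml.
rewrite /mmap mulr_suml gL_sum; apply: eq_bigr => al _.
have -> : mmap1 xw al = mpolyX P al by rewrite [in RHS]mpolyXE_id.
rewrite /= mul_mpolyC -scalerAl -scalerAr scalerA -mpolyXD !gLmon.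
rewrite -scalerAl -scalerAr scalerA -mpolyXD mul_mpolyC.
by rewrite scalarZ.
Qed.

Lemma Bez_reproducing h : in_ideal F (gL (mpolyC n h * Bez) - h * gL Bez).
Proof.
have inv_h p : mpolyC n p = mmap f2 yv p.
  rewrite {1}(mpolyE p) raddf_sum; apply: eq_bigr => al _.
  rewrite /= -mul_mpolyC mpolyCM mpolyXE_id rmorph_prod; congr (_ * _).
  by apply: eq_bigr => l _; rewrite rmorphXn.
pose dF i := mmap f2 xw (F i) - mmap f2 yv (F i).
have cramer j : (xw j - yv j) * Bez = \sum_i (\adj Bez_mx) j i * dF i.
  pose X : 'cV[BP]_n := \col_j (xw j - yv j).
  have : Bez_mx *m X = \col_i dF i.
    apply/colP => i; rewrite !mxE /dF -sum_mdiffq; apply: eq_bigr => l _.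
    by rewrite !mxE mulrC.
  move/(congr1 (mulmx (\adj Bez_mx))); rewrite mulmxA mul_adj_mx mul_scalar_mx.
  move/colP/(_ j); rewrite mxE [X in _ * X]mxE [in X in _ = X]mxE mulrC => ->.
  by apply: eq_bigr => i _; rewrite [in X in _ * X]mxE.
(* By [sum_mdiffq] the difference of [h] at the two points is a combination of the [xw j - yv j],
   and [cramer] turns each of these, times [Bez], into a combination of the [dF i]. *)
pose Y i := - \sum_j mdiffq f2 xw yv j h * (\adj Bez_mx) j i.
have E : mpolyC n h * Bez = mmap f2 xw h * Bez + \sum_i dF i * Y i.
  rewrite inv_h; apply/eqP; rewrite addrC -subr_eq -mulrBl -opprB -sum_mdiffq mulNr.
  apply/eqP; rewrite mulr_suml.
  transitivity (\sum_i - \sum_j dF i * (mdiffq f2 xw yv j h * \adj Bez_mx j i)); last first.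
    by apply: eq_bigr => i _; rewrite /Y mulrN mulr_sumr.
  rewrite sumrN; congr (- _); rewrite exchange_big; apply: eq_bigr => j _ /=.
  rewrite mulrAC cramer mulr_suml; apply: eq_bigr => i _; ring.
rewrite E gLD gL_inw addrC addKr gL_sum.
apply: in_ideal_sum => i; rewrite /dF; move: (Y i) => y.
rewrite mulrBl gLB [X in X - _]gL_inw.
apply: in_idealB; first by apply/in_idealMr/in_ideal_gen.
rewrite (_ : gL _ = 0); first exact: in_ideal0.
rewrite -inv_h.
apply/mpolyP => al; rewrite mcoeff_map_mpoly mcoeffCM mcoeff0.
exact: rho_ideal.
Qed.

(** The hypothesis [rho_bez] concerns numerical points [w]; a polynomial in the outer variables with
    value 1 at every point is 1. *)
Lemma gL_Bez : gL Bez = 1.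
Proof.
apply/eqP; rewrite -subr_eq0; apply/eqP/mpoly_eval_eq0 => w.
rewrite mevalB meval1; apply/eqP; rewrite subr_eq0; apply/eqP.
rewrite -(rho_bez w).
pose ev : {rmorphism BP -> P} := meval (fun l => mpolyC n (w l)).
have <- : ev Bez = \det (\matrix_(i, j)
    mdiffq (@mpolyC n C) (fun l => mpolyC n (w l)) (fun l => 'X_l) j (F i)).
  rewrite -det_map_mx; congr (\det _); apply/matrixP => i j; rewrite !mxE.
  apply: mdiffq_morph => [c|l|l]; rewrite /ev /= ?mevalC//.
  by rewrite mevalXU.
rewrite gLE raddf_sum /= /ev /= mevalE raddf_sum.
apply: eq_bigr => be _; rewrite mevalZ mevalX mulrC -[in RHS]mulrC /=.
have -> : \prod_i mpolyC n (w i) ^+ be i = mpolyC n (\prod_i w i ^+ be i).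
  by rewrite rmorph_prod; apply: eq_bigr => i _; rewrite rmorphXn.
by rewrite mul_mpolyC scalarZ.
Qed.

(* The Bezoutian is [\sum_k e k * e' k] with [e k] in the outer and [e' k] in the
   inner variables; on the diagonal it is the Jacobian determinant. *)
Lemma dual_family : exists N (e e' : 'I_N -> P),
  (forall h, in_ideal F (h - \sum_k rho (e' k * h) *: e k)) /\
  \sum_k e k * e' k = \det (\matrix_(i, j) mderiv j (F i)).
Proof.
pose s := msupp Bez; exists (size s).
exists (fun k => mpolyX C (nth (@mnm0 n) s k)), (fun k => mcoeff (nth (@mnm0 n) s k) Bez).
split=> [h|].
  have /in_idealN := Bez_reproducing h; rewrite gL_Bez mulr1 opprB.
  congr (in_ideal _ (_ - _)); rewrite gLE.
  rewrite -(big_mkord xpredT (fun k => rho (mcoeff (nth (@mnm0 n) s k) Bez * h) *: mpolyX C (nth (@mnm0 n) s k))).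
  rewrite -(big_nth (@mnm0 n) xpredT (fun be => rho (mcoeff be Bez * h) *: mpolyX C be)).
  transitivity (\sum_(be <- s) rho (mcoeff be (mpolyC n h * Bez)) *: mpolyX C be); last first.
    by apply: eq_bigr => be _; rewrite mcoeffCM mulrC.
  rewrite [in RHS](sum_uniq_sub (s := msupp (mpolyC n h * Bez))) ?msupp_uniq//.
    by move=> be; rewrite !mcoeff_msupp mcoeffCM; apply: contraNneq => ->; rewrite mulr0.
  move=> be _ /memN_msupp_eq0 ->; rewrite raddf0 scale0r//.
rewrite -(big_mkord xpredT (fun k => mpolyX C (nth (@mnm0 n) s k) * mcoeff (nth (@mnm0 n) s k) Bez)).
rewrite -(big_nth (@mnm0 n) xpredT (fun be => mpolyX C be * mcoeff be Bez)).
pose ev : {rmorphism BP -> P} := meval (fun l => 'X_l).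
have -> : \det (\matrix_(i, j) mderiv j (F i)) = ev Bez.
  rewrite -det_map_mx; congr (\det _); apply/matrixP => i j; rewrite !mxE -mdiffq_diag.
  apply/esym/mdiffq_morph => [c|l|l]; rewrite /ev /= ?mevalC//.
  by rewrite mevalXU.
rewrite /ev /= mevalE; apply: eq_bigr => be _.
by rewrite mulrC mpolyXE_id.
Qed.

End Duality.

(** * Multiplication operators on the quotient *)

Section TraceFormula.
Variables (C : numClosedFieldType) (n : nat) (F : 'I_n -> {mpoly C[n]}).
Local Notation P := {mpoly C[n]}.
Local Notation I := (in_ideal F).
Variable rho : {linear P -> C | *%R}.
Hypothesis rho_ideal : forall i h, rho (F i * h) = 0.
Variables (N : nat) (e e' : 'I_N -> P).
Hypothesis dual : forall h, I (h - \sum_k rho (e' k * h) *: e k).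
Implicit Types (g h u : P).

Lemma rho_in_ideal h : I h -> rho h = 0.
Proof. by move=> [A ->]; rewrite raddf_sum big1// => i _; rewrite mulrC; apply: rho_ideal. Qed.

Lemma rho_congr g h : I (g - h) -> rho g = rho h.
Proof. by move/rho_in_ideal/eqP; rewrite raddfB subr_eq0 => /eqP. Qed.

(** Coefficients of [h] in the spanning family [e], by [dual]. The map embeds the quotient into the
    column vectors, in general not onto them. *)
Let phi h : 'cV[C]_N := \col_k rho (e' k * h).
Let M h : 'M[C]_N := \matrix_(k, l) rho (e' k * (h * e l)).

Lemma phi_eq0 h : (phi h = 0) <-> I h.
Proof.
split=> [/colP phi0|Ih].
  have := dual h; rewrite big1 ?subr0// => k _.
  by have := phi0 k; rewrite !mxE => ->; rewrite scale0r.
by apply/colP => k; rewrite !mxE; apply/rho_in_ideal/in_idealMl.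
Qed.

Lemma phiM g h : phi (g * h) = M g *m phi h.
Proof.
apply/colP => k; rewrite !mxE.
transitivity (rho (e' k * (g * \sum_l rho (e' l * h) *: e l))).
  apply: rho_congr; rewrite -mulrBr; apply: in_idealMl; rewrite -mulrBr.
  by apply: in_idealMl.
rewrite !mulr_sumr raddf_sum; apply: eq_bigr => l _ /=.
by rewrite !mxE -!scalerAr scalarZ mulrC.
Qed.

Lemma phi_comb m (v : 'I_m -> C) (h : 'I_m -> P) :
  phi (\sum_i v i *: h i) = \sum_i v i *: phi (h i).
Proof.
apply/colP => k; rewrite mxE summxE mulr_sumr raddf_sum; apply: eq_bigr => i _ /=.
by rewrite !mxE -scalerAr scalarZ.
Qed.

Lemma phiB g h : phi (g - h) = phi g - phi h.
Proof. by apply/colP => k; rewrite !mxE mulrBr raddfB. Qed.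

Lemma M_col h l : col l (M h) = phi (h * e l).
Proof. by apply/colP => k; rewrite !mxE. Qed.

Lemma MM g h : M (g * h) = M g *m M h.
Proof.
apply/matrixP => k l; transitivity ((phi (g * (h * e l))) k 0).
  by rewrite !mxE -[g * h * e l]mulrA.
by rewrite phiM !mxE; apply: eq_bigr => i _; rewrite !mxE.
Qed.

Lemma M_linear c g h : M (c *: g + h) = c *: M g + M h.
Proof.
by apply/matrixP => k l; rewrite !mxE mulrDl mulrDr -scalerAl -scalerAr raddfD /= scalarZ.
Qed.

(** Modulo the ideal, 1 is a combination of the [e l], so [h] is a combination of the [h * e l],
    whose coordinates are the columns of [M h]. *)
Lemma M_eq0 h : M h = 0 -> I h.
Proof.
move=> Mh; have -> : h = h * (1 - \sum_l rho (e' l * 1) *: e l) +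
   \sum_l rho (e' l * 1) *: (h * e l).
  rewrite mulrBr mulr1 mulr_sumr; under eq_bigr do rewrite -scalerAr.
  by rewrite subrK.
apply: in_idealD; first exact: in_idealMl.
apply: in_ideal_sum => l; rewrite -mul_mpolyC; apply/in_idealMl/phi_eq0.
by rewrite -M_col Mh; apply/colP => k; rewrite !mxE.
Qed.

Lemma M_in_ideal h : I h -> M h = 0.
Proof.
by move=> Ih; apply/matrixP => k l; rewrite !mxE; apply/rho_in_ideal/in_idealMl/in_idealMr.
Qed.

Lemma trace_M h : \tr (M h) = rho (h * \sum_k e k * e' k).
Proof.
rewrite mulr_sumr raddf_sum; apply: eq_bigr => k _ /=.
by rewrite mxE mulrA mulrC; congr (rho _); ring.
Qed.

Lemma comm_M g h : M g *m M h = M h *m M g.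
Proof. by rewrite -!MM mulrC. Qed.

Lemma joint_spectrum : exists T : P -> 'M[C]_N,
  [/\ forall c g h, T (c *: g + h) = c *: T g + T h,
      forall g h, T (g * h) = T g *m T h,
      forall h, is_trig_mx (T h),
      forall h, T h = 0 <-> I h & forall h, \tr (T h) = \tr (M h)].
Proof.
(* [M 1] is included because it need not be the identity: a monomial goes to the product of the
   matrices of its variables with [M 1]. *)
pose As := M 1 :: [seq M (mpolyX C (mnm1 l)) | l <- enum 'I_n].
have [|V V_unitary] := @cotrigonalization _ _ As.
  have AsM A : A \in As -> exists h, A = M h.
    rewrite inE => /orP[/eqP ->|/mapP[l _ ->]]; first by exists 1.
    by exists (mpolyX C (mnm1 l)).
  by move=> A B /AsM[g ->] /AsM[h ->]; apply: comm_M.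
move=> /allP trigV; have V_unit := unitarymx_unit V_unitary.
pose T h := V *m M h *m invmx V.
have TZD c g h : T (c *: g + h) = c *: T g + T h.
  by rewrite /T M_linear mulmxDr mulmxDl -scalemxAr -scalemxAl.
have TM g h : T (g * h) = T g *m T h.
  by rewrite /T MM !mulmxA mulmxKV.
have trig_mul A B : is_trig_mx A -> is_trig_mx B -> is_trig_mx (A *m B : 'M[C]_N).
  move=> /is_trig_mxP trA /is_trig_mxP trB; apply/is_trig_mxP => i j ij.
  rewrite mxE big1// => k _; have [ik|ki] := ltnP i k; first by rewrite trA ?mul0r.
  by rewrite trB ?mulr0//; apply: leq_ltn_trans ij.
have T0 : T 0 = 0 by have := TZD (-1) 0 0; rewrite scaler0 addr0 scaleN1r addNr.
exists T; split=> // [h|h|h].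
- rewrite (mpolyE h); elim/big_rec: _ => [|al p _ tr_p].
    by rewrite T0; apply: mx0_is_trig.
  rewrite TZD; apply/is_trig_mxP => i j ij.
  rewrite [LHS]mxE (is_trig_mxP tr_p)// addr0 mxE.
  suff /is_trig_mxP -> : is_trig_mx (T (mpolyX C al)) by rewrite ?mulr0.
  rewrite mpolyXE_id; elim/big_rec: _ => [|l q _ tr_q].
    have /trigV : M 1 \in As by rewrite inE eqxx.
    by rewrite /= /similar_to /= conjumx.
  elim: (al l) => [|k IHk]; first by rewrite mul1r.
  rewrite exprS -mulrA TM; apply: trig_mul IHk.
  have /trigV : M (mpolyX C (mnm1 l)) \in As.
    by rewrite inE; apply/orP; right; apply/mapP; exists l; rewrite ?mem_enum.
  by rewrite /= /similar_to /= conjumx.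
- split=> [Th|Ih]; last by rewrite /T (M_in_ideal Ih) mulmx0 mul0mx.
  apply: M_eq0; rewrite -[M h](mulKmx V_unit) -[V *m M h](mulmxKV V_unit).
  by rewrite -/(T h) Th mul0mx mulmx0.
- by rewrite /T mxtrace_mulC mulmxA mulVmx// mul1mx.
Qed.

(* [rho (h * Jacobian)] is the trace of the multiplication by [h]. The [e k] span
   the quotient but need not be a basis, so that [M 1] is only idempotent: the
   characters [chi r] with [eps r = false] are zero. *)
Lemma trace_formula : exists (pts : 'I_N -> 'rV[C]_n) (eps : 'I_N -> bool),
  (forall h, rho (h * \sum_k e k * e' k) = \sum_(r | eps r) h.@[pts r]) /\
  (forall h, (forall r, eps r -> h.@[pts r] = 0) -> I (h ^+ N)) /\
  (forall h, I h -> forall r, eps r -> h.@[pts r] = 0).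
Proof.
have [T [TZD TM Ttrig T0 Ttr]] := joint_spectrum.
pose chi r h := T h r r.
have chiM r g h : chi r (g * h) = chi r g * chi r h.
  rewrite /chi TM mxE (bigD1 r)//= big1 ?addr0// => k kr.
  case: (ltngtP r k) => [rk|kr'|/val_inj/esym/eqP]; last by rewrite (negbTE kr).
    by rewrite (is_trig_mxP (Ttrig g)) ?mul0r.
  by rewrite (is_trig_mxP (Ttrig h)) ?mulr0.
have chiZD r c g h : chi r (c *: g + h) = c * chi r g + chi r h.
  by rewrite /chi TZD !mxE.
pose pts r : 'rV[C]_n := \row_l chi r (mpolyX C (mnm1 l)).
pose eps r := chi r 1 != 0.
have chi1 r : chi r 1 = (eps r)%:R.
  have := chiM r 1 1; rewrite mulr1 /eps; case: eqVneq => [-> //|x0].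
  by rewrite -[LHS]mulr1 => /(mulfI x0) <-.
have chi0 r : chi r 0 = 0.
  by have := chiZD r (-1) 0 0; rewrite scaler0 addr0 mulN1r addNr.
have chiE r h : chi r h = (eps r)%:R * h.@[pts r].
  rewrite {1}(mpolyE h) mevalE mulr_sumr; elim/big_rec2: _ => [//|al y p _ ih].
  rewrite chiZD ih; congr (_ + _); rewrite mulrCA; congr (_ * _).
  rewrite mpolyXE_id; elim/big_rec2: _ => [|l z q _ ihq]; first by rewrite chi1 mulr1.
  elim: (al l) => [|k IHk]; first by rewrite !mul1r.
  by rewrite exprS -mulrA chiM IHk !mxE exprS; ring.
exists pts, eps; split=> [h|].
  rewrite -trace_M -Ttr /mxtrace [RHS]big_mkcond/=; apply: eq_bigr => r _.
  by rewrite -/(chi r h) chiE; case: (eps r); rewrite ?mul1r ?mul0r.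
split=> [h h0|h /T0 Th r eps_r]; last first.
  by have := chiE r h; rewrite /chi Th mxE eps_r mul1r => <-.
(* The diagonal of [T h] is 0, so every further factor [h] moves the zero region of the triangular
   matrix down by one diagonal; after [N] factors nothing is left. *)
have low k (i j : 'I_N) : (i < j + k)%N -> T (h ^+ k) i j = 0.
  elim: k i j => [|k IHk] i j; first by rewrite addn0; apply/is_trig_mxP.
  rewrite exprS TM mxE addnS ltnS => le_ijk; rewrite big1// => l _.
  case: (ltngtP i l) => [il|li|/val_inj <-].
  - by rewrite (is_trig_mxP (Ttrig h)) ?mul0r.
  - by rewrite IHk ?mulr0//; apply: leq_trans le_ijk.
  - rewrite -/(chi i h) chiE; case E : (eps i); last by rewrite !mul0r.
    by rewrite h0 ?mulr0 ?mul0r.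
apply/T0/matrixP => i j; rewrite mxE low//.
by apply: leq_trans (ltn_ord i) _; rewrite leq_addl.
Qed.

(* The component of [C[w] / (F)] at [x] is [u C[w] / (F)] for an idempotent [u]. *)
Lemma local_component (pts : 'I_N -> 'rV[C]_n) (eps : 'I_N -> bool) (x : 'rV[C]_n) :
  (forall h, rho (h * \sum_k e k * e' k) = \sum_(r | eps r) h.@[pts r]) ->
  (forall h, (forall r, eps r -> h.@[pts r] = 0) -> I (h ^+ N)) ->
  exists u,
  [/\ u.@[x] = 1, forall r, pts r != x -> u.@[pts r] = 0, I (u * u - u) &
      exists b : 'I_#|[pred r | eps r && (pts r == x)]| -> P,
      forall h, exists! c : 'rV[C]_#|[pred r | eps r && (pts r == x)]|,
        I (u * (h - \sum_i c ord0 i *: b i))].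
Proof.
move=> trE nilp.
(* Lagrange interpolation: for each [pts r] other than [x], an affine function of a coordinate that
   distinguishes the two points. *)
have [u0 u0x u0pts] : exists2 u0 : P, u0.@[x] = 1 &
    forall r, pts r != x -> u0.@[pts r] = 0.
  have sep r : exists v : P, v.@[x] = 1 /\ (pts r != x -> v.@[pts r] = 0).
    have [->|rx] := eqVneq (pts r) x; first by exists 1; rewrite meval1.
    have [l xl] : exists l, pts r 0 l != x 0 l.
      apply/existsP; apply: contraNT rx; rewrite negb_exists => /forallP eq_rx.
      by apply/eqP/rowP => l; apply/eqP; have := eq_rx l; rewrite negbK.
    have xl0 : x 0 l - pts r 0 l != 0 by rewrite subr_eq0 eq_sym.
    exists ((x 0 l - pts r 0 l)^-1 *: (mpolyX C (mnm1 l) - mpolyC n (pts r 0 l))).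
    by rewrite !mevalZ !mevalB !mevalXU !mevalC subrr mulr0 mulVf.
  have /fin_all_exists[v vP] := sep.
  exists (\prod_r v r); first by rewrite rmorph_prod big1// => r _; case: (vP r).
  by move=> r rx; rewrite rmorph_prod (bigD1 r)//=; case: (vP r) => _ ->; rewrite ?mul0r.
(* Lifting of idempotents: [u] is a multiple of [u0 ^+ N.+1] and [1 - u] one of [(1 - u0) ^+ N.+1].
   Since [u0 * (1 - u0)] vanishes at all the points, its [N]-th power lies in the ideal, and so does
   [u * (1 - u)]. *)
pose u : P := 1 - (1 - u0 ^+ N.+1) ^+ N.+1.
have ux : u.@[x] = 1.
  by rewrite mevalB rmorphXn /= mevalB !meval1 rmorphXn /= u0x expr1n subrr expr0n subr0.
have upts r : pts r != x -> u.@[pts r] = 0.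
  move=> rx; rewrite mevalB rmorphXn /= mevalB !meval1 rmorphXn /= u0pts//.
  by rewrite expr0n subr0 expr1n subrr.
have uu : I (u * u - u).
  have [v1 v1E] : exists v1, u = u0 ^+ N.+1 * v1.
    rewrite /u -{1}(expr1n _ N.+1) subrXX subKr.
    by eexists.
  have [v2 v2E] : exists v2, 1 - u0 ^+ N.+1 = (1 - u0) * v2.
    by rewrite -{1}(expr1n _ N.+1) subrXX; eexists.
  have -> : u * u - u = (u0 * (1 - u0)) ^+ N * - (u0 * (1 - u0) * v1 * v2 ^+ N.+1).
    have -> : u * u - u = - (u * (1 - u)) by ring.
    rewrite {1}v1E /u subKr v2E !exprMn !exprS; ring.
  apply/in_idealMr/nilp => r _; rewrite mevalM mevalB meval1.
  have [->|rx] := eqVneq (pts r) x; first by rewrite u0x subrr mulr0.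
  by rewrite u0pts ?mul0r.
exists u; split => //.
have Muu : M u *m M u = M u.
  by have := M_linear 1 (u * u - u) u; rewrite !scale1r subrK (M_in_ideal uu) add0r MM.
set d := #|_|.
(* A full-rank factorization of the idempotent [M u]: [L] is injective, [Rr] surjective, and
   [Rr *m L] is the identity. *)
have [d0 [L [Rr [LR Linj Rinj]]]] : exists d0 (L : 'M[C]_(N, d0)) (Rr : 'M[C]_(d0, N)),
    [/\ L *m Rr = M u, forall m1 (A B : 'M[C]_(_, m1)), L *m A = L *m B -> A = B &
        forall m1 (A B : 'M[C]_(m1, _)), A *m Rr = B *m Rr -> A = B].
  exists (\rank (M u)), (col_base (M u)), (row_base (M u)).
  split; [exact: mulmx_base | |].
    by move=> m1; apply: row_full_inj; exact: col_base_full.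
  by move=> m1; apply: row_free_inj; exact: row_base_free.
have RL : Rr *m L = 1%:M.
  by apply: Linj; apply: Rinj; rewrite mulmx1 LR -mulmxA -(mulmxA Rr) LR (mulmxA L) LR Muu.
(* The rank of an idempotent is its trace, and by [trE] the trace of [M u] counts the points equal
   to [x]. *)
have rank_d : d0 = d.
  apply/eqP; rewrite -(eqr_nat C) -mxtrace1 -RL mxtrace_mulC LR trace_M trE.
  rewrite (bigID (fun r => pts r == x))/= [X in _ + X]big1 ?addr0; last first.
    by move=> r /andP[_ /upts].
  rewrite (eq_bigr (fun=> 1)) => [|r /andP[_ /eqP ->]//].
  by rewrite sumr_const.
rewrite -rank_d.
(* The columns of [L] are fixed by [M 1]; this makes them the coordinate vectors of the elements
   [b i]. *)
have M1L : M 1 *m L = L by apply: Rinj; rewrite -mulmxA LR -MM mul1r.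
pose b i := \sum_l L l i *: e l.
have Rb i : Rr *m phi (b i) = delta_mx i 0.
  have -> : phi (b i) = L *m delta_mx i 0.
    rewrite -colE -[in RHS]M1L phi_comb; apply/colP => k; rewrite summxE !mxE.
    by apply: eq_bigr => l _; rewrite !mxE mul1r mulrC.
  by rewrite mulmxA RL mul1mx.
have I_iff h (c : 'rV[C]_d0) :
    I (u * (h - \sum_i c ord0 i *: b i)) <-> Rr *m phi h = c^T.
  rewrite -phi_eq0 phiM -LR -mulmxA -[X in _ = X <-> _](mulmx0 _ L).
  have -> : Rr *m phi (h - \sum_i c ord0 i *: b i) = Rr *m phi h - c^T.
    rewrite phiB mulmxBr phi_comb mulmx_sumr; congr (_ - _).
    apply/colP => k; rewrite summxE (bigD1 k)//= -scalemxAr Rb !mxE !eqxx mulr1 big1 ?addr0//.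
    by move=> i ik; rewrite -scalemxAr Rb !mxE eq_sym (negbTE ik) mulr0.
  split=> [/Linj/eqP|->]; last by rewrite subrr.
  by rewrite subr_eq0 => /eqP.
exists b => h; exists (Rr *m phi h)^T; split; first by apply/I_iff; rewrite trmxK.
by move=> c /I_iff ->; rewrite trmxK.
Qed.

End TraceFormula.

(** * Multiplicities in the local rings *)

Section LocalMultiplicity.
Variables (R : realType) (n : nat).
Local Notation C := R[i].
Local Notation P := {mpoly C[n]}.
Local Notation "''X_' i" := (mpolyX C (mnm1 i)).
Implicit Types (f : 'I_n -> P) (x z : 'rV[C]_n) (y : {fraction P}) (h p : P).

Section LocalRing.
Variable z : 'rV[C]_n.

Lemma local_ring_tofrac p : local_ring z (tofrac p).
Proof. by exists p, 1; rewrite meval1 oner_neq0 tofrac1 divr1. Qed.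

Lemma local_ringV p : p.@[z] != 0 -> local_ring z (tofrac p)^-1.
Proof. by move=> pz; exists 1, p; rewrite tofrac1 div1r. Qed.

Lemma tofrac_neq0 p : p.@[z] != 0 -> tofrac p != 0.
Proof. by move=> pz; rewrite tofrac_eq0; apply: contraNneq pz => ->; rewrite meval0. Qed.

Lemma local_ringM y1 y2 : local_ring z y1 -> local_ring z y2 -> local_ring z (y1 * y2).
Proof.
move=> [g1 [s1 [s1z ->]]] [g2 [s2 [s2z ->]]]; exists (g1 * g2), (s1 * s2).
by rewrite mevalM mulf_neq0// !tofracM invfM mulrACA.
Qed.

Lemma local_ringD y1 y2 : local_ring z y1 -> local_ring z y2 -> local_ring z (y1 + y2).
Proof.
move=> [g1 [s1 [s1z ->]]] [g2 [s2 [s2z ->]]]; exists (g1 * s2 + g2 * s1), (s1 * s2).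
rewrite mevalM mulf_neq0// !(tofracM, tofracD) addf_div ?tofrac_neq0//.
Qed.

Lemma local_idealM f y1 y2 : local_ring z y1 -> local_ideal f z y2 -> local_ideal f z (y1 * y2).
Proof.
move=> y1z [h hz ->]; exists (fun i => y1 * h i) => [i|]; first exact: local_ringM.
by rewrite mulr_sumr; apply: eq_bigr => i _; rewrite mulrA.
Qed.

Lemma local_idealD f y1 y2 : local_ideal f z y1 -> local_ideal f z y2 -> local_ideal f z (y1 + y2).
Proof.
move=> [h hz ->] [g gz ->]; exists (fun i => h i + g i) => [i|]; first exact: local_ringD.
by rewrite -big_split; apply: eq_bigr => i _; rewrite mulrDl.
Qed.

Lemma local_idealN f y : local_ideal f z y -> local_ideal f z (- y).
Proof.
rewrite -mulN1r -tofrac1 -tofracN; apply: local_idealM; exact: local_ring_tofrac.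
Qed.

Lemma local_idealB f y1 y2 : local_ideal f z y1 -> local_ideal f z y2 -> local_ideal f z (y1 - y2).
Proof. by move=> y1z /local_idealN; apply: local_idealD. Qed.

Lemma local_ideal0 f : local_ideal f z 0.
Proof.
exists (fun=> 0) => [i|]; first by rewrite -tofrac0; apply: local_ring_tofrac.
by rewrite big1// => i _; rewrite mul0r.
Qed.

Lemma local_ideal_sum f m (A : 'I_m -> {fraction P}) :
  (forall i, local_ideal f z (A i)) -> local_ideal f z (\sum_i A i).
Proof. by move=> Az; apply: big_ind => //; [apply: local_ideal0 | apply: local_idealD]. Qed.

(* Two bases of the quotient are related by mutually inverse matrices. *)
Lemma multiplicity_le f d d' : has_multiplicity f z d -> has_multiplicity f z d' -> (d <= d')%N.
Proof.
move=> [b bz bP] [b' bz' bP'].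
have /fin_all_exists[A AP] i : exists c : 'rV[C]_d',
    local_ideal f z (b i - \sum_j tofrac (mpolyC n (c ord0 j)) * b' j).
  by have [c [? _]] := bP' _ (bz i); exists c.
have /fin_all_exists[B BP] i : exists c : 'rV[C]_d,
    local_ideal f z (b' i - \sum_j tofrac (mpolyC n (c ord0 j)) * b j).
  by have [c [? _]] := bP _ (bz' i); exists c.
apply: (@mulmx1_min C _ _ (\matrix_(i, j) A i ord0 j) (\matrix_(i, j) B i ord0 j)).
apply/row_matrixP => i; have [c [_ c_uniq]] := bP _ (bz i).
rewrite -[LHS](c_uniq (row i _)); last first.
  pose y1 := b i - \sum_j tofrac (mpolyC n (A i ord0 j)) * b' j.
  pose y2 := \sum_j tofrac (mpolyC n (A i ord0 j)) *
     (b' j - \sum_k tofrac (mpolyC n (B j ord0 k)) * b k).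
  rewrite (_ : _ - _ = y1 + y2).
    apply: local_idealD; first exact: AP.
    apply: local_ideal_sum => j; apply: local_idealM; last exact: BP.
    exact: local_ring_tofrac.
  have -> : y2 = \sum_j tofrac (mpolyC n (A i ord0 j)) * b' j -
      \sum_j \sum_k tofrac (mpolyC n (A i ord0 j)) * (tofrac (mpolyC n (B j ord0 k)) * b k).
    by rewrite -sumrB; apply: eq_bigr => j _; rewrite mulrBr mulr_sumr.
  rewrite /y1 addrA subrK; congr (_ - _).
  rewrite exchange_big; apply: eq_bigr => k _ /=.
  rewrite !mxE !raddf_sum mulr_suml; apply: eq_bigr => j _ /=.
  by rewrite !mxE mulrA mpolyCM tofracM.
apply: c_uniq; rewrite (_ : _ - _ = 0); first exact: local_ideal0.
rewrite (bigD1 i)//= !mxE eqxx mpolyC1 tofrac1 mul1r big1 ?addr0 ?subrr//.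
by move=> j /negbTE ji; rewrite !mxE eq_sym ji mpolyC0 tofrac0 mul0r.
Qed.

Lemma multiplicity_inj f d d' : has_multiplicity f z d -> has_multiplicity f z d' -> d = d'.
Proof. by move=> fd fd'; apply/eqP; rewrite eqn_leq !(multiplicity_le fd, multiplicity_le fd'). Qed.

Lemma common_denominator m (y : 'I_m -> {fraction P}) : (forall i, local_ring z (y i)) ->
  exists s (g : 'I_m -> P), s.@[z] != 0 /\ forall i, tofrac s * y i = tofrac (g i).
Proof.
move=> yz; have /fin_all_exists[g] := yz => /fin_all_exists[s sP].
exists (\prod_i s i), (fun i => (\prod_(j | j != i) s j) * g i); split.
  by rewrite rmorph_prod; apply/prodf_neq0 => i _; case: (sP i).
move=> i; have [siz ->] := sP i.
by rewrite (bigD1 i)//= !tofracM mulrC mulrA divfK ?tofrac_neq0// mulrC.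
Qed.

(** If [d] were 0, then 1 would lie in the local ideal; clearing denominators gives [s] in the ideal
    of the [f i] with a nonzero value at the zero [z]. *)
Lemma multiplicity_gt0 f d : is_zero f z -> has_multiplicity f z d -> (0 < d)%N.
Proof.
move=> fz [b bz bP]; case: d b bz bP => // b bz bP.
have [|c [[h hz]]] := bP 1; first by rewrite -tofrac1; apply: local_ring_tofrac.
rewrite big_ord0 subr0 => def1 _.
have [s [g [sz sg]]] := common_denominator hz.
have : s = \sum_i g i * f i.
  apply/eqP; rewrite -tofrac_eq raddf_sum /= -[tofrac s]mulr1 def1 mulr_sumr.
  by apply/eqP; apply: eq_bigr => i _; rewrite mulrA sg -tofracM.
move/(congr1 (meval (fun j => z ord0 j))); rewrite raddf_sum big1 => [s0|i _].
  by rewrite s0 eqxx in sz.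
by rewrite /= mevalM [X in _ * X]fz mulr0.
Qed.

End LocalRing.

(** * The inversion of coordinates and the local rings *)

Section Inversion.
Let Z (j : 'I_n) : {fraction P} := tofrac 'X_j.

Definition inv_subst : P -> {fraction P} := mmap (@tofrac P \o @mpolyC n C) (fun j => (Z j)^-1).

(** The polynomial (z_1 ... z_n)^k h(1/z); the truncated subtraction is exact once [k] bounds the
    degree of [h] in every variable. *)
Definition revp k h : P :=
  \sum_(al <- msupp h) mcoeff al h *: \prod_j 'X_j ^+ (k - al j).

Definition cubeX k : P := \prod_j 'X_j ^+ k.

Lemma Z_neq0 j : Z j != 0.
Proof. by rewrite tofrac_eq0 -msupp_eq0 msuppX. Qed.

Lemma le_msize h (al : multinom n) k j : (msize h <= k)%N -> al \in msupp h -> (al j <= k)%N.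
Proof.
move=> le_hk /msize_mdeg_lt lt_al; apply: leq_trans le_hk; apply: leq_trans (ltnW lt_al).
by rewrite mdegE (bigD1 j)//= leq_addr.
Qed.

Lemma exp_subV (L : fieldType) (t : L) k m : t != 0 -> (m <= k)%N ->
  t ^+ (k - m) = t^-1 ^+ m * t ^+ k.
Proof.
move=> t0 le_mk; rewrite -[in RHS](subnK le_mk) exprD mulrCA exprVn mulVf ?mulr1//.
by rewrite expf_neq0.
Qed.

Lemma inv_subst_revp k h : (msize h <= k)%N ->
  inv_subst h * tofrac (cubeX k) = tofrac (revp k h).
Proof.
move=> le_hk; rewrite /inv_subst /mmap /revp /cubeX mulr_suml raddf_sum big_seq [RHS]big_seq.
apply: eq_bigr => al al_h /=; rewrite -mul_mpolyC tofracM -mulrA; congr (_ * _).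
rewrite !rmorph_prod /mmap1 -big_split; apply: eq_bigr => j _ /=.
by rewrite !tofracXn -/(Z j) exp_subV ?Z_neq0 ?(le_msize _ le_hk).
Qed.

Lemma tofrac_inv_subst k h : (msize h <= k)%N ->
  tofrac h = inv_subst (revp k h) * tofrac (cubeX k).
Proof.
move=> le_hk; rewrite {1}(mpolyE h) /revp /cubeX /inv_subst !raddf_sum mulr_suml big_seq [RHS]big_seq.
apply: eq_bigr => al al_h; rewrite /= mmapZ -mul_mpolyC tofracM -mulrA; congr (_ * _).
rewrite mpolyXE_id !rmorph_prod -big_split; apply: eq_bigr => j _ /=.
rewrite !rmorphXn /= mmapX mmap1U -/(Z j) -exp_subV ?Z_neq0 ?leq_subr// subKn//.
exact: le_msize le_hk al_h.
Qed.

Definition inv_point x : 'rV[C]_n := \row_j (x ord0 j)^-1.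

Lemma meval_revp k h x : (msize h <= k)%N -> off_hyperplanes x ->
  (revp k h).@[inv_point x] = h.@[x] * \prod_j (x ord0 j)^-1 ^+ k.
Proof.
move=> le_hk x0; rewrite [in RHS]mevalE /revp raddf_sum mulr_suml big_seq [RHS]big_seq.
apply: eq_bigr => al al_h; rewrite /= mevalZ -mulrA; congr (_ * _).
rewrite rmorph_prod -big_split; apply: eq_bigr => j _ /=.
rewrite rmorphXn /= mevalXU mxE exp_subV ?invr_eq0 ?x0// ?invrK//.
exact: le_msize le_hk al_h.
Qed.

Lemma inv_pointK : involutive inv_point.
Proof. by move=> x; apply/rowP => j; rewrite !mxE invrK. Qed.

Lemma off_inv_point x : off_hyperplanes x -> off_hyperplanes (inv_point x).
Proof. by move=> x0 j; rewrite mxE invr_eq0. Qed.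

Lemma prod_inv_neq0 k x : off_hyperplanes x -> \prod_j (x ord0 j)^-1 ^+ k != 0.
Proof. by move=> x0; apply/prodf_neq0 => j _; rewrite expf_neq0// invr_eq0 x0. Qed.

Lemma meval_cubeX k x : off_hyperplanes x -> (cubeX k).@[x] != 0.
Proof.
move=> x0; rewrite rmorph_prod; apply/prodf_neq0 => j _.
by rewrite rmorphXn /= mevalXU expf_neq0.
Qed.

Lemma cubeX_neq0 k : tofrac (cubeX k) != 0.
Proof. by rewrite rmorph_prod; apply/prodf_neq0 => j _; rewrite /= tofracXn expf_neq0 ?Z_neq0. Qed.

(** The reversed polynomial is 0, so [h] vanishes off the coordinate hyperplanes; [cubeX 1] vanishes
    on them, and the product is 0 everywhere. *)
Lemma inv_subst_inj h : inv_subst h = 0 -> h = 0.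
Proof.
move=> h0; have := inv_subst_revp (leqnn (msize h)); rewrite h0 mul0r => /esym/eqP.
rewrite tofrac_eq0 => /eqP rev0.
suff : h * cubeX 1 = 0.
  by move/eqP; rewrite mulf_eq0 -[cubeX 1 == 0]tofrac_eq0 (negbTE (cubeX_neq0 1)) orbF => /eqP.
apply: mpoly_eval_eq0 => w; rewrite rmorphM /=.
have [[j wj]|w0] := pselect (exists j, w j = 0).
  rewrite [X in _ * X](_ : _ = 0) ?mulr0// rmorph_prod (bigD1 j)//=.
  by rewrite rmorphXn /= mevalXU wj expr1 mul0r.
pose x : 'rV[C]_n := \row_j w j.
have x0 : off_hyperplanes x by move=> j; rewrite mxE; apply/eqP => wj; apply: w0; exists j.
have := meval_revp (leqnn (msize h)) x0; rewrite rev0 meval0 => /esym/eqP.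
rewrite mulf_eq0 (negbTE (prod_inv_neq0 _ x0)) orbF => /eqP hx.
by rewrite (@meval_eq _ _ w (fun j => x ord0 j) h) ?hx ?mul0r// => j; rewrite mxE.
Qed.

Lemma local_ring_inv_subst x h : off_hyperplanes x -> local_ring (inv_point x) (inv_subst h).
Proof.
move=> x0; exists (revp (msize h) h), (cubeX (msize h)).
by rewrite meval_cubeX -?inv_subst_revp ?mulfK ?cubeX_neq0//; apply: off_inv_point.
Qed.

Lemma local_ring_inv_substV x h : off_hyperplanes x -> h.@[x] != 0 ->
  inv_subst h != 0 /\ local_ring (inv_point x) (inv_subst h)^-1.
Proof.
move=> x0 hx; have rev0 : (revp (msize h) h).@[inv_point x] != 0.
  by rewrite meval_revp// mulf_neq0// prod_inv_neq0.
split; first by apply: contraNneq hx => /inv_subst_inj ->; rewrite meval0.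
exists (cubeX (msize h)), (revp (msize h) h); split=> //.
by rewrite -inv_subst_revp// invfM mulrCA mulfV ?mulr1// cubeX_neq0.
Qed.

Variables (f F : 'I_n -> P) (mu : 'I_n -> P).
Hypothesis fF : forall i, tofrac (f i) = inv_subst (F i) * tofrac (mu i).
Hypothesis mu_neq0 : forall i x, off_hyperplanes x -> (mu i).@[x] != 0.

Lemma inv_substM g h : inv_subst (g * h) = inv_subst g * inv_subst h.
Proof. by rewrite /inv_subst rmorphM. Qed.

Lemma inv_substB g h : inv_subst (g - h) = inv_subst g - inv_subst h.
Proof. by rewrite /inv_subst rmorphB. Qed.

Lemma inv_subst_sum (I : Type) (r : seq I) (A : I -> P) :
  inv_subst (\sum_(i <- r) A i) = \sum_(i <- r) inv_subst (A i).
Proof. by rewrite /inv_subst rmorph_sum. Qed.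

Section AtPoint.
Variables (x : 'rV[C]_n) (u : P).
Hypotheses (x_off : off_hyperplanes x) (ux : u.@[x] = 1).
Hypothesis u_local : forall S, S.@[x] != 0 -> exists T, in_ideal F (u * (1 - S * T)).
Local Notation z := (inv_point x).

(** From right to left, [u] is a unit near [x] and so are the [mu i] at the inverted point.
    Conversely, clearing denominators puts [S * h] in the ideal for some [S] with nonzero value at
    [x], and [u_local] inverts [S] on the component of [u]. *)
Lemma local_ideal_inv_subst h : local_ideal f z (inv_subst h) <-> in_ideal F (u * h).
Proof.
split=> [[y yz def_h]|[A uh]]; last first.
  have [u0 uV] : inv_subst u != 0 /\ local_ring z (inv_subst u)^-1.
    by apply: local_ring_inv_substV => //; rewrite ux oner_neq0.
  exists (fun i => (inv_subst u)^-1 * (inv_subst (A i) * (tofrac (mu i))^-1)).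
    move=> i; apply: local_ringM => //; apply: local_ringM; first exact: local_ring_inv_subst.
    by apply/local_ringV/mu_neq0/off_inv_point.
  apply: (mulfI u0); rewrite -inv_substM uh inv_subst_sum mulr_sumr.
  apply: eq_bigr => i _; rewrite inv_substM fF !mulrA divff// mul1r mulrAC divfK//.
  by apply: (@tofrac_neq0 z); apply/mu_neq0/off_inv_point.
have [s [g [sz sg]]] := common_denominator yz.
pose k := maxn (msize s) (\max_i msize (g i * mu i)).
have le_sk : (msize s <= k)%N by rewrite leq_maxl.
have le_gk i : (msize (g i * mu i) <= k)%N.
  by rewrite leq_max; apply/orP; right; apply: (@leq_bigmax _ (fun i => msize (g i * mu i))).
pose S := revp k s.
have Sx : S.@[x] != 0.
  rewrite -[x]inv_pointK meval_revp//; last exact: off_inv_point.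
  by rewrite mulf_neq0// prod_inv_neq0//; apply: off_inv_point.
have Sh : S * h = \sum_i revp k (g i * mu i) * F i.
  apply/eqP; rewrite -subr_eq0; apply/eqP/inv_subst_inj.
  rewrite inv_substB inv_substM [X in _ - X]inv_subst_sum; apply/eqP; rewrite subr_eq0.
  apply/eqP/(mulIf (cubeX_neq0 k)); rewrite mulrAC -tofrac_inv_subst// def_h mulr_sumr mulr_suml.
  apply: eq_bigr => i _; rewrite mulrA sg fF inv_substM mulrAC -tofrac_inv_subst//.
  by rewrite tofracM mulrCA mulrC.
have [T uT] := u_local Sx.
have -> : u * h = u * (1 - S * T) * h + u * T * (S * h) by ring.
apply: in_idealD; first exact: in_idealMr.
by apply: in_idealMl; rewrite Sh; eexists.
Qed.

(** A denominator that is nonzero at the point has a polynomial inverse on the component, so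
    polynomials in the inverted coordinates represent all classes. *)
Lemma local_ring_mod y : local_ring z y -> exists h, local_ideal f z (y - inv_subst h).
Proof.
move=> [g [s [sz ->]]]; pose k := maxn (msize s) (msize g).
pose S := revp k s; pose G := revp k g.
have Sx : S.@[x] != 0.
  rewrite -[x]inv_pointK meval_revp ?leq_maxl//; last exact: off_inv_point.
  by rewrite mulf_neq0// prod_inv_neq0//; apply: off_inv_point.
have [T uT] := u_local Sx; exists (G * T).
have [S0 SV] := local_ring_inv_substV x_off Sx.
have -> : tofrac g / tofrac s - inv_subst (G * T) =
    inv_subst G / inv_subst S * inv_subst (1 - S * T).
  rewrite (@tofrac_inv_subst k s) ?leq_maxl// (@tofrac_inv_subst k g) ?leq_maxr//.
  rewrite -/S -/G inv_substB !inv_substM invfM mulrACA divff ?cubeX_neq0// mulr1 mulrBr.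
  by rewrite [in RHS]mulrA divfK// [inv_subst 1]rmorph1 mulr1.
apply: local_idealM; last exact/local_ideal_inv_subst.
by apply: local_ringM => //; apply: local_ring_inv_subst.
Qed.

Lemma has_multiplicity_local d (b : 'I_d -> P) :
  (forall h, exists! c : 'rV[C]_d, in_ideal F (u * (h - \sum_i c ord0 i *: b i))) ->
  has_multiplicity f z d.
Proof.
move=> bP; exists (fun i => inv_subst (b i)) => [i|y yz]; first exact: local_ring_inv_subst.
have [h yh] := local_ring_mod yz.
have E (c : 'rV[C]_d) :
    local_ideal f z (y - \sum_i tofrac (mpolyC n (c ord0 i)) * inv_subst (b i)) <->
    in_ideal F (u * (h - \sum_i c ord0 i *: b i)).
  rewrite -local_ideal_inv_subst inv_substB inv_subst_sum.
  have -> : \sum_i inv_subst (c ord0 i *: b i) =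
      \sum_i tofrac (mpolyC n (c ord0 i)) * inv_subst (b i).
    by apply: eq_bigr => i _; rewrite /inv_subst mmapZ.
  set s := \sum_i _; split=> [ys|hs].
    rewrite (_ : _ - s = (y - s) - (y - inv_subst h)); first exact: local_idealB.
    by ring.
  rewrite (_ : y - s = (inv_subst h - s) + (y - inv_subst h)); first exact: local_idealD.
  by ring.
have [c [hc c_uniq]] := bP h; exists c; split; first exact/E.
by move=> c' /E/c_uniq.
Qed.

End AtPoint.
End Inversion.
End LocalMultiplicity.

(** * From the trace to the sum over the zeros *)

Section PowerSum.
Variables (R : realType) (n : nat).
Local Notation C := R[i].
Local Notation P := {mpoly C[n]}.
Local Notation "''X_' i" := (mpolyX C (mnm1 i)).
Variables (f F mu : 'I_n -> P).
Hypothesis fF : forall i, tofrac (f i) = inv_subst (F i) * tofrac (mu i).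
Hypothesis mu_neq0 : forall i x, off_hyperplanes x -> (mu i).@[x] != 0.
Variable rho : {linear P -> C | *%R}.
Hypothesis rho_ideal : forall i h, rho (F i * h) = 0.
Variables (N : nat) (e e' : 'I_N -> P).
Hypothesis dual : forall h, in_ideal F (h - \sum_k rho (e' k * h) *: e k).
Local Notation Jac := (\sum_k e k * e' k).

Lemma is_zero_inv x : off_hyperplanes x -> is_zero f (inv_point x) <-> is_zero F x.
Proof.
move=> x0; have z0 := off_inv_point x0.
have E i : f i * @cubeX R n (msize (F i)) = revp (msize (F i)) (F i) * mu i.
  apply/eqP; rewrite -tofrac_eq !tofracM fF mulrAC; apply/eqP; congr (_ * _).
  exact: inv_subst_revp.
have Ez i : (f i).@[inv_point x] * (@cubeX R n (msize (F i))).@[inv_point x] =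
    (F i).@[x] * (\prod_j (x ord0 j)^-1 ^+ msize (F i) * (mu i).@[inv_point x]).
  by rewrite mulrA -meval_revp// -!mevalM E.
split=> [fz i|Fx i].
  have /esym/eqP := Ez i; rewrite fz mul0r !mulf_eq0 (negbTE (prod_inv_neq0 _ x0)).
  by rewrite (negbTE (mu_neq0 _ z0)) !orbF => /eqP.
have /eqP := Ez i; rewrite Fx mul0r mulf_eq0 (negbTE (meval_cubeX _ z0)) orbF.
by move/eqP.
Qed.

Lemma zeros_and_power_sum : (exists zs, zeros_with_multiplicity f zs) /\
  forall zs, zeros_with_multiplicity f zs -> forall gam : multinom n,
    \sum_(z <- zs) \prod_k (z ord0 k) ^- (gam k).+1 =
    rho ((\prod_k 'X_k ^+ (gam k).+1) * Jac).
Proof.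
have [pts [eps [trE [nilp van]]]] := trace_formula rho_ideal dual.
pose off (x : 'rV[C]_n) := [forall k, x ord0 k != 0].
have offP x : reflect (off_hyperplanes x) (off x) by apply: forallP.
pose zs0 := [seq inv_point (pts r) | r <- enum 'I_N & eps r && off (pts r)].
have count_zs0 x : off_hyperplanes x ->
    count_mem (inv_point x) zs0 = #|[pred r | eps r && (pts r == x)]|.
  move=> x0; rewrite count_map count_filter cardE size_filter -enumT; apply: eq_count => r /=.
  rewrite (inj_eq (inv_inj (@inv_pointK R n))) !inE andbC -andbA andbC -andbA.
  by case: eqP => [->|]; rewrite ?andbF//= andbT; case: offP; rewrite ?andbT ?andbF.
have mult x : off_hyperplanes x ->
    has_multiplicity f (inv_point x) #|[pred r | eps r && (pts r == x)]|.
  move=> x0; have [u [ux upts uu [b bP]]] := local_component rho_ideal dual x trE nilp.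
  apply: (has_multiplicity_local fF mu_neq0 x0 ux) bP => S Sx.
  pose S' := (S.@[x])^-1 *: S.
  (* [S'] has value 1 at [x], so [u * (1 - S')] vanishes at all the points and is nilpotent modulo
     the ideal; [v] is the finite geometric series that inverts [S'] on the component. *)
  have [v vE] : exists v, 1 - (1 - S') ^+ N.+1 = S' * v.
    by rewrite -{1}(expr1n _ N.+1) subrXX subKr; eexists.
  exists ((S.@[x])^-1 *: v).
  rewrite -scalerAr scalerAl -vE subKr.
  have uk k : in_ideal F (u ^+ k.+1 - u).
    elim: k => [|k IHk]; first by rewrite expr1 subrr; apply: in_ideal0.
    have -> : u ^+ k.+2 - u = u * (u ^+ k.+1 - u) + (u * u - u) by rewrite exprS; ring.
    by apply: in_idealD uu; apply: in_idealMl.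
  have -> : u * (1 - S') ^+ N.+1 = (u * (1 - S')) ^+ N * (u * (1 - S')) -
      (u ^+ N.+1 - u) * (1 - S') ^+ N.+1 by rewrite exprMn !exprSr; ring.
  apply: in_idealB; last exact/in_idealMr/uk.
  apply/in_idealMr/nilp => r _; rewrite mevalM mevalB meval1 mevalZ.
  have [->|rx] := eqVneq (pts r) x; first by rewrite mulVf// subrr mulr0.
  by rewrite upts ?mul0r.
(* Multiplicities of zeros are positive, hence no zero off the hyperplanes is missing from [zs0]. *)
have in_zs0 z : is_zero f z -> off_hyperplanes z -> z \in zs0 /\ has_multiplicity f z (count_mem z zs0).
  move=> fz z0; have x0 := off_inv_point z0.
  have := mult _ x0; rewrite -count_zs0// inv_pointK => zm; split=> //.
  by have := multiplicity_gt0 fz zm; rewrite -has_count has_pred1.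
have zs0P : zeros_with_multiplicity f zs0.
  split=> [z /mapP[r]|//]; rewrite mem_filter => /andP[/andP[eps_r /offP x0] _] ->.
  split; last exact: off_inv_point.
  apply/is_zero_inv => // i; apply: van => //; exact: in_ideal_gen.
split; first by exists zs0.
move=> zs [zs_zero zs_mult] gam.
(* The multiplicity at a point is unique, so any admissible list is a permutation of [zs0]. *)
have eq_zs : perm_eq zs zs0.
  apply/allP => z _ /=; apply/eqP.
  have [[fz z0]|nz] := pselect (is_zero f z /\ off_hyperplanes z).
    have [_ zm] := zs_mult z fz z0; have [_ zm0] := in_zs0 z fz z0.
    exact: multiplicity_inj zm zm0.
  have notin s : (forall x, x \in s -> is_zero f x /\ off_hyperplanes x) -> count_mem z s = 0%N.
    by move=> sz; apply/count_memPn/negP => /sz.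
  by rewrite !notin//; case: zs0P.
rewrite (perm_big _ eq_zs) trE big_map big_filter big_enum_cond /= [RHS](bigID (fun r => off (pts r)))/=.
rewrite [X in _ + X]big1 ?addr0 => [|r /andP[_]].
  apply: eq_bigr => r _; rewrite rmorph_prod; apply: eq_bigr => k _.
  by rewrite mxE exprVn invrK rmorphXn /= mevalXU.
rewrite negb_forall => /existsP[k]; rewrite negbK => /eqP pk.
by rewrite rmorph_prod (bigD1 k)//= rmorphXn /= mevalXU pk expr0n mul0r.
Qed.

End PowerSum.

(** * The system in the inverted coordinates *)

Section PowerSumResidues.
Variables (R : realType) (n : nat) (a : 'I_n -> 'I_n -> R[i]) (m : 'I_n -> 'I_n -> nat).
Variables (c : 'I_n -> {mpoly R[i][n]}).
Hypotheses (n_gt0 : (0 < n)%N) (m_gt0 : forall i j, (0 < m i j)%N).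
Hypothesis a_neq : forall i k j, i != k -> a i j != a k j.
Hypothesis degQ : forall i j, a i j != 0 -> (degz j (Q c i) <= m i j)%N.
Local Notation C := R[i].
Local Notation P := {mpoly C[n]}.
Local Notation "''X_' i" := (mpolyX C (mnm1 i)).
Local Notation mm := (mexp a m c).
Local Notation G := (Qt a m c).

Lemma a_inj j : injective (a ^~ j).
Proof. by move=> i k /eqP; apply: contraTeq => /a_neq. Qed.

Lemma le_degz (p : P) (al : multinom n) j : al \in msupp p -> (al j <= degz j p)%N.
Proof. by move=> al_p; apply: (@leq_bigmax_seq _ _ xpredT (fun k : multinom n => k j) _ al_p isT). Qed.

(** Due to the factor z_1 ... z_n of [Q c i]. After inversion this becomes the strict degree bound
    on [Qt], and it makes the modified exponents [mexp] positive. *)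
Lemma msupp_Q_gt0 i (al : multinom n) j : al \in msupp (Q c i) -> (0 < al j)%N.
Proof.
rewrite /Q => /msuppM_le/allpairsP[[b1 b2] [/= b1_X _ ->]]; rewrite mnmDE addn_gt0; apply/orP; left.
have E : \prod_k 'X_k = mpolyX C (Multinom [tuple 1%N | k < n]).
  by rewrite mpolyXE_id; apply: eq_bigr => k _; rewrite multinomE tnth_mktuple expr1.
by move: b1_X; rewrite E msuppX inE => /eqP ->; rewrite multinomE tnth_mktuple.
Qed.

Lemma degz_le_mexp i j : (degz j (Q c i) <= mm i j)%N.
Proof.
rewrite /mexp; have [aij|aij] := eqVneq (a i j) 0; last exact: degQ.
have [->|//] := eqVneq (Q c i) 0; by rewrite /degz msupp0 big_nil.
Qed.

Lemma mexp_gt0 i j : (0 < mm i j)%N.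
Proof.
rewrite /mexp; case: ifP => // /andP[_ Q0].
have [al al_Q] : exists al, al \in msupp (Q c i).
  case Qs : (msupp (Q c i)) => [|al s]; last by exists al; rewrite inE eqxx.
  by rewrite (msuppnil0 Qs) eqxx in Q0.
exact: leq_trans (msupp_Q_gt0 j al_Q) (le_degz j al_Q).
Qed.

Lemma degle_Qt i l : degle l 1 (mm i l) (G i).
Proof.
rewrite /Qt big_seq; apply: degle_sum => al al_Q; apply: degleZ.
apply: degleW (@degleX _ n l _); rewrite multinomE tnth_mktuple.
have := msupp_Q_gt0 l al_Q; have := leq_trans (le_degz l al_Q) (degz_le_mexp i l).
by move: (al l) (mm i l) => x y; lia.
Qed.

Let mu i : P := \prod_j 'X_j ^+ mm i j.

Lemma tofrac_sys i : tofrac (sys a m c i) = inv_subst (qt a m c i + G i) * tofrac (mu i).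
Proof.
have Z0 := @Z_neq0 R n.
rewrite /sys /inv_subst !raddfD /= mulrDl; congr (_ + _).
  rewrite /q /qt /mu !rmorph_prod -big_split; apply: eq_bigr => j _ /=.
  rewrite !rmorphXn /= -exprMn !rmorphB /= mmapX mmap1U mmapC mulrBl mulVf//= tofrac1.
  (* Where [a i j = 0] the factor of [q] is 1 for any exponent, so the exponents [m] and [mexp] may
     differ there. *)
  rewrite -mul_mpolyC tofracM /mexp; case: (eqVneq (a i j) 0) => [->|//] /=.
  by rewrite mpolyC0 tofrac0 mul0r subr0 !expr1n.
rewrite {1}(mpolyE (Q c i)) /Qt /mu !raddf_sum mulr_suml big_seq [RHS]big_seq.
apply: eq_bigr => al al_Q; rewrite /= mmapZ -mul_mpolyC tofracM -mulrA; congr (_ * _).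
rewrite mpolyXE_id !rmorph_prod mmapX /mmap1 -big_split; apply: eq_bigr => j _ /=.
have le_al := leq_trans (le_degz j al_Q) (degz_le_mexp i j).
by rewrite !rmorphXn multinomE tnth_mktuple /= -exp_subV// ?leq_subr// subKn.
Qed.

Lemma degle_mderiv (l j : 'I_n) k d (p : P) :
  degle l k d p -> degle l (k + (l == j)) d (mderiv j p).
Proof.
move=> /degleP p0; apply/degleP => al; rewrite addnA => lt_d.
by rewrite mcoeff_mderiv p0 ?mul0rn// mnmDE mnm1E eq_sym addnAC.
Qed.

(** Each term of the determinant contains exactly one factor differentiated in the variable [l]. *)
Lemma degle_Delta l : degle l 1 (\sum_i mm i l) (Delta a m c).
Proof.
apply: degle_sum => s _.
have : degle l 1 (\sum_i mm i l) (\prod_i mderiv (s i) (qt a m c i + G i)).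
  have -> : 1%N = (\sum_i (l == s i))%N.
    rewrite (bigD1 (s^-1%g l))//= permKV eqxx big1// => i.
    by case: (l =P s i) => // ->; rewrite permK eqxx.
  apply: degle_prod => i _; apply: (@degle_mderiv l (s i) 0); apply: degleD.
    exact: degle_linprod.
  by apply: degleW (@degle_Qt i l); rewrite addn0 leq_addr.
rewrite (eq_bigr (fun i => (\matrix_(i, j) mderiv j (qt a m c i + G i)) i (s i))); last first.
  by move=> i _; rewrite mxE.
by case: (odd_perm s); rewrite ?mul1r// expr1 mulN1r; apply: degleN.
Qed.

Definition numerator (gam K : multinom n) : P :=
  (\prod_k 'X_k ^+ (gam k).+1) * Delta a m c * \prod_i G i ^+ K i.

Definition pole_order (K : multinom n) i l : nat := ((K i).+1 * mm i l)%N.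

(** The origin of the bound in [frakR]: w^{gam + I} has degree [gam l + 1] in the variable [l],
    [Delta] one less than the sum of the [mm i l], and the degree count asks for a gap of two, that
    is, [gam l + 2 <= mdeg K] for all [l]. *)
Lemma residue_notin_frakR (gam K : multinom n) : ~ frakR gam K ->
  mresidue a (pole_order K) (numerator gam K) = 0.
Proof.
move=> KR; apply: (res_term_small n_gt0 a_inj degle_Qt) => l.
have le_gam : (gam l + 2 <= mdeg K)%N.
  by rewrite leqNgt; apply/negP => lt_K; apply: KR; exists l.
have degX : degle l 0 (gam l).+1 (\prod_k 'X_k ^+ (gam k).+1).
  have -> : \prod_k 'X_k ^+ (gam k).+1 = mpolyX C (Multinom [tuple (gam k).+1 | k < n]).
    by rewrite mpolyXE_id; apply: eq_bigr => k _; rewrite multinomE tnth_mktuple.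
  by apply: degleW (@degleX _ n l _); rewrite multinomE tnth_mktuple.
by apply: degleW (degleM degX (degle_Delta l)); lia.
Qed.

Lemma power_sum_residues : (exists zs, zeros_with_multiplicity (sys a m c) zs) /\
  forall zs, zeros_with_multiplicity (sys a m c) zs -> forall gam : multinom n,
    \sum_(z <- zs) \prod_k (z ord0 k) ^- (gam k).+1 =
    \sum_(K \in frakR gam) (-1) ^+ mdeg K * mresidue a (pole_order K) (numerator gam K).
Proof.
have [rho rhoE] : exists rho : {linear P -> C | *%R}, forall g, rho g = global_res a mm G g.
  by exists (HB.pack (global_res a mm G)
    (GRing.isLinear.Build C P C _ _ (global_res_linear n_gt0 a_inj degle_Qt)) : {linear P -> C | *%R}).
have rho_ideal i h : rho ((linprod a i (mm i) + G i) * h) = 0.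
  by rewrite rhoE (global_res_ideal n_gt0 a_inj degle_Qt).
have rho_bez w : rho (\det (\matrix_(i, j) mdiffq (@mpolyC n C) (fun l => mpolyC n (w l))
    (fun l => 'X_l) j (linprod a i (mm i) + G i))) = 1.
  by rewrite rhoE (global_res_bez n_gt0 a_inj mexp_gt0 degle_Qt).
have [N [e [e' [dual Jac]]]] := dual_family rho_ideal rho_bez.
have mu0 i x : off_hyperplanes x -> (mu i).@[x] != 0.
  move=> x0; rewrite rmorph_prod; apply/prodf_neq0 => j _.
  by rewrite rmorphXn /= mevalXU expf_neq0.
have [ex_zs sumE] := zeros_and_power_sum tofrac_sys mu0 rho_ideal dual.
split; first exact: ex_zs.
move=> zs zsP gam; rewrite (sumE zs zsP gam) Jac rhoE.
have fin := finite_frakR gam.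
rewrite fsbig_finite//= /global_res -/(Delta a m c).
set g := _ * _; pose T K := (-1) ^+ mdeg K * mresidue a (pole_order K) (numerator gam K).
(* A truncation that exceeds both the one of [global_res] and all degrees in [frakR gam]. *)
pose N1 := (msize g + \max_(K <- fset_set (frakR gam)) (mdeg K)).+1.
have -> : res_below a mm G (msize g).+1 g = res_below a mm G N1 g.
  apply/esym/res_below_wider => //; first exact: a_inj; first exact: degle_Qt.
    by rewrite /N1 ltnS leq_addr.
  by move=> l; apply: degleW (@degle_msize _ _ g l); rewrite addn1 addn2 ltnS leq_addr.
rewrite /res_below -[LHS]/(\sum_(K <- multinoms_below n N1) T K).
apply: sum_uniq_sub; rewrite ?multinoms_below_uniq ?fset_uniq//.
  move=> K KR; rewrite mem_multinoms_below /N1 ltnS; apply: leq_trans (leq_addl _ _).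
  exact: (@leq_bigmax_seq _ _ xpredT (@mdeg n)).
move=> K _ KR; rewrite /T residue_notin_frakR ?mulr0// => KR'.
by move/negP: KR; apply; rewrite in_fset_set// inE.
Qed.

End PowerSumResidues.

Local Open Scope classical_set_scope.
Local Open Scope ring_scope.

(** * Mixed derivatives *)

Section RationalDerivative.
Variable K : numFieldType.

Lemma cvg_horner (T : Type) (F : set_system T) {FF : Filter F} (p : {poly K}) (g : T -> K) (x : K) :
  g @ F --> x -> (fun t => p.[g t]) @ F --> p.[x].
Proof.
move=> gx; elim/poly_ind: p => [|p c IHp].
  have -> : (fun t => (0 : {poly K}).[g t]) = cst 0 by apply/funext => h; rewrite horner0.
  by rewrite horner0; exact: cvg_cst.
have -> : (fun t => (p * 'X + c%:P).[g t]) = (fun t => p.[g t] * g t + c).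
  by apply/funext => h; rewrite hornerD hornerC hornerM hornerX.
rewrite hornerD hornerC hornerM hornerX; apply: cvgD; last exact: cvg_cst.
by apply: cvgM; first exact: IHp.
Qed.

Lemma cvg_shift0 (x : K) : (fun h => x + h) @ nbhs (0 : K) --> x.
Proof.
have FF := nbhs_filter (0 : K).
by rewrite -[X in _ --> X]addr0; apply: cvgD; [exact: cvg_cst|exact: cvg_id].
Qed.

Lemma near_horner_neq0 (p : {poly K}) (x : K) : p.[x] != 0 ->
  \forall h \near nbhs (0 : K), p.[x + h] != 0.
Proof.
have FF := nbhs_filter (0 : K).
move=> px; have px_cvg : (fun h => p.[x + h]) @ nbhs (0 : K) --> p.[x].
  by apply: cvg_horner; apply: cvg_shift0.
exact: (@cvgr_neq0 K K^o K _ FF (fun h => p.[x + h]) p.[x] px_cvg px).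
Qed.

(** The increment need only factor as [h * q h] for small [h]; the derivative is then the limit of
    [q]. *)
Lemma derive_difference_quotient (V : normedModType K) (g : V -> K^o) (w v : V) (q : K -> K) (d : K) :
  (\forall h \near nbhs (0 : K), g (h *: v + w) - g w = h * q h) ->
  q @ nbhs (0 : K) --> d -> 'D_v g w = d.
Proof.
move=> gq qd; have FF := nbhs_filter (0 : K).
apply: cvg_lim; first exact: norm_hausdorff.
have qd' : q @ within (fun h => h != 0) (nbhs (0 : K)) --> d.
  by apply: cvg_trans qd; apply: cvg_app; exact: cvg_within.
apply: cvg_trans qd'; apply: near_eq_cvg; rewrite near_withinE.
near=> h => h0 /=.
by rewrite (near gq h)// /GRing.scale /= mulKf.
Unshelve. all: by end_near. Qed.

Variables (n : nat) (I : eqType) (s : seq I) (c : I -> K) (p : I -> 'I_n -> {poly K}).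
Variable r : 'I_n -> {poly K}.

(** A sum of products of one-variable fractions, differentiated [k t] times in the variable [t]: a
    class of functions stable under partial derivatives. *)
Definition rational_sum (k : 'I_n -> nat) (w : 'rV[K]_n) : K :=
  \sum_(al <- s) c al * \prod_t ((dnum (r t) (p al t) (k t)).[w ord0 t] / (r t).[w ord0 t] ^+ (k t).+1).

Definition off_poles (w : 'rV[K]_n) : Prop := forall t, (r t).[w ord0 t] != 0.

Lemma derive_rational_sum k l (g : 'rV[K]_n -> K^o) :
  (forall w, off_poles w -> g w = rational_sum k w) ->
  forall w, off_poles w ->
  'D_(delta_mx ord0 l) g w = rational_sum (fun t => k t + (t == l))%N w.
Proof.
move=> gE w w_off; set x := w ord0 l.
pose Cst al := c al * \prod_(t | t != l)
   ((dnum (r t) (p al t) (k t)).[w ord0 t] / (r t).[w ord0 t] ^+ (k t).+1).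
pose pp : {poly K} := \sum_(al <- s) Cst al *: dnum (r l) (p al l) (k l).
pose RR : {poly K} := r l ^+ (k l).+1.
have RRx : RR.[x] != 0 by rewrite horner_exp expf_neq0.
(* The numerator of the increment of [pp / RR] from [x]. It vanishes at [x], and its quotient by
   ['X - x] gives the difference quotient explicitly. *)
pose u : {poly K} := RR.[x] *: pp - pp.[x] *: RR.
have ux : u.[x] = 0 by rewrite hornerD hornerN !hornerZ mulrC subrr.
have line h : (h *: delta_mx ord0 l + w) ord0 l = x + h.
  by rewrite !mxE !eqxx mulr1 addrC.
have line' h t : t != l -> (h *: delta_mx ord0 l + w) ord0 t = w ord0 t.
  by move=> /negbTE tl; rewrite !mxE tl andbF mulr0 add0r.
have sumE (h : K) : rational_sum k (h *: delta_mx ord0 l + w) = pp.[x + h] / RR.[x + h].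
  rewrite /pp horner_sum mulr_suml; apply: eq_bigr => al _.
  rewrite (bigD1 l)//= line hornerZ /RR horner_exp /Cst -!mulrA; congr (_ * _).
  rewrite [RHS]mulrC -!mulrA; congr (_ * (_ * _)).
  by apply: eq_bigr => t tl; rewrite line'.
apply: (derive_difference_quotient (q := fun h => (diffq u x).[x + h] / (RR.[x + h] * RR.[x]))).
  (* The formula for [g] holds off the poles only; a small move in the coordinate [l] stays off
     them. *)
  have near_off := near_horner_neq0 RRx.
  near=> h; have RRh : RR.[x + h] != 0 by near: h.
  have h_off : off_poles (h *: delta_mx ord0 l + w).
    move=> t; have [->|tl] := eqVneq t l; last by rewrite line'.
    by move: RRh; rewrite line horner_exp expf_eq0 /=.
  have gw : g w = pp.[x] / RR.[x].
    by rewrite gE// -[w in LHS]add0r -[X in X + w](scale0r (delta_mx ord0 l)) sumE addr0.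
  rewrite gE// sumE gw; have := congr1 (horner^~ (x + h)) (diffqE u x).
  rewrite ux subr0 hornerM hornerXsubC addrAC subrr add0r => E.
  rewrite mulrA [h * _]mulrC E /u hornerD hornerN !hornerZ.
  by rewrite [RR.[x] * _]mulrC -mulNr addf_div// mulrC ![_ * RR.[x]]mulrC; congr (_ / _); ring.
have -> : rational_sum (fun t => k t + (t == l))%N w = (diffq u x).[x] / (RR.[x] * RR.[x]).
  have -> : (diffq u x).[x] = u^`().[x].
    have := congr1 (fun v : {poly K} => v^`().[x]) (diffqE u x).
    rewrite ux subr0 /= derivM derivXsubC mulr1 hornerD hornerM hornerXsubC subrr.
    by rewrite mulr0 add0r.
  have rx : (r l).[x] != 0 by apply: w_off.
  transitivity ((pp^`() * r l - (pp * (r l)^`()) *+ (k l).+1).[x] / (r l).[x] ^+ (k l).+2).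
    have -> : pp^`() * r l - (pp * (r l)^`()) *+ (k l).+1 =
        \sum_(al <- s) Cst al *: dnum (r l) (p al l) (k l).+1.
      rewrite /pp raddf_sum !mulr_suml -sumrMnl -sumrB; apply: eq_bigr => al _.
      by rewrite /= derivZ scalerBr -!scalerAl scalerMnr.
    rewrite horner_sum mulr_suml; apply: eq_bigr => al _.
    rewrite (bigD1 l)//= eqxx addn1 hornerZ /Cst -!mulrA; congr (_ * _).
    rewrite -/x [RHS]mulrC -!mulrA; congr (_ * (_ * _)).
    by apply: eq_bigr => t /negbTE ->; rewrite addn0.
  rewrite /u derivD derivN !derivZ /RR deriv_exp /= !(hornerE, hornerMn).
  rewrite !exprS; set y := (r l).[x]; set z := y ^+ k l.
  have z0 : z != 0 by rewrite expf_neq0.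
  by field; rewrite rx z0.
have FF := nbhs_filter (0 : K).
apply: cvgM; first by apply: cvg_horner; apply: cvg_shift0.
apply: cvgV; first by rewrite mulf_neq0.
apply: cvgM; last exact: cvg_cst.
by apply: cvg_horner; apply: cvg_shift0.
Unshelve. all: by end_near. Qed.

Lemma eq_rational_sum k k' : k =1 k' -> rational_sum k =1 rational_sum k'.
Proof.
by move=> kk' w; apply: eq_bigr => al _; congr (_ * _); apply: eq_bigr => t _; rewrite kk'.
Qed.

End RationalDerivative.

Section MixedDerivative.
Variables (R : realType) (n : nat) (I : eqType) (s : seq I) (c : I -> R[i]).
Variables (p : I -> 'I_n -> {poly R[i]}) (r : 'I_n -> {poly R[i]}).

Lemma mixed_pderiv_rational_sum (b : 'I_n -> nat) (g : 'rV[R[i]]_n -> R[i]) :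
  (forall w, off_poles r w -> g w = rational_sum s c p r (fun=> 0%N) w) ->
  forall w, off_poles r w -> mixed_pderiv b g w = rational_sum s c p r b w.
Proof.
move=> gE.
have iter_step m l k (h : 'rV[R[i]]_n -> R[i]) :
    (forall w, off_poles r w -> h w = rational_sum s c p r k w) ->
    forall w, off_poles r w ->
      iter m (pderiv l) h w = rational_sum s c p r (fun t => k t + (t == l) * m)%N w.
  move=> hE; elim: m => [|m IHm] w w_off.
    by rewrite /= hE//; apply: eq_rational_sum => t; rewrite muln0 addn0.
  rewrite iterS /pderiv (derive_rational_sum l IHm)//.
  by apply: eq_rational_sum => t; rewrite mulnS addnCA addnC.
have foldr_step (ls : seq 'I_n) w : off_poles r w ->
    foldr (fun l h => iter (b l) (pderiv l) h) g ls w =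
    rational_sum s c p r (fun t => \sum_(l <- ls) (t == l) * b l)%N w.
  elim: ls w => [|l ls IHls] w w_off /=.
    by rewrite gE//; apply: eq_rational_sum => t; rewrite big_nil.
  rewrite (iter_step _ _ _ _ IHls)//; apply: eq_rational_sum => t.
  by rewrite big_cons addnC.
move=> w w_off; rewrite /mixed_pderiv foldr_step//; apply: eq_rational_sum => t.
rewrite big_enum/= (bigD1 t)//= eqxx mul1n big1 ?addn0// => l /negbTE lt.
by rewrite eq_sym lt.
Qed.

End MixedDerivative.

Section ReducedIntegrand.
Variables (R : realType) (n : nat) (a : 'I_n -> 'I_n -> R[i]) (m : 'I_n -> 'I_n -> nat).
Variables (c : 'I_n -> {mpoly R[i][n]}) (gam K : multinom n) (J : 'S_n).
Hypothesis m_gt0 : forall i j, (0 < m i j)%N.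
Hypothesis a_neq : forall i k j, i != k -> a i j != a k j.
Local Notation E := (pole_order a m c K).
Local Notation num := (numerator a m c gam K).

Lemma meval_numerator (w : 'rV[R[i]]_n) : num.@[w] =
  (Delta a m c).@[w] * (\prod_k w ord0 k ^+ (gam k).+1) * \prod_i (Qt a m c i).@[w] ^+ K i.
Proof.
rewrite /numerator !mevalM [X in X * _ = _]mulrC; congr (_ * _ * _);
  rewrite rmorph_prod; apply: eq_bigr => i _; rewrite rmorphXn //=.
by rewrite mevalXU.
Qed.

(** The product, given row by row, is regrouped by variables: in the variable [t] there remain all
    rows other than [J t]. *)
Lemma meval_qKIJ (w : 'rV[R[i]]_n) : (qKIJ a m c K J).@[w] =
  \prod_t (cofactor_poly (a ^~ t) (J t) (E ^~ t)).[w ord0 t].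
Proof.
rewrite /qKIJ rmorph_prod.
transitivity (\prod_l \prod_(t | t != l) (w ord0 t - a (J l) t) ^+ E (J l) t).
  apply: eq_bigr => l _; rewrite rmorphXn rmorph_prod -prodrXl; apply: eq_bigr => t _ /=.
  by rewrite rmorphXn /= mevalB mevalXU mevalC -exprM mulnC.
rewrite (exchange_big_dep xpredT)//=; apply: eq_bigr => t _.
rewrite /cofactor_poly horner_prod [RHS](reindex_inj (@perm_inj _ J)) /=.
apply: eq_big => [l|l _]; first by rewrite (inj_eq perm_inj) eq_sym.
by rewrite horner_exp hornerXsubC.
Qed.

Lemma mixed_pderiv_reduced :
  mixed_pderiv (beta a m c K J) (reduced_integrand a m c gam K J) (aJ a J) =
  (\prod_l (beta a m c K J l)`!)%:R * mresidue_at a E J num.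
Proof.
pose r t := cofactor_poly (a ^~ t) (J t) (E ^~ t).
have a_inj := a_inj a_neq.
rewrite (@mixed_pderiv_rational_sum _ _ _ (msupp num) (fun al => mcoeff al num)
  (fun al t => 'X^(al t)) r); last first.
- by move=> t; rewrite mxE; apply: cofactor_poly_neq0.
- move=> w _; rewrite /reduced_integrand mulrA -meval_numerator meval_qKIJ mevalE mulr_suml.
  apply: eq_bigr => al _; rewrite -mulrA; congr (_ * _).
  rewrite -prodfV -big_split; apply: eq_bigr => t _ /=.
  by rewrite hornerXn expr1.
rewrite /rational_sum /mresidue_at /mlinear mulr_sumr; apply: eq_bigr => al _.
rewrite mulrCA; congr (_ * _); rewrite natr_prod -big_split; apply: eq_bigr => t _ /=.
have ->: residue (a^~ t) (J t) (E^~ t) 'X^(al t) =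
    (dnum (r t) 'X^(al t) (beta a m c K J t)).[a (J t) t] /
    (r t).[a (J t) t] ^+ (beta a m c K J t).+1 / (beta a m c K J t)`!%:R.
  (* The truncated subtraction in [beta] is exact since [mexp] is positive: the derivative has order
     one less than the pole. *)
  have Eb : E (J t) t = (beta a m c K J t).+1.
    rewrite /pole_order /beta mulnC subn1 prednK// muln_gt0 /= andbT.
    exact: mexp_gt0.
  by rewrite /residue Eb.
by rewrite mxE [RHS]mulrC divfK// pnatr_eq0 -lt0n fact_gt0.
Qed.

End ReducedIntegrand.

Local Open Scope complex_scope.

(** * Torus integrals *)

Section CircleIntegral.
Variable R : realType.
Local Notation C := R[i].
Local Notation Re := complex.Re.
Local Notation Im := complex.Im.
Local Notation normc := ComplexField.Normc.normc.
Implicit Types (h : R -> C).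

(** Componentwise, because [cintegral] is defined through real and imaginary parts. *)
Definition ctsC h := continuous (fun t => Re (h t)) /\ continuous (fun t => Im (h t)).

Lemma ctsC_cst (z : C) : ctsC (fun=> z).
Proof. by split => x; exact: cvg_cst. Qed.

Lemma ReD (x y : C) : Re (x + y) = Re x + Re y. Proof. by case: x y => ? ? []. Qed.
Lemma ImD (x y : C) : Im (x + y) = Im x + Im y. Proof. by case: x y => ? ? []. Qed.
Lemma ReM (x y : C) : Re (x * y) = Re x * Re y - Im x * Im y. Proof. by case: x y => ? ? []. Qed.
Lemma ImM (x y : C) : Im (x * y) = Re x * Im y + Im x * Re y. Proof. by case: x y => ? ? []. Qed.
Lemma ReV (x : C) : Re x^-1 = Re x * (Re x * Re x + Im x * Im x)^-1.
Proof. by case: x => ? ? /=; rewrite -!expr2. Qed.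
Lemma ImV (x : C) : Im x^-1 = - (Im x * (Re x * Re x + Im x * Im x)^-1).
Proof. by case: x => ? ? /=; rewrite -!expr2 ?mulNr. Qed.

Lemma eqCP (x y : C) : Re x = Re y -> Im x = Im y -> x = y.
Proof. by case: x y => ? ? [? ?] /= -> ->. Qed.

Lemma ctsCD h1 h2 : ctsC h1 -> ctsC h2 -> ctsC (fun t => h1 t + h2 t).
Proof.
move=> [r1 i1] [r2 i2]; split.
  under eq_fun do rewrite ReD.
  by move=> x; apply: cvgD; [exact: r1 | exact: r2].
under eq_fun do rewrite ImD.
by move=> x; apply: cvgD; [exact: i1 | exact: i2].
Qed.

Lemma ctsCM h1 h2 : ctsC h1 -> ctsC h2 -> ctsC (fun t => h1 t * h2 t).
Proof.
move=> [r1 i1] [r2 i2]; split.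
  under eq_fun do rewrite ReM.
  move=> x; apply: cvgB; apply: cvgM;
    by [exact: r1 | exact: r2 | exact: i1 | exact: i2].
under eq_fun do rewrite ImM.
move=> x; apply: cvgD; apply: cvgM;
  by [exact: r1 | exact: r2 | exact: i1 | exact: i2].
Qed.

Lemma sqsum_neq0 (x : C) : x != 0 -> Re x * Re x + Im x * Im x != 0.
Proof.
case: x => a b /=; rewrite eq_complex /= negb_and => ab.
rewrite -!expr2 paddr_eq0 ?sqr_ge0// !sqrf_eq0 negb_and //.
Qed.

Lemma ctsCV h : ctsC h -> (forall t, h t != 0) -> ctsC (fun t => (h t)^-1).
Proof.
move=> [rh ih] h0.
have ctsD : continuous (fun t => (Re (h t) * Re (h t) + Im (h t) * Im (h t))^-1).
  move=> x; apply: cvgV; first exact: sqsum_neq0.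
  by apply: cvgD; apply: cvgM; by [exact: rh | exact: ih].
split.
  under eq_fun do rewrite ReV.
  by move=> x; apply: cvgM; [exact: rh | exact: ctsD].
under eq_fun do rewrite ImV.
by move=> x; apply: cvgN; apply: cvgM; [exact: ih | exact: ctsD].
Qed.

Lemma ctsCX h k : ctsC h -> ctsC (fun t => h t ^+ k).
Proof.
move=> ch; elim: k => [|k IHk]; first exact: ctsC_cst.
by under eq_fun do rewrite exprS; apply: ctsCM.
Qed.

Lemma ctsC_prod (I : Type) (s : seq I) (A : I -> R -> C) :
  (forall i, ctsC (A i)) -> ctsC (fun t => \prod_(i <- s) A i t).
Proof.
move=> cA; elim: s => [|i s IHs]; first by under eq_fun do rewrite big_nil; exact: ctsC_cst.
by under eq_fun do rewrite big_cons; apply: ctsCM.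
Qed.

Lemma ctsC_sum (I : Type) (s : seq I) (A : I -> R -> C) :
  (forall i, ctsC (A i)) -> ctsC (fun t => \sum_(i <- s) A i t).
Proof.
move=> cA; elim: s => [|i s IHs]; first by under eq_fun do rewrite big_nil; exact: ctsC_cst.
by under eq_fun do rewrite big_cons; apply: ctsCD.
Qed.

Lemma ctsC_horner (p : {poly C}) h : ctsC h -> ctsC (fun t => p.[h t]).
Proof.
move=> ch; under eq_fun do rewrite horner_coef.
by apply: ctsC_sum => i; apply: ctsCM; [exact: ctsC_cst | exact: ctsCX].
Qed.

Definition expi (t : R) : C := cos t +i* sin t.

Lemma ctsC_expi : ctsC expi.
Proof. by split; [exact: continuous_cos | exact: continuous_sin]. Qed.

Local Notation I02 := (`[0 : R, 2 * pi]%classic).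
Local Notation intR f := (Rintegral lebesgue_measure I02 f).
Local Notation intC h := (cintegral 0 (2 * pi) h).

Lemma integrable_cts (f : R -> R) : continuous f ->
  lebesgue_measure.-integrable I02 (EFin \o f).
Proof.
move=> cf; apply: continuous_compact_integrable; first exact: segment_compact.
exact: continuous_subspaceT.
Qed.

Lemma twopi_gt0 : 0 < 2 * pi :> R.
Proof. by rewrite mulr_gt0// pi_gt0. Qed.

Lemma intR_cst (r : R) : intR (fun=> r) = r * (2 * pi).
Proof.
rewrite Rintegral_cst//= lebesgue_measure_itv /= lte_fin twopi_gt0 /=.
by rewrite oppr0 addr0.
Qed.

Lemma cintegral_linear z h1 h2 : ctsC h1 -> ctsC h2 ->
  intC (fun t => z * h1 t + h2 t) = z * intC h1 + intC h2.
Proof.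
move=> [r1 i1] [r2 i2].
have lin (x y : R) (f g k : R -> R) : continuous f -> continuous g -> continuous k ->
    intR (fun t => x * f t + y * g t + k t) = x * intR f + y * intR g + intR k.
  move=> cf cg ck.
  have cxf : continuous (fun t => x * f t).
    by move=> t; apply: cvgM; [exact: cvg_cst | exact: cf].
  have cyg : continuous (fun t => y * g t).
    by move=> t; apply: cvgM; [exact: cvg_cst | exact: cg].
  rewrite RintegralD//; [|by apply: integrable_cts => t; apply: cvgD; [exact: cxf | exact: cyg] |
    exact: integrable_cts].
  rewrite RintegralD//; try exact: integrable_cts.
  by rewrite !RintegralZl//; exact: integrable_cts.
apply: eqCP.
  rewrite ReD ReM /= -mulNr -lin//; congr (Rintegral _ _ _); apply/funext => t.
  by rewrite ReD ReM mulNr.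
rewrite ImD ImM /= -lin//; congr (Rintegral _ _ _); apply/funext => t.
by rewrite ImD ImM.
Qed.

Lemma intR_FTC (F f : R -> R) : (forall x : R, is_derive x (1 : R) F (f x)) -> continuous f ->
  intR f = F (2 * pi) - F 0.
Proof.
move=> dF cf.
have cF : continuous F.
  by move=> x; apply/differentiable_continuous/derivable1_diffP; have [] := dF x.
rewrite /Rintegral (@continuous_FTC2 _ _ F) ?twopi_gt0//.
- exact: continuous_subspaceT.
- split.
  + by move=> x _; have [] := dF x.
  + by apply: cvg_at_right_filter; exact: cF.
  + by apply: cvg_at_left_filter; exact: cF.
- by move=> x _; rewrite derive1E; have [_ ->] := dF x.
Qed.

Lemma continuous_cosM (k : R) : continuous (fun t => cos (k * t)).
Proof.
move=> x; apply: continuous_comp; last exact: continuous_cos.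
by apply: cvgM; [exact: cvg_cst | exact: cvg_id].
Qed.

Lemma continuous_sinM (k : R) : continuous (fun t => sin (k * t)).
Proof.
move=> x; apply: continuous_comp; last exact: continuous_sin.
by apply: cvgM; [exact: cvg_cst | exact: cvg_id].
Qed.

Lemma is_derive_mulL (k x : R) : is_derive x (1 : R) (fun t => k * t) k.
Proof.
have : is_derive x (1 : R) (k \*: (@id R)) (k *: (1 : R)) by exact: is_deriveZ.
by rewrite /GRing.scale /= mulr1.
Qed.

Lemma sin_2pi_nat k : sin (k%:R * (2 * pi)) = 0 :> R /\ cos (k%:R * (2 * pi)) = 1 :> R.
Proof.
elim: k => [|k [IHs IHc]]; first by rewrite mul0r sin0 cos0.
rewrite -natr1 mulrDl mul1r sinD cosD IHs IHc [2 * pi]mulrC mulr_natr sin2pi cos2pi.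
by rewrite !mul0r !mul1r addr0 subr0.
Qed.

Lemma intR_cos k : intR (fun t => cos (k.+1%:R * t)) = 0.
Proof.
have k0 : k.+1%:R != 0 :> R by rewrite pnatr_eq0.
have dF (x : R) : is_derive x (1 : R) (fun t => k.+1%:R^-1 * sin (k.+1%:R * t)) (cos (k.+1%:R * x)).
  have dsin : is_derive x (1 : R) (sin \o ( *%R k.+1%:R)) (k.+1%:R * cos (k.+1%:R * x)).
    have := @is_derive1_comp R sin ( *%R k.+1%:R) x _ _ (is_derive_sin _) (is_derive_mulL _ x).
    by rewrite mulrC.
  have := @is_deriveZ R R R (sin \o ( *%R k.+1%:R)) k.+1%:R^-1 x 1 _ dsin.
  by rewrite /GRing.scale /= mulKf.
rewrite (@intR_FTC _ _ dF (@continuous_cosM _)).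
by have [-> _] := sin_2pi_nat k.+1; rewrite !mulr0 sin0 mulr0 subrr.
Qed.

Lemma intR_sin k : intR (fun t => sin (k.+1%:R * t)) = 0.
Proof.
have k0 : k.+1%:R != 0 :> R by rewrite pnatr_eq0.
have dF (x : R) : is_derive x (1 : R) (fun t => - k.+1%:R^-1 * cos (k.+1%:R * t)) (sin (k.+1%:R * x)).
  have dcos : is_derive x (1 : R) (cos \o ( *%R k.+1%:R)) (k.+1%:R * - sin (k.+1%:R * x)).
    have := @is_derive1_comp R cos ( *%R k.+1%:R) x _ _ (is_derive_cos _) (is_derive_mulL _ x).
    by rewrite mulrC.
  have := @is_deriveZ R R R (cos \o ( *%R k.+1%:R)) (- k.+1%:R^-1) x 1 _ dcos.
  by rewrite /GRing.scale /= mulrN mulrNN mulKf.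
rewrite (@intR_FTC _ _ dF (@continuous_sinM _)).
by have [_ ->] := sin_2pi_nat k.+1; rewrite mulr0 cos0 subrr.
Qed.

Lemma expi_norm t : normc (expi t) = 1.
Proof. by rewrite /= cos2Dsin2 sqrtr1. Qed.

Lemma expi_neq0 t : expi t != 0.
Proof.
apply/eqP => /(congr1 (@ComplexField.Normc.normc R)); rewrite expi_norm ComplexField.Normc.normc0.
by apply/eqP; rewrite oner_eq0.
Qed.

Lemma expiX t k : expi t ^+ k = cos (k%:R * t) +i* sin (k%:R * t).
Proof.
elim: k => [|k IHk]; first by rewrite mul0r cos0 sin0 expr0.
rewrite exprSr IHk -natr1 mulrDl mul1r cosD sinD; apply: eqCP.
  by rewrite ReM.
by rewrite ImM /= addrC [X in X + _]mulrC [X in _ + X]mulrC addrC.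
Qed.

Lemma expiV t : (expi t)^-1 = cos t +i* - sin t.
Proof. by apply: eqCP => /=; rewrite cos2Dsin2 ?divr1// ?invr1 ?mulr1. Qed.

Lemma expiVX t k : (expi t)^-1 ^+ k = cos (k%:R * t) +i* - sin (k%:R * t).
Proof.
by rewrite exprVn expiX -[cos _ +i* sin _]/(expi (k%:R * t)) expiV.
Qed.

Lemma cintegral_cst (z : C) : intC (fun=> z) = z * (2 * pi)%:C.
Proof.
case: z => x y; rewrite /cintegral /= !intR_cst; apply: eqCP; rewrite ?ReM ?ImM /=.
  by rewrite mulr0 subr0.
by rewrite mulr0 add0r.
Qed.

Lemma cintegral_expi k : intC (fun t => expi t ^+ k.+1) = 0.
Proof.
under eq_fun do rewrite expiX.
by rewrite /cintegral /= intR_cos intR_sin.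
Qed.

Lemma cintegral_expiV k : intC (fun t => (expi t)^-1 ^+ k.+1) = 0.
Proof.
under eq_fun do rewrite expiVX.
rewrite /cintegral /= intR_cos.
have -> : intR (fun t => - sin (k.+1%:R * t)) = 0.
  have -> : (fun t => - sin (k.+1%:R * t)) = (fun t : R => -1 * sin (k.+1%:R * t)).
    by apply/funext => t; rewrite mulN1r.
  rewrite RintegralZl ?intR_sin ?mulr0//; exact/integrable_cts/continuous_sinM.
by [].
Qed.

Lemma cintegralD h1 h2 : ctsC h1 -> ctsC h2 ->
  intC (fun t => h1 t + h2 t) = intC h1 + intC h2.
Proof.
move=> c1 c2; rewrite -[in RHS](mul1r (intC h1)) -cintegral_linear//.
by under [in RHS]eq_fun do rewrite mul1r.
Qed.

Lemma cintegralZ z h : ctsC h -> intC (fun t => z * h t) = z * intC h.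
Proof.
move=> ch; have := cintegral_linear z ch (ctsC_cst 0); rewrite cintegral_cst mul0r addr0 => <-.
by under [in RHS]eq_fun do rewrite addr0.
Qed.

Lemma cintegral_sum (I : Type) (s : seq I) (A : I -> R -> C) : (forall i, ctsC (A i)) ->
  intC (fun t => \sum_(i <- s) A i t) = \sum_(i <- s) intC (A i).
Proof.
move=> cA; elim: s => [|i s IHs].
  by rewrite big_nil; under eq_fun do rewrite big_nil; rewrite cintegral_cst mul0r.
rewrite big_cons -IHs; under eq_fun do rewrite big_cons.
by rewrite cintegralD//; apply: ctsC_sum.
Qed.

Lemma cintegral_horner (p : {poly C}) : p`_0 = 0 -> intC (fun t => p.[expi t]) = 0.
Proof.
move=> p0; under eq_fun do rewrite horner_coef.
have cX k : ctsC (fun t => expi t ^+ k) by apply/ctsCX/ctsC_expi.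
rewrite cintegral_sum => [|k]; last by apply: ctsCM; [exact: ctsC_cst | exact: cX].
rewrite big1// => -[[|k] lt_k] _ /=.
  by under eq_fun do rewrite p0 mul0r; rewrite cintegral_cst mul0r.
by rewrite cintegralZ// cintegral_expi mulr0.
Qed.

Lemma normc_Re_Im (z : C) : `|Re z| <= normc z /\ `|Im z| <= normc z.
Proof.
case: z => x y /=; rewrite -(sqrtr_sqr x) -(sqrtr_sqr y).
by split; apply: ler_wsqrtr; rewrite ?lerDl ?lerDr ?sqr_ge0.
Qed.

Lemma normc_le (z : C) : normc z <= `|Re z| + `|Im z|.
Proof.
case: z => x y /=; rewrite -(ler_pXn2r (n := 2))// ?nnegrE ?addr_ge0 ?sqrtr_ge0//.
rewrite sqr_sqrtr ?addr_ge0 ?sqr_ge0// sqrrD !real_normK ?num_real//.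
by rewrite -addrA lerD2l lerDr mulrn_wge0// mulr_ge0.
Qed.

(** The factor 2 comes from bounding the two parts separately; it is harmless, as the bound serves
    only for [M] tending to 0. *)
Lemma cintegral_bound h M : ctsC h -> (forall t, normc (h t) <= M) ->
  normc (intC h) <= 2 * (M * (2 * pi)).
Proof.
move=> [cr ci] hM.
have bound (f : R -> R) : continuous f -> (forall t, `|f t| <= M) -> `|intR f| <= M * (2 * pi).
  move=> cf fM; apply: le_trans (le_normr_Rintegral _ (integrable_cts cf)) _ => //.
  rewrite -intR_cst; apply: le_Rintegral => //; apply: integrable_cts; last by move=> t; exact: cvg_cst.
  by move=> t; apply: cvg_norm; exact: cf.
have -> : 2 * (M * (2 * pi)) = M * (2 * pi) + M * (2 * pi) by ring.
apply: le_trans (normc_le _) _; apply: lerD; apply: bound => // t.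
  exact: le_trans (normc_Re_Im _).1 (hM t).
exact: le_trans (normc_Re_Im _).2 (hM t).
Qed.

End CircleIntegral.

(** * Circle and torus integrals as residues *)

Section CircleResidue.
Variable R : realType.
Local Notation C := R[i].
Local Notation normc := ComplexField.Normc.normc.
Local Notation intC h := (cintegral 0 (2 * pi) h).
Implicit Types (h : R -> C) (p : {poly C}).

Lemma normc_real (x : R) : 0 <= x -> normc x%:C = x.
Proof. by move=> x0; rewrite /= expr0n /= addr0 sqrtr_sqr ger0_norm. Qed.

Lemma normc_ge0 (z : C) : 0 <= normc z.
Proof. by case: z => x y /=; apply: sqrtr_ge0. Qed.

Lemma normcX (z : C) k : normc (z ^+ k) = normc z ^+ k.
Proof.
elim: k => [|k IHk]; first by rewrite !expr0 ComplexField.Normc.normc1.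
by rewrite !exprS ComplexField.Normc.normcM IHk.
Qed.

Lemma normc_horner (p : {poly C}) z : normc z = 1 -> normc p.[z] <= \sum_(k < size p) normc p`_k.
Proof.
move=> z1; rewrite horner_coef; elim/big_rec2: _ => [|k x y _ le_yx].
  by rewrite ComplexField.Normc.normc0.
apply: le_trans (le_normcD _ _) _; apply: lerD => //.
by rewrite ComplexField.Normc.normcM normcX z1 expr1n mulr1.
Qed.

Lemma geometric_le0 (x c q : R) : 0 <= q < 1 -> (forall N, x <= c * q ^+ N) -> x <= 0.
Proof.
move=> /andP[q0 q1] le_x.
have cvg0 : (fun N => c * q ^+ N) @ \oo --> 0.
  rewrite -[X in _ --> X](mulr0 c); apply: cvgM; first exact: cvg_cst.
  by apply: cvg_expr; rewrite ger0_norm.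
by rewrite leNgt; apply/negP => x0; have [N _ /(_ N (leqnn N))] := cvgr_lt 0 cvg0 x x0; rewrite /= ltNge le_x.
Qed.

Section FarPole.
Variables (d : C) (r : R).
Hypotheses (r_gt0 : 0 < r) (rd : r < normc d).

Lemma d_neq0 : d != 0.
Proof.
apply/eqP => d0; move: rd; rewrite d0 ComplexField.Normc.normc0 => /(lt_trans r_gt0).
by rewrite ltxx.
Qed.

Lemma far_norm t : normc d - r <= normc (d + r%:C * expi t).
Proof.
rewrite lerBlDr {1}(_ : d = (d + r%:C * expi t) + - (r%:C * expi t)); last by ring.
apply: le_trans (le_normcD _ _) _.
by rewrite normcN ComplexField.Normc.normcM expi_norm mulr1 normc_real ?(ltW r_gt0).
Qed.

Lemma far_neq0 t : d + r%:C * expi t != 0.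
Proof.
apply/eqP => E; have := far_norm t; rewrite E ComplexField.Normc.normc0 subr_le0.
by rewrite leNgt rd.
Qed.

Lemma ctsC_far : ctsC (fun t => (d + r%:C * expi t)^-1).
Proof.
apply: ctsCV far_neq0; apply: ctsCD; first exact: ctsC_cst.
by apply: ctsCM; [exact: ctsC_cst | exact: ctsC_expi].
Qed.

(* The inverse of [d + r e^{it}] is a geometric series in [e^{it}]. *)
Lemma cintegral_far n p : p`_0 = 0 ->
  intC (fun t => p.[expi t] * (d + r%:C * expi t)^-1 ^+ n) = 0.
Proof.
elim: n p => [|n IHn] p p0.
  by under eq_fun do rewrite expr0 mulr1; apply: cintegral_horner.
pose z : C := - (r%:C / d).
have cp (u : {poly C}) k : ctsC (fun t => u.[expi t] * (d + r%:C * expi t)^-1 ^+ k).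
  apply: ctsCM; first exact/ctsC_horner/ctsC_expi.
  exact/ctsCX/ctsC_far.
pose M := (\sum_(k < size p) normc p`_k) * (normc d - r)^-1 ^+ n.+1.
pose q := r / normc d.
have d_gt0 : 0 < normc d by apply: lt_trans rd.
have dr_gt0 : 0 < normc d - r by rewrite subr_gt0.
apply: ComplexField.Normc.eq0_normc; apply: le_anti; rewrite normc_ge0 andbT.
apply: (@geometric_le0 _ (2 * (M * (2 * pi))) q).
  by rewrite /q divr_ge0 ?ltW//= ltr_pdivrMr// mul1r.
(* [A] is the truncated series and [B] its remainder, of constant modulus [q ^+ N] on the unit
   circle. *)
move=> N; pose A : {poly C} := d^-1 *: \sum_(k < N) (z *: 'X) ^+ k.
pose B : {poly C} := (z *: 'X) ^+ N.
have AB t : (d + r%:C * expi t)^-1 = A.[expi t] + B.[expi t] * (d + r%:C * expi t)^-1.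
  apply: (mulfI (far_neq0 t)); rewrite mulrDr mulrCA !divff ?far_neq0// mulr1.
  have zE : d + r%:C * expi t = d * (1 - z * expi t).
    by rewrite /z; field; rewrite d_neq0.
  have -> : A.[expi t] = d^-1 * \sum_(k < N) (z * expi t) ^+ k.
    rewrite hornerZ horner_sum; congr (_ * _); apply: eq_bigr => k _.
    by rewrite horner_exp hornerZ hornerX.
  have -> : B.[expi t] = (z * expi t) ^+ N by rewrite horner_exp hornerZ hornerX.
  rewrite zE mulrACA divff ?d_neq0// mul1r.
  have := subrXX 1 (z * expi t) N; rewrite expr1n.
  under eq_bigr do rewrite expr1n mul1r.
  by move=> <-; rewrite subrK.
(* The part with [A] has one pole factor less and still no constant term, so it integrates to 0 by
   induction. The part with [B] is at most a constant times [q ^+ N], for every [N]. *)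
have -> : intC (fun t => p.[expi t] * (d + r%:C * expi t)^-1 ^+ n.+1) =
    intC (fun t => (p * B).[expi t] * (d + r%:C * expi t)^-1 ^+ n.+1).
  rewrite -[RHS]add0r -(IHn (p * A)); last by rewrite coefM big_ord_recl big_ord0 p0 mul0r addr0.
  rewrite -cintegralD//; congr (cintegral _ _ _); apply/funext => t.
  rewrite exprSr {2}AB !hornerM; ring.
rewrite [X in _ <= X](_ : _ = 2 * ((M * q ^+ N) * (2 * pi))); last by ring.
apply: cintegral_bound => [|t]; first exact: cp.
rewrite hornerM !ComplexField.Normc.normcM normcX ComplexField.Normc.normcV /M.
have nB : normc B.[expi t] = q ^+ N.
  rewrite horner_exp hornerZ hornerX normcX ComplexField.Normc.normcM expi_norm mulr1.
  by rewrite /z normcN ComplexField.Normc.normcM ComplexField.Normc.normcV normc_real ?(ltW r_gt0).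
rewrite nB mulrAC; apply: ler_wpM2r; first by rewrite exprn_ge0// divr_ge0 ?ltW.
apply: ler_pM; rewrite ?normc_ge0 ?exprn_ge0 ?invr_ge0 ?normc_ge0//.
  exact/normc_horner/expi_norm.
apply: lerXn2r; [by rewrite nnegrE invr_ge0 normc_ge0 | by rewrite nnegrE invr_ge0 ltW|].
by rewrite lef_pV2 ?posrE ?far_norm//; apply: lt_le_trans (far_norm t).
Qed.

End FarPole.

Section OneCircle.
Variables (n : nat) (b : 'I_n -> C) (l : 'I_n) (r : R).
Hypotheses (b_inj : injective b) (r_gt0 : 0 < r).
Hypothesis r_small : forall k, k != l -> r < normc (b l - b k).

Lemma rC_neq0 : r%:C != 0.
Proof. by apply/eqP => -[] r0; have := r_gt0; rewrite r0 ltxx. Qed.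

Lemma on_circle_neq0 k t : b l + r%:C * expi t - b k != 0.
Proof.
have [->|kl] := eqVneq k l; first by rewrite addrAC subrr add0r mulf_neq0 ?rC_neq0 ?expi_neq0.
by rewrite addrAC; apply: far_neq0 => //; apply: r_small.
Qed.

Lemma ctsC_circle : ctsC (fun t => b l + r%:C * expi t).
Proof.
apply: ctsCD; first exact: ctsC_cst.
by apply: ctsCM; [exact: ctsC_cst | exact: ctsC_expi].
Qed.

Lemma ctsC_on_circle (e : 'I_n -> nat) p :
  ctsC (fun t => p.[b l + r%:C * expi t] * \prod_k (b l + r%:C * expi t - b k)^-1 ^+ e k).
Proof.
apply: ctsCM; first exact/ctsC_horner/ctsC_circle.
apply: ctsC_prod => k; apply: ctsCX; apply: ctsCV (on_circle_neq0 k).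
by apply: ctsCD; [exact: ctsC_circle | exact: ctsC_cst].
Qed.

Lemma ctsC_dz : ctsC (fun t => (0 +i* 1) * (r%:C * expi t)).
Proof.
apply: ctsCM; first exact: ctsC_cst.
by apply: ctsCM; [exact: ctsC_cst | exact: ctsC_expi].
Qed.

(** By [fraction_ind] only polynomials and single poles matter. A pole other than the centre lies
    outside the circle and is covered by [cintegral_far]; a pole of order [m.+1] at the centre
    leaves a multiple of e^{-imt}, whose integral is nonzero for [m = 0] only. *)
Lemma circle_residue (e : 'I_n -> nat) p :
  circle_integral (b l) r (fun x => p.[x] * \prod_k (x - b k)^-1 ^+ e k) =
  (0 +i* (2 * pi)) * residue b l e p.
Proof.
pose T e p := circle_integral (b l) r (fun x => p.[x] * \prod_k (x - b k)^-1 ^+ e k).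
pose U e p := (0 +i* (2 * pi)) * residue b l e p.
rewrite -/(T e p) -/(U e p); apply: (fraction_ind b_inj) => {e p}.
- move=> e c p q; rewrite /T /circle_integral /= -cintegral_linear.
  + congr (cintegral _ _ _); apply/funext => t.
    by rewrite hornerD hornerZ !mulrDl !mulrA.
  + by apply: ctsCM; [exact: ctsC_on_circle | exact: ctsC_dz].
  + by apply: ctsCM; [exact: ctsC_on_circle | exact: ctsC_dz].
- by move=> e c p q; rewrite /U residue_linear mulrDr mulrCA.
- move=> e k p; rewrite /T /circle_integral /=; congr (cintegral _ _ _); apply/funext => t.
  congr (_ * _); rewrite -/(expi t) hornerM hornerXsubC -mulrA; congr (_ * _).
  rewrite (bigD1 k)//= [in RHS](bigD1 k)//= /incr eqxx addn1 exprS !mulrA.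
  rewrite mulfV ?on_circle_neq0// mul1r; congr (_ * _).
  by apply: eq_bigr => j /negbTE ->; rewrite addn0.
- by move=> e k p; rewrite /U residue_incr.
- move=> e p e0; rewrite /U residue0// mulr0 /T /circle_integral /=.
  (* The integrand as a polynomial in e^{it}; the differential dz provides the factor that kills its
     constant term. *)
  pose q : {poly C} := (p \Po (r%:C *: 'X + (b l)%:P)) * (((0 +i* 1) * r%:C) *: 'X).
  rewrite -[RHS](@cintegral_horner R q); last by rewrite /q -scalerAr coefZ coefMX mulr0.
  congr (cintegral _ _ _); apply/funext => t; rewrite -/(expi t).
  rewrite big1 ?mulr1 => [|k _]; last by rewrite e0 expr0.
  by rewrite /q hornerM horner_comp !(hornerD, hornerZ, hornerX, hornerC) addrC !mulrA.
- move=> e k m ek; rewrite /U (residue_pole b l ek) /T /circle_integral /=.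
  have E t : (1 : {poly C}).[b l + r%:C * expi t] * \prod_j (b l + r%:C * expi t - b j)^-1 ^+ e j =
      (b l + r%:C * expi t - b k)^-1 ^+ m.+1.
    rewrite hornerC mul1r (bigD1 k)//= ek eqxx mul1n big1 ?mulr1// => j /negbTE jk.
    by rewrite ek jk.
  have [lk|lk] := eqVneq l k; last first.
    rewrite mul0r mulr0.
    rewrite -[RHS](@cintegral_far (b l - b k) r r_gt0 _ m.+1 (((0 +i* 1) * r%:C) *: 'X)).
    + congr (cintegral _ _ _); apply/funext => t; rewrite -/(expi t) E mulrC addrAC.
      by rewrite hornerZ hornerX mulrA.
    + by apply: r_small; rewrite eq_sym.
    + by rewrite coefZ coefX mulr0.
  rewrite mul1r.
  have -> : (fun t : R => (1 : {poly C}).[b l + r%:C * (cos t +i* sin t)] *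
      \prod_j (b l + r%:C * (cos t +i* sin t) - b j)^-1 ^+ e j *
      ((0 +i* 1) * (r%:C * (cos t +i* sin t)))) =
     (fun t => ((0 +i* 1) * r%:C^-1 ^+ m) * (expi t)^-1 ^+ m).
    apply/funext => t; rewrite -/(expi t) E -lk addrAC subrr add0r invfM exprMn !exprS.
    by field; rewrite rC_neq0 expi_neq0.
  case: m ek E => [|m] ek E.
    rewrite (_ : (fun t => _) = (fun=> 0 +i* 1)); last first.
      by apply/funext => t; rewrite !expr0 !mulr1.
    rewrite cintegral_cst mulr1; apply: eqCP; rewrite ?ReM ?ImM /=.
      by rewrite mul0r mulr0 subr0.
    by rewrite mul0r mul1r add0r.
  rewrite cintegralZ ?cintegral_expiV ?mulr0//.
  by apply/ctsCX/ctsCV; [exact: ctsC_expi | exact: expi_neq0].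
- by move=> e e' ee' p; congr (circle_integral _ _ _); apply/funext => x; congr (_ * _);
    apply: eq_bigr => k _; rewrite ee'.
- by move=> e e' ee' p; rewrite /U (eq_residue b l p ee').
Qed.

End OneCircle.

Lemma circle_integral_sum (I : Type) (s : seq I) (z0 : C) (r : R) (c : I -> C) (g : I -> C -> C) :
  (forall i, ctsC (fun t => g i (z0 + r%:C * expi t))) ->
  circle_integral z0 r (fun z => \sum_(i <- s) c i * g i z) =
  \sum_(i <- s) c i * circle_integral z0 r (g i).
Proof.
move=> cg; rewrite /circle_integral /=.
have cgz i : ctsC (fun t => g i (z0 + r%:C * (cos t +i* sin t)) * ((0 +i* 1) * (r%:C * (cos t +i* sin t)))).
  by apply: ctsCM; [exact: cg | exact: ctsC_dz].
under [RHS]eq_bigr do rewrite -cintegralZ//.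
rewrite -cintegral_sum; last by move=> i; apply: ctsCM; [exact: ctsC_cst | exact: cgz].
congr (cintegral _ _ _); apply/funext => t; rewrite mulr_suml; apply: eq_bigr => i _.
by rewrite !mulrA.
Qed.

(** Variables separate in each summand, so every inner integral is a constant factor and no theorem
    of Fubini is called for. The claim [step] describes the state after the variables of [ls] are
    integrated. *)
Lemma torus_integral_sum n (I : Type) (s : seq I) (z0 : 'rV[C]_n) (eps : 'I_n -> R) (c : I -> C)
    (g : I -> 'I_n -> C -> C) :
  (forall i l, ctsC (fun t => g i l (z0 ord0 l + (eps l)%:C * expi t))) ->
  torus_integral z0 eps (fun w => \sum_(i <- s) c i * \prod_l g i l (w ord0 l)) =
  \sum_(i <- s) c i * \prod_l circle_integral (z0 ord0 l) (eps l) (g i l).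
Proof.
move=> cg; rewrite /torus_integral.
have step (ls : seq 'I_n) : uniq ls -> forall w,
    foldr (fun k G w => circle_integral (z0 ord0 k) (eps k) (fun z => G (upd w k z)))
      (fun w => \sum_(i <- s) c i * \prod_l g i l (w ord0 l)) ls w =
    \sum_(i <- s) c i * \prod_l (if l \in ls then circle_integral (z0 ord0 l) (eps l) (g i l)
                                  else g i l (w ord0 l)).
  elim: ls => [//|k ls IHls] /= /andP[k_ls ls_uniq] w.
  pose A i := c i * \prod_(l | l != k) (if l \in ls then circle_integral (z0 ord0 l) (eps l) (g i l)
                                  else g i l (w ord0 l)).
  transitivity (circle_integral (z0 ord0 k) (eps k) (fun z => \sum_(i <- s) A i * g i k z)).
    congr (circle_integral _ _ _); apply/funext => z; rewrite IHls//.
    apply: eq_bigr => i _; rewrite (bigD1 k)//= (negbTE k_ls) mxE eqxx /A -[RHS]mulrA.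
    congr (_ * _); rewrite [RHS]mulrC; congr (_ * _).
    by apply: eq_bigr => l /negbTE lk; rewrite mxE lk.
  rewrite circle_integral_sum//; apply: eq_bigr => i _.
  rewrite /A [in RHS](bigD1 k)//= inE eqxx /= -mulrA; congr (_ * _); rewrite mulrC; congr (_ * _).
  by apply: eq_bigr => l /negbTE lk; rewrite inE lk.
rewrite step ?enum_uniq//; apply: eq_bigr => i _; congr (_ * _).
by apply: eq_bigr => l _; rewrite mem_enum.
Qed.

Section TorusResidue.
Variables (n : nat) (a : 'I_n -> 'I_n -> C) (m : 'I_n -> 'I_n -> nat).
Variables (c : 'I_n -> {mpoly C[n]}) (gam K : multinom n) (J : 'S_n) (eps : 'I_n -> R).
Hypothesis a_neq : forall i k j, i != k -> a i j != a k j.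
Hypothesis eps_gt0 : forall k, 0 < eps k.
Hypothesis eps_small : forall i k, i != J k -> eps k < normc (a (J k) k - a i k).
Local Notation E := (pole_order a m c K).

Lemma meval_qt i (w : 'rV[C]_n) : (qt a m c i).@[w] = \prod_l (w ord0 l - a i l) ^+ mexp a m c i l.
Proof.
rewrite rmorph_prod; apply: eq_bigr => l _.
by rewrite rmorphXn /= mevalB mevalXU mevalC.
Qed.

Lemma torus_integral_integrand :
  torus_integral (aJ a J) eps (integrand a m c gam K) =
  (0 +i* (2 * pi)) ^+ n * mresidue_at a E J (numerator a m c gam K).
Proof.
pose g (al : multinom n) l x := ('X^(al l) : {poly C}).[x] * \prod_i (x - a i l)^-1 ^+ E i l.
have -> : integrand a m c gam K = fun w =>
    \sum_(al <- msupp (numerator a m c gam K))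
      mcoeff al (numerator a m c gam K) * \prod_l g al l (w ord0 l).
  apply/funext => w; rewrite /integrand mulrA -meval_numerator mevalE mulr_suml.
  apply: eq_bigr => al _; rewrite -mulrA; congr (_ * _); rewrite /g big_split/=.
  congr (_ * _); first by apply: eq_bigr => l _; rewrite hornerXn.
  rewrite exchange_big -prodfV; apply: eq_bigr => i _ /=.
  rewrite meval_qt -prodrXl -prodfV; apply: eq_bigr => l _.
  by rewrite exprVn -exprM mulnC.
rewrite torus_integral_sum => [|al l]; last first.
  rewrite mxE; apply: (@ctsC_on_circle n (a ^~ l) (J l) (eps l)) => // k.
  exact: eps_small.
rewrite /mresidue_at /mlinear mulr_sumr; apply: eq_bigr => al _.
rewrite mulrCA; congr (_ * _).
rewrite (eq_bigr (fun l => (0 +i* (2 * pi)) * residue (a^~ l) (J l) (E^~ l) 'X^(al l))).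
  by rewrite big_split/= prodr_const card_ord.
move=> l _; rewrite mxE; apply: circle_residue => //; first exact: a_inj.
by move=> k; apply: eps_small.
Qed.

End TorusResidue.
End CircleResidue.

Lemma column_gap (R : realType) (n : nat) (a : 'I_n -> 'I_n -> R[i]) :
  (forall i k j, i != k -> a i j != a k j) ->
  exists2 delta : R, 0 < delta &
    forall i k j, i != k -> delta <= ComplexField.Normc.normc (a k j - a i j).
Proof.
move=> a_neq.
pose gap (t : 'I_n * 'I_n * 'I_n) := ComplexField.Normc.normc (a t.1.2 t.2 - a t.1.1 t.2).
(* The default 1 serves the case [n = 1], where no two rows can be compared. *)
exists (\big[Order.min/1]_(t | t.1.1 != t.1.2) gap t) => [|i k j ik]; last first.
  exact: (@bigmin_le_cond _ _ _ _ (i, k, j) (fun t => t.1.1 != t.1.2) gap).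
apply/bigmin_gtP; split=> // t tt; rewrite lt_def normc_ge0 andbT.
apply/eqP => /ComplexField.Normc.eq0_normc /eqP.
by rewrite subr_eq0 eq_sym (negbTE (a_neq _ _ _ tt)).
Qed.

Lemma finite_has_msum (R : realType) n (A : set (multinom n)) (u : multinom n -> R[i]) :
  finite_set A -> (forall K, ~ A K -> u K = 0) -> has_msum u (\sum_(K \in A) u K).
Proof.
move=> finA u0 e e0; exists (fset_set A) => B AB.
rewrite fsbig_finite//= -(big_fset_incl _ AB) => [|K _].
  by rewrite subrr normr0 ltcR.
by rewrite in_fset_set// => /negP; rewrite in_setE; apply: u0.
Qed.

(* Both right-hand sides carry the sign (-1)^{||K|| + n}, hence the factor
   (-1)^n in front of the power sum: for n = 1, f = 1 - z, gam = 0 the power sum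
   is 1 while the right-hand sides are -1. *)
Theorem theorem8 (R : realType) (n : nat) (n_gt0 : (0 < n)%N)
    (a : 'I_n -> 'I_n -> R[i]) (m : 'I_n -> 'I_n -> nat)
    (c : 'I_n -> {mpoly R[i][n]}) (gam : multinom n)
    (m_gt0 : forall i j, (0 < m i j)%N)
    (a_neq : forall i k j, i != k -> a i j != a k j)
    (degQ : forall i j, a i j != 0 -> (degz j (Q c i) <= m i j)%N) :
  (exists zs : seq 'rV[R[i]]_n, zeros_with_multiplicity (sys a m c) zs) /\
  forall zs : seq 'rV[R[i]]_n, zeros_with_multiplicity (sys a m c) zs ->
    let sigma := \sum_(z <- zs) \prod_k (z ord0 k) ^- (gam k).+1 in
    (exists2 delta : R, 0 < delta &
       forall eps : 'S_n -> 'I_n -> R, (forall J k, 0 < eps J k < delta) ->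
       exists2 S : R[i],
         has_msum (fun K => (-1) ^+ (mdeg K + n) *
           \sum_(J : 'S_n) (-1) ^+ J *
             torus_integral (aJ a J) (eps J) (integrand a m c gam K)) S &
         (-1) ^+ n * sigma = (0 +i* (2 * pi)) ^- n * S) /\
    (-1) ^+ n * sigma =
      \sum_(K \in frakR gam) (-1) ^+ (mdeg K + n) *
        \sum_(J : 'S_n) (-1) ^+ J / (\prod_l (beta a m c K J l)`!)%:R *
          mixed_pderiv (beta a m c K J) (reduced_integrand a m c gam K J) (aJ a J).
Proof.
have [zs_ex sigmaE] := power_sum_residues n_gt0 m_gt0 a_neq degQ.
split=> // zs zsP sigma; have finR := finite_frakR gam.
pose res K := mresidue a (pole_order a m c K) (numerator a m c gam K).
have {sigmaE} sigE : (-1) ^+ n * sigma = \sum_(K \in frakR gam) (-1) ^+ (mdeg K + n) * res K.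
  rewrite /sigma (sigmaE zs zsP gam) !fsbig_finite//= mulr_sumr.
  by apply: eq_bigr => K _; rewrite exprD mulrA [_ * (-1) ^+ n]mulrC.
split; last first.
  rewrite sigE; apply: eq_fsbigr => K _; congr (_ * _); apply: eq_bigr => J _.
  rewrite mixed_pderiv_reduced// mulrA divfK// pnatr_eq0 -lt0n prodn_gt0// => l.
  exact: fact_gt0.
have [delta delta_gt0 gap] := column_gap a_neq.
exists delta => // eps eps_delta.
pose u K := (-1) ^+ (mdeg K + n) * \sum_(J : 'S_n) (-1) ^+ J *
  torus_integral (aJ a J) (eps J) (integrand a m c gam K).
(* The bound [delta] keeps every other [a i k] outside the circle around [a (J k) k], and each of
   the [n] circles contributes a factor 2 pi i. *)
have uE K : u K = (0 +i* (2 * pi)) ^+ n * ((-1) ^+ (mdeg K + n) * res K).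
  rewrite /u mulrCA; congr (_ * _); rewrite mulr_sumr; apply: eq_bigr => J _.
  rewrite (@torus_integral_integrand _ _ a m c gam K J (eps J))// 1?mulrCA// => [k|i k iJ].
    by have /andP[] := eps_delta J k.
  by apply: lt_le_trans (gap _ _ k iJ); have /andP[] := eps_delta J k.
exists (\sum_(K \in frakR gam) u K).
  apply: finite_has_msum=> //.
  by move=> K KR; rewrite -/(u K) uE /res residue_notin_frakR// !mulr0.
have pi_neq0 : (0 +i* (2 * pi) : R[i]) != 0.
  by apply/eqP => -[] /eqP; rewrite mulf_eq0 pnatr_eq0/= gt_eqF// pi_gt0.
rewrite sigE !fsbig_finite//= mulr_sumr; apply: eq_bigr => K _.
by rewrite uE mulKf// expf_neq0.
Qed.
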